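(* Let $V$ be a smooth irreducible complex algebraic variety of complex dimension $2n$ ($n\ge1$), let $\omega$ be a non-degenerate closed holomorphic $2$-form on $V$, and let $f:V\dashrightarrow V$ be a birational map with $f^*\omega=\omega$. If $f$ is integrable (in the isotropic way), then the Lie algebra of the Malgrange groupoid of $f$ is commutative, i.e. $[X,Y]=0$ for any two of its sections $X,Y$ over a common open subset of $V$.
   Context: Integrability. For $H\in\mathbb{C}(V)$ the symplectic gradient $X_H$ is the rational vector field with $dH=\omega(X_H,\cdot)$; $H$ is a first integral of $f$ if $H\circ f=H$. The map $f$ is integrable (in the isotropic way) if, for some integer $\ell$ with $0\le \ell\le n$, it admits $n+\ell$ functionally independent first integrals $H_1,\dots,H_{n+\ell}\in\mathbb{C}(V)$ (differentials linearly independent on a Zariski dense open subset) such that the distribution $\bigcap_{i}\ker dH_i$ is generated over $\mathbb{C}(V)$ by $X_{H_1},\dots,X_{H_{n-\ell}}$. Frame bundles. Put $m=\dim V$. For $q\in\mathbb{N}$, $R_qV$ is the algebraic variety of order $q$ jets $j_q(r)$ at $0$ of invertible maps $r:(\mathbb{C}^m,0)\to V$ (arbitrary target point). Local coordinates $r_1,\dots,r_m$ on an open $U\subset V$ induce coordinates $r_i^\alpha$ ($1\le i\le m$, $\alpha\in\mathbb{N}^m$, $|\alpha|\le q$) on the part $R_qU$ of $R_qV$ above $U$, where $r_i^\alpha$ is the $\alpha$-th partial derivative of $r_i$ at $0$ (and $r_i^0=r_i$). Prolongation of $f$: $R_qf:R_qV\dashrightarrow R_qV$, $(R_qf)(j_q(r))=j_q(f\circ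 r)$. Differential invariants: $\mathcal{D}_qInv(f)$ is the set of rational functions $H:R_qV\dashrightarrow\mathbb{C}$ with $H\circ R_qf=H$. Prolongation of vector fields: let $D_j=\sum_{i,\alpha}r_i^{\alpha+\epsilon(j)}\frac{\partial}{\partial r_i^\alpha}$, where $\epsilon(j)\in\mathbb{N}^m$ is the $j$-th unit multi-index (so $D_j$ sends functions on $R_qU$ to functions on $R_{q+1}U$), and $D^\alpha=D_1^{\alpha_1}\cdots D_m^{\alpha_m}$. For a holomorphic vector field $X=\sum_i a_i\frac{\partial}{\partial r_i}$ on $U$, $R_qX=\sum_{i,\,|\alpha|\le q}(D^\alpha a_i)\frac{\partial}{\partial r_i^\alpha}$, a vector field on $R_qU$. Lie algebra of the Malgrange groupoid of $f$: the analytic sheaf on $V$ whose sections are the holomorphic vector fields $X$ on open subsets of $V$ such that $(R_qX)H=0$ for all $q\in\mathbb{N}$ and all $H\in\mathcal{D}_qInv(f)$. *)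

(* Defs.v *)
From HB Require Import structures.
From mathcomp Require Import all_boot all_order all_algebra.
From mathcomp Require Import all_classical all_reals all_analysis.
From mathcomp Require Import complex.
(* The notations of mpoly clash with those of MathComp-Analysis. *)
From mathcomp Require Import -(notations) mpoly.
Set Implicit Arguments.
Unset Strict Implicit.
Unset Printing Implicit Defensive.
Import Order.TTheory GRing.Theory Num.Theory.
Import numFieldNormedType.Exports.
Local Open Scope classical_set_scope.
Local Open Scope ring_scope.

(** [C : numClosedFieldType] is meant to be [R[i]] with [R : realType]. *)

(** * Varieties, in the style of Weil and Serre

    A space covered by finitely many sets [dom i], each identified with a
    subset of an affine space by coordinates [crd i].  Only the union of the
    [dom i] is relevant, and [crd i] is only relevant on [dom i]. *)

Record atlas (C : numClosedFieldType) := Atlas {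
  pt :> Type;
  chart : finType;
  adim : chart -> nat;
  dom : chart -> set pt;
  crd : forall i : chart, pt -> 'rV[C]_(adim i) }.

Definition peval (C : numClosedFieldType) (N : nat)
    (p : mpoly N C) (v : 'rV[C]_N) : C :=
  meval (fun k => v 0 k) p.

Section Algebraic.
Variables (C : numClosedFieldType) (V : atlas C).
Implicit Types (O U : set V) (g h : V -> C).

Definition zopen O := forall x, O x ->
  (exists i, dom i x) /\
  forall i, dom i x -> exists Q : mpoly (adim i) C,
    peval Q (crd i x) != 0 /\
    forall y, dom i y -> peval Q (crd i y) != 0 -> O y.

Definition regular_at g (x : V) := forall i, dom i x ->
  exists P Q : mpoly (adim i) C,
    peval Q (crd i x) != 0 /\
    forall y, dom i y -> peval Q (crd i y) != 0 ->
      g y = peval P (crd i y) / peval Q (crd i y).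

(** On an irreducible variety a nonempty Zariski open set is dense, so that
    [generic P] means "[P] holds on a Zariski dense open set". *)
Definition generic (P : V -> Prop) :=
  exists U, [/\ zopen U, U !=set0 & forall x, U x -> P x].

(** A rational function is represented by a total function, whose values
    outside of some nonempty Zariski open set are meaningless; rational
    functions are to be compared with [generic]. *)
Definition ratfun g := generic (regular_at g).

Definition irreducible := [set: V] !=set0 /\
  forall O U, zopen O -> zopen U -> O !=set0 -> U !=set0 ->
    (O `&` U) !=set0.

(** Smoothness of dimension [m] (Jacobian criterion): on a Zariski
    neighborhood of [x], the image of [crd i] is cut out by [adim i - m]
    equations with linearly independent differentials at [x]. *)
Definition smooth_at (m : nat) (i : chart V) (x : V) :=
  exists (c : nat) (p : 'I_c -> mpoly (adim i) C)
         (Q : mpoly (adim i) C),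
  [/\ (c + m)%N = adim i,
      forall a y, dom i y -> peval (p a) (crd i y) = 0,
      \rank (\matrix_(a < c, k < adim i)
               peval (mderiv k (p a)) (crd i x)) = c,
      peval Q (crd i x) != 0
    & forall v, peval Q v != 0 -> (forall a, peval (p a) v = 0) ->
        exists2 y, dom i y & crd i y = v].

Record smooth_irreducible_variety (m : nat) : Prop := {
  var_cover : forall x : V, exists i, dom i x;
  var_inj : forall i (x y : V),
    dom i x -> dom i y -> crd i x = crd i y -> x = y;
  (* the charts are affine *)
  var_affine : forall i : chart V, exists S : set (mpoly (adim i) C),
    forall v, (exists2 x, dom i x & crd i x = v) <->
              (forall p, S p -> peval p v = 0);
  var_dom_open : forall i : chart V, zopen (dom i);
  var_compat : forall (i : chart V) k (x : V), dom i x ->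
    regular_at (fun y => crd i y 0 k) x;
  (* the diagonal is closed *)
  var_separated : forall i j : chart V,
    exists S : set (mpoly (adim i + adim j) C),
    forall x y, dom i x -> dom j y ->
      (x = y <-> forall p, S p -> peval p (row_mx (crd i x) (crd j y)) = 0);
  var_irreducible : irreducible;
  var_smooth : forall i (x : V), dom i x -> smooth_at m i x }.

(** Continuity of [f] on [U] follows by pulling back indicator functions of
    Zariski open sets, which are regular on these sets. *)
Definition morphism_on U (f : V -> V) :=
  forall x, U x -> forall g, regular_at g (f x) -> regular_at (g \o f) x.

(** The rational map is represented by a total function, as for rational
    functions. *)
Definition birational (f : V -> V) :=
  exists (U W : set V) (g : V -> V),
  [/\ zopen U, zopen W & U !=set0] /\
  [/\ morphism_on U f, morphism_on W g,
      forall x, U x -> W (f x) /\ g (f x) = x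
    & forall y, W y -> U (g y) /\ f (g y) = y].

Definition first_integral (f : V -> V) (H : V -> C) :=
  ratfun H /\ generic (fun x => H (f x) = H x).

End Algebraic.

(** * The underlying complex manifold *)

Section Holomorphic.
Variables (C : numClosedFieldType) (V : atlas C).
Implicit Types (O U W : set V) (g h : V -> C) (x : V).

(** Neighborhoods for the transcendental topology. *)
Definition anbhs x O := forall i, dom i x ->
  \forall v \near crd i x, forall y, dom i y -> crd i y = v -> O y.

Definition aopen O := forall x, O x -> anbhs x O.

(** [g] is holomorphic in a neighborhood of [x]. *)
Definition hol_at g x := forall i, dom i x ->
  exists G : 'rV[C]_(adim i) -> C,
  \forall v \near crd i x, differentiable G v /\
    forall y, dom i y -> crd i y = v -> g y = G v.

(** [s] is holomorphic in a neighborhood of [z]; continuity follows by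
    pulling back indicator functions of open sets. *)
Definition holmap_at (E : normedModType C) (s : E -> V) (z : E) :=
  forall g, hol_at g (s z) -> \forall z' \near z, differentiable (g \o s) z'.

Definition tvec := (V -> C) -> C.
Definition vfield := V -> tvec.

(** Tangent vectors at [x] act on germs of holomorphic functions; a value is
    irrelevant, and set to 0, on functions not holomorphic near [x]. *)
Definition on_germs x (u : tvec) : tvec :=
  fun g => if `[< hol_at g x >] then u g else 0.

(** Tangent vectors are velocities of holomorphic curves. *)
Definition tangent x (u : tvec) := exists gamma : C -> V,
  [/\ gamma 0 = x, holmap_at gamma 0 &
      u = on_germs x (fun g => 'D_1 (g \o gamma) 0)].

Definition holvf W (X : vfield) :=
  (forall x, W x -> tangent x (X x)) /\
  (forall x g, W x -> hol_at g x -> hol_at (fun y => X y g) x).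

Definition bracket (X Y : vfield) : vfield := fun x =>
  on_germs x (fun g => X x (fun y => Y y g) - Y x (fun y => X y g)).

Definition ratvf (X : vfield) := exists U,
  [/\ zopen U, U !=set0, holvf U X &
      forall x g, U x -> regular_at g x -> regular_at (fun y => X y g) x].

(** ** Differential 2-forms *)

Definition form2 := V -> tvec -> tvec -> C.

Record holomorphic_form (w : form2) : Prop := {
  form_linear : forall x a u v t, tangent x u -> tangent x v -> tangent x t ->
    w x (fun g => a * u g + v g) t = a * w x u t + w x v t;
  form_alternating : forall x u v, tangent x u -> tangent x v ->
    w x u v = - w x v u;
  form_holomorphic : forall W X Y, aopen W -> holvf W X -> holvf W Y ->
    forall x, W x -> hol_at (fun y => w y (X y) (Y y)) x }.

Definition nondegenerate_form (w : form2) := forall x u, tangent x u ->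
  (forall v, tangent x v -> w x u v = 0) -> u = (fun=> 0).

(** dw = 0, with dw given by Cartan's formula. *)
Definition closed_form (w : form2) := forall W X Y Z, aopen W ->
  holvf W X -> holvf W Y -> holvf W Z -> forall x, W x ->
  X x (fun y => w y (Y y) (Z y))
  - Y x (fun y => w y (X y) (Z y))
  + Z x (fun y => w y (X y) (Y y))
  - w x (bracket X Y x) (Z x)
  + w x (bracket X Z x) (Y x)
  - w x (bracket Y Z x) (X x) = 0.

Definition pushforward (f : V -> V) x (u : tvec) : tvec :=
  on_germs (f x) (fun g => u (g \o f)).

Definition preserves (f : V -> V) (w : form2) := generic (fun x =>
  forall u v, tangent x u -> tangent x v ->
    w (f x) (pushforward f x u) (pushforward f x v) = w x u v).

(** ** Integrability *)

(** [w] is only assumed holomorphic, so that the existence of a rational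
    vector field [X] with dH = w(X, .) is a condition on [H]. *)
Definition symplectic_gradient (w : form2) (H : V -> C) (X : vfield) :=
  ratvf X /\
  generic (fun x => forall v, tangent x v -> v H = w x (X x) v).

Definition functionally_independent (k : nat) (H : 'I_k -> V -> C) :=
  generic (fun x => forall c : 'I_k -> C,
    (forall v, tangent x v -> \sum_(i < k) c i * v (H i) = 0) ->
    forall i, c i = 0).

(** The distribution is the C(V)-vector space of the rational vector fields
    annihilating all the [H i]. *)
Definition kernel_generated_by (k l : nat) (H : 'I_k -> V -> C)
    (X : 'I_l -> vfield) :=
  forall Y, ratvf Y ->
    ((forall i, generic (fun x => Y x (H i) = 0)) <->
     exists c : 'I_l -> V -> C, (forall j, ratfun (c j)) /\
       generic (fun x => Y x = (fun g => \sum_(j < l) c j x * X j x g))).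

Definition low_index (n l : nat) : 'I_(n - l) -> 'I_(n + l) :=
  widen_ord (leq_trans (leq_subr l n) (leq_addr l n)).

Definition integrable_isotropic (n : nat) (w : form2) (f : V -> V) :=
  exists l : nat, (l <= n)%N /\
  exists (H : 'I_(n + l) -> V -> C) (X : 'I_(n - l) -> vfield),
  [/\ forall i, first_integral f (H i),
      functionally_independent H,
      forall j, symplectic_gradient w (H (low_index j)) (X j)
    & kernel_generated_by H X].

End Holomorphic.

(** * Frame bundles and the Malgrange groupoid *)

Section MultiIndices.
Variables (C : numClosedFieldType) (m : nat).

(** op_1^{alpha_1} ... op_m^{alpha_m} *)
Definition multipower (T : Type) (op : 'I_m -> T -> T)
    (alpha : multinom m) (F : T) : T :=
  foldr (fun j => iter (alpha j) (op j)) F (enum 'I_m).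

Definition partial (alpha : multinom m) :
    ('rV[C]_m -> C) -> 'rV[C]_m -> C :=
  multipower (fun j g z => 'D_(delta_mx 0 j) g z) alpha.

(** The coordinates r_i^alpha. *)
Definition jcoord := 'I_m -> multinom m -> C.

Definition jcoord_upd (rho : jcoord) (i : 'I_m) (alpha : multinom m)
    (t : C) : jcoord :=
  fun i' alpha' =>
    if (i' == i) && (alpha' == alpha) then t else rho i' alpha'.

Definition djcoord (i : 'I_m) (alpha : multinom m)
    (F : jcoord -> C) : jcoord -> C :=
  fun rho =>
    'D_1 (fun t : C => F (jcoord_upd rho i alpha t)) (rho i alpha).

(** D_j; the sum has finite support when [F] has finite order. *)
Definition total_derivative (j : 'I_m) (F : jcoord -> C) : jcoord -> C :=
  fun rho => \sum_(p \in [set: 'I_m * multinom m])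
    rho p.1 (mnm_add p.2 (mnm1 j)) * djcoord p.1 p.2 F rho.

Definition base (rho : jcoord) : 'rV[C]_m :=
  \row_(i < m) rho i (@mnm0 m).

Definition linear_part (rho : jcoord) : 'M[C]_m :=
  \matrix_(i < m, j < m) rho i (mnm1 j).

(** The polynomial map with jet [rho] of order [q] at 0. *)
Definition taylor (q : nat) (rho : jcoord) (z : 'rV[C]_m) : 'rV[C]_m :=
  \row_(i < m) \sum_(alpha : bmultinom m q.+1)
    rho i alpha * \prod_(j < m) (z 0 j ^+ alpha j / ((alpha j)`!)%:R).

End MultiIndices.

Section Jets.
Variables (C : numClosedFieldType) (V : atlas C) (m q : nat).
Implicit Types (r s : 'rV[C]_m -> V).

Definition invertible_germ r := holmap_at r 0 /\
  exists t : V -> 'rV[C]_m,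
  [/\ forall k, hol_at (fun x => t x 0 k) (r 0),
      \forall z \near (0 : 'rV[C]_m), t (r z) = z
    & anbhs (r 0) [set x | r (t x) = x]].

Definition same_jet r s := r 0 = s 0 /\
  forall i, dom i (r 0) -> forall k (alpha : multinom m),
    (mdeg alpha <= q)%N ->
    partial alpha (fun z => crd i (r z) 0 k) 0 =
    partial alpha (fun z => crd i (s z) 0 k) 0.

(** j_q(r), as the class of all invertible germs with the same jet. *)
Definition jet r : set ('rV[C]_m -> V) :=
  [set s | invertible_germ s /\ same_jet r s].

Definition jet_entry (i : chart V) r
    (k : 'I_(adim i) * bmultinom m q.+1) : C :=
  partial k.2 (fun z => crd i (r z) 0 k.1) 0.

(** R_qV: above [dom i], a jet is given by the partial derivatives of order
    at most [q] of the coordinates [crd i]. *)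
Definition frame_bundle : atlas C :=
  @Atlas C (set ('rV[C]_m -> V)) (chart V)
    (fun i => #|{: 'I_(adim i) * bmultinom m q.+1}|)
    (fun i => [set J | exists r,
       [/\ invertible_germ r, dom i (r 0) & J = jet r]])
    (fun i J => xget 0 [set c | exists2 r, J r &
       c = \row_k jet_entry r (enum_val k)]).

(** D_qInv(f) *)
Definition diff_invariant (f : V -> V) (H : frame_bundle -> C) :=
  ratfun H /\
  generic (fun J : frame_bundle => forall r, J r -> H (jet (f \o r)) = H J).

(** Local coordinates [r] on [U], with inverse [s]. *)
Definition local_coordinates (U : set V) (r : V -> 'rV[C]_m) s :=
  [/\ aopen U,
      forall x, U x -> (forall k, hol_at (fun y => r y 0 k) x) /\ s (r x) = x,
      open (r @` U)
    & forall x, U x -> holmap_at s (r x)].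

Section Prolongation.
Variables (r : V -> 'rV[C]_m) (s : 'rV[C]_m -> V).

(** [H] in the coordinates of R_qU *)
Definition in_jcoord (H : frame_bundle -> C) : jcoord C m -> C :=
  fun rho => H (jet (s \o taylor q rho)).

(** a_i, where X = \sum_i a_i d/dr_i, as a function on R_0U *)
Definition component (X : vfield V) (i : 'I_m) : jcoord C m -> C :=
  fun rho => X (s (base rho)) (fun y => r y 0 i).

(** (R_qX)H *)
Definition prolong (X : vfield V) (H : frame_bundle -> C) : jcoord C m -> C :=
  fun rho => \sum_(i < m) \sum_(alpha : bmultinom m q.+1)
    multipower (@total_derivative C m) alpha (component X i) rho *
    djcoord i alpha (in_jcoord H) rho.

End Prolongation.
End Jets.

(** Sections on [W] of the Lie algebra of the Malgrange groupoid of [f], for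
    [m] the dimension of [V].  The equation (R_qX)H = 0 is required wherever
    [H] is regular. *)
Definition malgrange_section (C : numClosedFieldType) (V : atlas C) (m : nat)
    (f : V -> V) (W : set V) (X : vfield V) :=
  [/\ aopen W, holvf W X &
  forall q (H : frame_bundle V m q -> C), diff_invariant f H ->
  forall U r s, U `<=` W -> local_coordinates U r s ->
  forall rho : jcoord C m,
    (r @` U) (base rho) -> linear_part rho \in unitmx ->
    regular_at H (jet q (s \o taylor q rho)) ->
    prolong r s X H rho = 0].

(* Main.v *)
(** Everything is compared at generic points.  For a first integral [H] the function
    J |-> H (r 0) of the jet J of r is an invariant, so that a section X of the Lie
    algebra satisfies X H = 0.  The Hamiltonian fields X_j (j < n - l) are preserved
    by f, as f preserves both w and the H_j; hence their components in a frame are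
    invariants of order 1, and evaluating (R_1 X) on them gives [X, X_j] = 0.
    Moreover [X_i, X_j] = 0, because X_j H_i = 0 and w is closed.  At a generic
    point the X_j are n - l independent vectors in the common kernel of n + l
    independent differentials, so that X = \sum_i c_i X_i and Y = \sum_j d_j X_j
    there, and the three commutation relations give X (Y g) = Y (X g) at this point.
    Since nonempty Zariski open sets are dense, [X, Y] = 0 everywhere.

    Holomorphy means complex differentiability in a neighborhood, so that Goursat's
    theorem (derivatives are differentiable), the symmetry of second derivatives and
    the inverse function theorem for polynomial maps are needed.  Density is proved
    by an algebraic relation between N + 1 polynomials in N variables. *)

From HB Require Import structures.
Require Import Defs.
From mathcomp Require Import all_boot all_order all_algebra.
From mathcomp Require Import all_classical all_reals all_analysis.
From mathcomp Require Import complex zify ring lra.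
From mathcomp Require Import -(notations) mpoly.
Set Implicit Arguments.
Unset Strict Implicit.
Unset Printing Implicit Defensive.
Import Order.TTheory GRing.Theory Num.Theory.
Import numFieldNormedType.Exports.
Local Open Scope classical_set_scope.
Local Open Scope ring_scope.

(** * Cauchy's theorem on squares *)

(** The coefficients of two sections over the Hamiltonian fields are taken at one point only: in X
    (Y g) the outer field is expanded at the point, the commutation relation brings the inner field
    outside, and it is expanded at the same point in turn, so no coefficient is ever differentiated.
    Order 1 suffices for the invariants because [f] carries a frame and a preserved field along
    together, and a vector field prolonged to frames acts on the components of another field as a
    Lie derivative.

    The relations hold at generic points, while a section lives on an arbitrary open set of the
    transcendental topology. Irreducibility is stated with Zariski open sets, so analytic
    continuation from one open set to another would need a connectedness argument; an algebraic
    relation, cancelled down by irreducibility, replaces it. Derivatives are controlled without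
    integrals: trapezoid sums over a square are not shown to converge, and only upper and lower
    bounds valid at all large depths of subdivision are used. *)

Section DifferentiableEps.
Variables (K : numFieldType) (V W : normedModType K).

Lemma diff_eps (f : V -> W) x : differentiable f x -> forall e : K, 0 < e ->
  \forall y \near x, `|f y - f x - 'd f x (y - x)| <= e * `|y - x|.
Proof.
move=> /diff_locallyP[_ /eqaddoP df] e e0.
rewrite (near_shift 0 x); apply: filterS (df e e0) => h /=.
by rewrite subr0 addrK opprD addrA.
Qed.

Lemma eps_diff (f : V -> W) x (df : {linear V -> W}) : continuous df ->
  (forall e : K, 0 < e ->
     \forall y \near x, `|f y - f x - df (y - x)| <= e * `|y - x|) ->
  differentiable f x /\ 'd f x = df :> (V -> W).
Proof.
move=> cdf h.
have H : f \o shift x = cst (f x) + df +o_ (0 : V) id.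
  apply/eqaddoP => e e0 /=; have := h e e0; rewrite (near_shift 0 x).
  by apply: filterS => y /=; rewrite subr0 addrK opprD addrA.
have E := diff_unique cdf H; split => //.
by apply/diff_locallyP; rewrite E.
Qed.
End DifferentiableEps.

(** * Trapezoid sums along segments and quadrilaterals *)

Section Trapezoid.
Variable C : numClosedFieldType.
Implicit Types (q : C -> C) (a b : C).

(* Composite trapezoid sums replace contour integrals: they are exactly additive
   when a contour is subdivided at midpoints. *)
Fixpoint trap (k : nat) q a b : C :=
  if k is k'.+1 then trap k' q a ((a + b) / 2) + trap k' q ((a + b) / 2) b
  else (b - a) * (q a + q b) / 2.

Lemma trapN k q a b : trap k q b a = - trap k q a b.
Proof.
elim: k a b => [|k IH] a b /=; first by rewrite (addrC (q b)) -opprB !mulNr.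
by rewrite (addrC b a) (IH ((a + b) / 2) b) (IH a) opprD [LHS]addrC.
Qed.

Lemma trapD k q1 q2 a b :
  trap k (fun z => q1 z + q2 z) a b = trap k q1 a b + trap k q2 a b.
Proof.
elim: k a b => [|k IH] a b /=; last by rewrite !IH addrACA.
by rewrite addrACA mulrDr mulrDl.
Qed.

Lemma trapZ k q c a b : trap k (fun z => c * q z) a b = c * trap k q a b.
Proof.
elim: k a b => [|k IH] a b /=; last by rewrite !IH mulrDr.
by rewrite -mulrDr mulrCA !mulrA.
Qed.

Lemma trap_rot k q u a b :
  trap k q (u * a) (u * b) = u * trap k (fun z => q (u * z)) a b.
Proof.
elim: k a b => [|k IH] a b /=; first by rewrite -mulrBr !mulrA.
by rewrite -mulrDr -mulrA !IH -mulrDr.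
Qed.

(** The trapezoid rule is exact on affine integrands, so subdivision changes nothing. Closed sums of
    affine integrands therefore vanish at every depth, which removes the linear part of [q] in the
    local estimate of [cauchy_punctured]. *)
Lemma trap_affine k u v a b :
  trap k (fun z => u + v * z) a b = (b - a) * (u + v * ((a + b) / 2)).
Proof.
have n2 : (2 : C) != 0 by rewrite pnatr_eq0.
elim: k a b => [|k IH] a b /=; first by field.
by rewrite !IH; field.
Qed.

Definition quad k q a b c d : C :=
  trap k q a b + trap k q b c + trap k q c d + trap k q d a.

(** An outer side at depth [k.+1] is by definition the sum of its halves at depth [k], and the edges
    ending at [o] are run through in both directions. Hence [o] may be any point. *)
Lemma quad_split k q a b c d o : quad k.+1 q a b c d =
  quad k q a ((a + b) / 2) o ((a + d) / 2)
  + quad k q ((a + b) / 2) b ((b + c) / 2) o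
  + quad k q o ((b + c) / 2) c ((c + d) / 2)
  + quad k q ((a + d) / 2) o ((c + d) / 2) d.
Proof.
rewrite /quad /= (addrC d a).
rewrite (trapN k q ((a + b) / 2) o) (trapN k q ((b + c) / 2) o).
rewrite (trapN k q ((c + d) / 2) o) (trapN k q ((a + d) / 2) o).
by ring.
Qed.

Lemma quadD k q1 q2 a b c d : quad k (fun z => q1 z + q2 z) a b c d =
  quad k q1 a b c d + quad k q2 a b c d.
Proof. by rewrite /quad !trapD; ring. Qed.

Lemma quadZ k q u a b c d :
  quad k (fun z => u * q z) a b c d = u * quad k q a b c d.
Proof. by rewrite /quad !trapZ; ring. Qed.

Lemma quad_affine k u v a b c d : quad k (fun z => u + v * z) a b c d = 0.
Proof.
have n2 : (2 : C) != 0 by rewrite pnatr_eq0.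
by rewrite /quad !trap_affine; field.
Qed.

End Trapezoid.

Definition cplx (R : realType) : numClosedFieldType := R[i].

Import ComplexField.Normc.

(** * Goursat's subdivision argument and a Cauchy formula on squares *)

Section Squares.
Local Notation Re := complex.Re.
Local Notation Im := complex.Im.
Variable R : realType.
Local Notation C := (cplx R).
Local Notation N := (@ComplexField.Normc.normc R).
Implicit Types (q f : C -> C) (x y s : R) (t z : C).

(** Convexity as far as trapezoid sums see it: only iterated midpoints of the end points are
    evaluated. *)
Definition midclosed (P : set C) := forall a b, P a -> P b -> P ((a + b) / 2).

Lemma N_half z : N (z / 2) = N z / 2.
Proof.
rewrite normcM normcV; congr (_ / _).
by rewrite -[2]/(1 + 1)%C /normc /= addr0 expr0n addr0 sqrtr_sqr ger0_norm.
Qed.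

Lemma N_ge0 z : 0 <= N z.
Proof. by case: z => a b; rewrite /normc sqrtr_ge0. Qed.

Lemma N_D z z' : N (z + z') <= N z + N z'.
Proof. exact: le_normcD. Qed.

Lemma N_B z z' : N (z - z') = N (z' - z).
Proof. by rewrite -normcN opprB. Qed.

Lemma trap_le P q M k a b : midclosed P -> P a -> P b ->
  (forall z, P z -> N (q z) <= M) -> N (trap k q a b) <= M * N (b - a).
Proof.
move=> mP; elim: k a b => [|k IH] a b Pa Pb qM /=.
  rewrite N_half normcM; have := qM _ Pa; have := qM _ Pb.
  have := N_D (q a) (q b); have := N_ge0 (b - a).
  by nra.
have Pm := mP _ _ Pa Pb.
apply: le_trans (N_D _ _) _.
have n2 : (2 : C) != 0 by rewrite pnatr_eq0.
have -> : M * N (b - a) = M * N ((a + b) / 2 - a) + M * N (b - (a + b) / 2).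
  have -> : (a + b) / 2 - a = (b - a) / 2 by field.
  have -> : b - (a + b) / 2 = (b - a) / 2 by field.
  by rewrite N_half; field.
by rewrite lerD ?IH.
Qed.

Lemma ReD z z' : Re (z + z') = Re z + Re z'. Proof. by rewrite raddfD. Qed.
Lemma ImD z z' : Im (z + z') = Im z + Im z'. Proof. by rewrite raddfD. Qed.

Lemma Re_half z : Re (z / 2) = Re z / 2.
Proof.
have n2 : (2 : C) != 0 by rewrite pnatr_eq0.
have : Re z = Re (z / 2) + Re (z / 2) by rewrite -ReD; congr Re; field.
lra.
Qed.

Lemma Im_half z : Im (z / 2) = Im z / 2.
Proof.
have n2 : (2 : C) != 0 by rewrite pnatr_eq0.
have : Im z = Im (z / 2) + Im (z / 2) by rewrite -ImD; congr Im; field.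
lra.
Qed.

Definition half2E := (Re_half, Im_half, ReD, ImD).

Lemma complex_eqP z z' : Re z = Re z' -> Im z = Im z' -> z = z'.
Proof. by case: z z' => a b [a' b'] /= -> ->. Qed.

Definition sq k q x y s : C := quad k q (Complex x y) (Complex (x + s) y)
  (Complex (x + s) (y + s)) (Complex x (y + s)).

Definition in_sq x y s z := x <= Re z <= x + s /\ y <= Im z <= y + s.

Definition bd_sq x y s z := in_sq x y s z /\
  (Re z = x \/ Re z = x + s \/ Im z = y \/ Im z = y + s).

Lemma sq_split k q x y s : sq k.+1 q x y s =
  sq k q x y (s / 2) + sq k q (x + s / 2) y (s / 2)
  + sq k q (x + s / 2) (y + s / 2) (s / 2) + sq k q x (y + s / 2) (s / 2).
Proof.
rewrite /sq (quad_split _ _ _ _ _ _ (Complex (x + s / 2) (y + s / 2))).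
have E a b : a + b / 2 + b / 2 = a + b :> R by field.
rewrite !E.
by congr (_ + _ + _ + _); congr (quad _ _); apply: complex_eqP;
  rewrite !half2E /=; field.
Qed.

Lemma sq_le k q x y s M : 0 <= s -> (forall z, bd_sq x y s z -> N (q z) <= M) ->
  N (sq k q x y s) <= 4 * M * s.
Proof.
move=> s0 qM; rewrite /sq /quad.
have L a b P : midclosed P -> P a -> P b -> P `<=` bd_sq x y s ->
    N (b - a) = s -> N (trap k q a b) <= M * s.
  by move=> mP Pa Pb sP <-; apply: (trap_le _ mP) => // z /sP /qM.
have nr u v : N (Complex u 0 * Complex v 0) = `|u * v|.
  by rewrite /normc /= !mulr0 !mul0r subr0 addr0 expr0n addr0 sqrtr_sqr.
have e1 : N (Complex (x + s) y - Complex x y) = s.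
  by rewrite /normc /= subrr expr0n /= addr0 addrC addKr sqrtr_sqr ger0_norm.
have e2 : N (Complex (x + s) (y + s) - Complex (x + s) y) = s.
  by rewrite /normc /= subrr expr0n /= add0r (addrC y) addrK sqrtr_sqr ger0_norm.
have e3 : N (Complex x (y + s) - Complex (x + s) (y + s)) = s.
  rewrite N_B /normc /= subrr expr0n /= addr0 addrC addKr sqrtr_sqr ger0_norm//.
have e4 : N (Complex x y - Complex x (y + s)) = s.
  by rewrite N_B /normc /= subrr expr0n /= add0r (addrC y) addrK sqrtr_sqr ger0_norm.
have M1 c : midclosed (fun z => Im z = c /\ x <= Re z <= x + s).
  by move=> a b /= [A1 /andP[A2 A3]] [B1 /andP[B2 B3]]; rewrite !half2E A1 B1; split; [field|apply/andP; split; lra].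
have M2 c : midclosed (fun z => Re z = c /\ y <= Im z <= y + s).
  by move=> a b /= [A1 /andP[A2 A3]] [B1 /andP[B2 B3]]; rewrite !half2E A1 B1; split; [field|apply/andP; split; lra].
have T1 : N (trap k q (Complex x y) (Complex (x + s) y)) <= M * s.
  apply: (L _ _ _ (M1 y)) => //=; try (by split=> //; apply/andP; split; lra).
  by move=> z [E /andP[F G]]; split; [split; apply/andP; split; lra|right;right;left].
have T2 : N (trap k q (Complex (x+s) y) (Complex (x + s) (y+s))) <= M * s.
  apply: (L _ _ _ (M2 (x+s))) => //=; try (by split=> //; apply/andP; split; lra).
  by move=> z [E /andP[F G]]; split; [split; apply/andP; split; lra|right;left].
have T3 : N (trap k q (Complex (x+s) (y+s)) (Complex x (y+s))) <= M * s.
  apply: (L _ _ _ (M1 (y+s))) => //=; try (by split=> //; apply/andP; split; lra).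
  by move=> z [E /andP[F G]]; split; [split; apply/andP; split; lra|right;right;right].
have T4 : N (trap k q (Complex x (y+s)) (Complex x y)) <= M * s.
  apply: (L _ _ _ (M2 x)) => //=; try (by split=> //; apply/andP; split; lra).
  by move=> z [E /andP[F G]]; split; [split; apply/andP; split; lra|left].
have := N_D; move=> D.
apply: le_trans (D _ _) _; apply: le_trans (lerD (D _ _) (lexx _)) _.
apply: le_trans (lerD (lerD (D _ _) (lexx _)) (lexx _)) _.
lra.
Qed.

(** Bisection, with compactness packaged as an induction principle. If [P] failed, some quarter of
    each bad square would be bad, and nested bad squares would shrink to a point, where the local
    hypothesis excludes them. *)
Lemma square_induction (P : R -> R -> R -> Prop) x0 y0 s0 : 0 < s0 ->
  (forall x y s, 0 < s -> P x y (s / 2) -> P (x + s / 2) y (s / 2) ->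
     P (x + s / 2) (y + s / 2) (s / 2) -> P x (y + s / 2) (s / 2) -> P x y s) ->
  (forall z, in_sq x0 y0 s0 z -> exists2 d, 0 < d & forall x y s,
     0 < s < d -> in_sq x y s z -> P x y s) -> P x0 y0 s0.
Proof.
move=> s00 Psplit Ploc; apply: contrapT => nP0.
pose bad (w : R * R * R) := 0 < w.2 /\ ~ P w.1.1 w.1.2 w.2.
pose sub (w w' : R * R * R) := w'.2 = w.2 / 2 /\
  (w'.1.1 = w.1.1 \/ w'.1.1 = w.1.1 + w.2 / 2) /\
  (w'.1.2 = w.1.2 \/ w'.1.2 = w.1.2 + w.2 / 2).
have ex w : exists w', bad w -> bad w' /\ sub w w'.
  case: w => -[x y] s; have [b|nb] := pselect (bad (x, y, s)); last by exists (x, y, s).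
  move: (b) => [/= s0' nP].
  have h : 0 < s / 2 by lra.
  apply: contrapT => nex; apply: nP; apply: Psplit => //.
  - apply: contrapT => nP; apply: nex; exists (x, y, s / 2) => _; split => //=.
    by split => //=; split; left.
  - apply: contrapT => nP; apply: nex; exists (x + s / 2, y, s / 2) => _; split => //=.
    by split => //=; split; [right|left].
  - apply: contrapT => nP; apply: nex; exists (x + s / 2, y + s / 2, s / 2) => _; split => //=.
    by split => //=; split; right.
  - apply: contrapT => nP; apply: nex; exists (x, y + s / 2, s / 2) => _; split => //=.
    by split => //=; split; [left|right].
have [nxt nxtP] := choice ex.
pose u n := iter n nxt (x0, y0, s0).
have ub n : bad (u n) by elim: n => [|n IH] //=; have [] := nxtP _ IH.
have us n : sub (u n) (u n.+1) by have [] := nxtP _ (ub n).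
have sE n : (u n).2 = s0 / 2 ^+ n.
  elim: n => [|n IH]; first by rewrite expr0 divr1.
  by have [-> _] := us n; rewrite IH exprS invfM mulrA mulrAC.
have s_gt0 n : 0 < (u n).2 by have [] := ub n.
(* [p] is one of the two coordinates of the lower corner. It increases along the sequence while the
   opposite corner decreases, so its supremum lies in all the intervals. *)
have mono (p : R * R -> R) : (forall n, p (u n.+1).1 = p (u n).1 \/ p (u n.+1).1 = p (u n).1 + (u n).2 / 2) ->
    exists X, forall n, p (u n).1 <= X <= p (u n).1 + (u n).2.
  move=> hp.
  have st n : p (u n).1 <= p (u n.+1).1 /\ p (u n.+1).1 + (u n.+1).2 <= p (u n).1 + (u n).2.
    have [-> _] := us n; have := s_gt0 n; have [->|->] := hp n; split; lra.
  have le1 n m : p (u n).1 <= p (u (n + m)%N).1 /\ p (u (n + m)%N).1 + (u (n + m)%N).2 <= p (u n).1 + (u n).2.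
    elim: m => [|m [I1 I2]]; first by rewrite addn0.
    by rewrite addnS; have [J1 J2] := st (n + m)%N; split; lra.
  have le2 n m : p (u n).1 <= p (u m).1 + (u m).2.
    have [A _] := le1 n m; have [_ B] := le1 m n; rewrite addnC in B.
    by have := s_gt0 (n + m)%N; lra.
  pose E := range (fun n => p (u n).1).
  have hE m : ubound E (p (u m).1 + (u m).2) by move=> _ [n _ <-].
  exists (sup E) => n; apply/andP; split.
    by apply: ub_le_sup; [exists (p (u 0).1 + (u 0).2); apply: hE|exists n].
  by apply: ge_sup; [exists (p (u 0).1); exists 0%N|apply: hE].
have [X hX] := mono fst (fun n => (us n).2.1).
have [Y hY] := mono snd (fun n => (us n).2.2).
have [d d0 dP] := Ploc (Complex X Y) (conj (hX 0) (hY 0)).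
have [n hn] : exists n, s0 / 2 ^+ n < d.
  have [n hn] : exists n : nat, s0 / d < n%:R by exists (Num.truncn (s0 / d)).+1; rewrite truncnS_gt.
  exists n; rewrite ltr_pdivrMr ?exprn_gt0//; rewrite ltr_pdivrMr// mulrC in hn.
  apply: lt_le_trans hn _; rewrite ler_pM2l//.
  by rewrite -natrX ler_nat ltnW// ltn_expl.
have [_] := ub n; apply; apply: dP => /=; first by rewrite s_gt0 sE.
by split; [apply: hX|apply: hY].
Qed.

(* The mean over the two half-open conventions makes [weight t], up to the factor
   4, an exactly additive count of the squares of a subdivision containing [t]. *)
Definition in_lo (x s u : R) : nat :=
  ((x <= u < x + s)%R + (x < u <= x + s)%R)%N.

Lemma in_lo_split x s u : 0 < s ->
  in_lo x s u = (in_lo x (s / 2) u + in_lo (x + s / 2) (s / 2) u)%N.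
Proof.
move=> s0; rewrite /in_lo (_ : x + s / 2 + s / 2 = x + s); last by field.
have h : x < x + s / 2 by lra.
have h' : x + s / 2 < x + s by lra.
have [] := ltgtP u x; have [] := ltgtP u (x + s / 2); have [] := ltgtP u (x + s);
  move=> * //=; by exfalso; lra.
Qed.

Definition weight t x y s : nat := (in_lo x s (Re t) * in_lo y s (Im t))%N.

Lemma weight_split t x y s : 0 < s -> weight t x y s =
  (weight t x y (s / 2) + weight t (x + s / 2) y (s / 2)
   + weight t (x + s / 2) (y + s / 2) (s / 2) + weight t x (y + s / 2) (s / 2))%N.
Proof.
by move=> s0; rewrite /weight (in_lo_split x)// (in_lo_split y)//; lia.
Qed.

Lemma weight_ge1 t x y s : 0 < s -> in_sq x y s t -> (0 < weight t x y s)%N.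
Proof.
move=> s0 [/andP[a b] /andP[c d]]; rewrite /weight muln_gt0 /in_lo a b c d /=.
rewrite andbT andbT !addn_gt0 !lt0b.
apply/andP; split; first by have [] := ltP (Re t) (x + s) => //=; lra.
by have [] := ltP (Im t) (y + s) => //=; lra.
Qed.

Lemma weight_le4 t x y s : (weight t x y s <= 4)%N.
Proof.
rewrite /weight /in_lo.
by do 4!case: (_ && _).
Qed.

Lemma normE (z : C) : `|z| = Complex (N z) 0 :> C.
Proof. by rewrite /cplx normc_def; case: z. Qed.

Lemma diff_N f z : differentiable f z -> forall e : R, 0 < e ->
  exists2 d : R, 0 < d & forall z', N (z' - z) < d ->
    N (f z' - f z - 'd f z 1 * (z' - z)) <= e * N (z' - z).
Proof.
move=> df e e0.
have e0' : 0 < Complex e 0 :> C by rewrite /cplx ltcE /= eqxx.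
have /nbhs_ballP[d d0 hd] := diff_eps df e0'.
have dE : d = Complex (Re d) 0 :> C.
  by move: d0; rewrite /= /cplx ltcE => /andP[/eqP /= E _]; case: (d) E => a b /= ->.
exists (Re d); first by move: d0; rewrite /= /cplx ltcE /= => /andP[].
move=> z' zd; have := hd z'; rewrite /ball /= -normrN opprB normE dE /cplx ltcR => /(_ zd).
rewrite -{1}[z' - z]mulr1 linearZ /= !normE.
have E (a b : R) : Complex a 0 * Complex b 0 = Complex (a * b) 0 :> C.
  by rewrite /cplx; apply: complex_eqP => /=; ring.
by rewrite E [_ *: _]mulrC /cplx lecR.
Qed.

(** The bound is proved in terms of [s ^+ 2] plus [weight], which is additive under subdivision:
    area pays for small squares around points other than [t], as in Goursat's argument, and [weight]
    pays for those containing [t], where [q] is only bounded. *)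
Lemma cauchy_punctured q t x0 y0 s0 : 0 < s0 ->
  (forall z, in_sq x0 y0 s0 z -> z != t -> differentiable q z) ->
  (exists M, exists2 d : R, 0 < d & forall z, N (z - t) < d -> N (q z) <= M) ->
  forall e : R, 0 < e -> exists k0, forall k, (k0 <= k)%N ->
    N (sq k q x0 y0 s0) <= e.
Proof.
move=> s00 dq [M [dM dM0 qM]].
have near_sq x y s z z' : 0 < s -> in_sq x y s z -> in_sq x y s z' -> N (z' - z) <= 2 * s.
  move=> s_gt0 [/andP[a1 a2] /andP[a3 a4]] [/andP[b1 b2] /andP[b3 b4]].
  rewrite (_ : z' - z = Complex (Re z' - Re z) 0 + Complex 0 (Im z' - Im z)); last first.
    by apply: complex_eqP; rewrite /= ?addr0 ?add0r ?raddfB.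
  apply: le_trans (N_D _ _) _; rewrite /normc expr0n /= addr0 add0r !sqrtr_sqr mulr2n mulrDl mul1r.
  by apply: lerD; rewrite ler_norml; apply/andP; split; lra.
suff H e : 0 < e -> exists k0, forall k, (k0 <= k)%N ->
    N (sq k q x0 y0 s0) <= e * (s0 ^+ 2 + (weight t x0 y0 s0)%:R).
  move=> e e0; have p : 0 < s0 ^+ 2 + 4 by have := sqr_ge0 s0; lra.
  have [|k0 hk] := H (e / (s0 ^+ 2 + 4)); first by rewrite divr_gt0.
  exists k0 => k /hk /le_trans; apply.
  rewrite mulrAC ler_pdivrMr// ler_pM2l// lerD2l.
  by rewrite (ler_nat _ _ 4) weight_le4.
move=> e0; pose P x y s := exists k0, forall k, (k0 <= k)%N ->
  N (sq k q x y s) <= e * (s ^+ 2 + (weight t x y s)%:R).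
apply: (@square_induction P) => //.
  move=> x y s s_gt0 [k1 h1] [k2 h2] [k3 h3] [k4 h4].
  (* The successor is the level spent on the subdivision; the sum exceeds each of the four
     thresholds. *)
  exists (k1 + k2 + k3 + k4).+1%N => -[//|k] hk.
  have [l1 l2 l3 l4] : [/\ (k1 <= k)%N, (k2 <= k)%N, (k3 <= k)%N & (k4 <= k)%N].
    by clear -hk; split; lia.
  have {}h1 := h1 k l1; have {}h2 := h2 k l2.
  have {}h3 := h3 k l3; have {}h4 := h4 k l4.
  rewrite sq_split weight_split// !natrD.
  apply: le_trans (N_D _ _) _; apply: le_trans (lerD (N_D _ _) (lexx _)) _.
  apply: le_trans (lerD (lerD (N_D _ _) (lexx _)) (lexx _)) _.
  by nra.
move=> z z0; have [zt|zt] := eqVneq z t.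
  pose M' := `|M| + 1.
  have M0 : 0 < M' by rewrite ltr_wpDl.
  (* Points of a square of side [s] are at distance at most [2 * s], so a side below [dM / 2] keeps
     it in the disc where [q] is bounded. The other bound makes [4 * M' * s] at most [e], which a
     weight of at least 1 pays for. *)
  pose d := Num.min (dM / 2) (e / (4 * M')).
  exists d; first by rewrite lt_min !divr_gt0// mulr_gt0.
  move=> x y s /andP[s_gt0]; rewrite lt_min => /andP[sd1 sd2] zxy; exists 0%N => k _.
  have /= := @sq_le k q x y s M' (ltW s_gt0); rewrite mulrAC => /(_ _)/le_trans; apply.
    move=> w [wxy _]; apply: le_trans (qM _ _) _.
      rewrite -zt; apply: le_lt_trans (near_sq _ _ _ _ _ s_gt0 zxy wxy) _.
      by rewrite mulrC -ltr_pdivlMr.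
    by rewrite /M'; have := ler_norm M; lra.
  have w1 : 1 <= (weight t x y s)%:R :> R by rewrite (ler_nat _ 1) weight_ge1 -?zt.
  rewrite ltr_pdivlMr in sd2; last by rewrite mulr_gt0.
  have := sqr_ge0 s; nra.
have := diff_N (dq _ z0 zt); set v := 'd q z 1 => hv.
(* The remainder is at most [e / 8 * (2 * s)] on the boundary, of length [4 * s], which gives
   [e * s ^+ 2]. *)
have [|d d0 hd] := hv (e / 8); first by rewrite divr_gt0.
exists (d / 2); first by rewrite divr_gt0.
move=> x y s /andP[s_gt0 sd] zxy; exists 0%N => k _.
have -> : sq k q x y s = sq k (fun w => q w - q z - v * (w - z)) x y s.
  rewrite -[LHS]addr0 -[X in _ + X](quad_affine k (- q z + v * z) (- v) (Complex x y) (Complex (x + s) y)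
     (Complex (x + s) (y + s)) (Complex x (y + s))) -quadD; congr quad.
  by apply/funext => w; ring.
have := @sq_le k (fun w => q w - q z - v * (w - z)) x y s (e / 8 * (2 * s)) (ltW s_gt0).
move=> /(_ _)/le_trans; apply.
  move=> w [wxy _]; have l := near_sq _ _ _ _ _ s_gt0 zxy wxy.
  apply: le_trans (hd _ _) _; first by lra.
  by rewrite ler_pM2l// divr_gt0.
have : 0 <= e * (weight t x y s)%:R by rewrite mulr_ge0// ltW.
by nra.
Qed.

Let I : C := Complex 0 1.

Lemma ImI z : Im (I * z) = Re z.
Proof. by case: z => a b; rewrite /cplx /=; ring. Qed.

Lemma ReI z : Re (I * z) = - Im z.
Proof. by case: z => a b; rewrite /cplx /=; ring. Qed.

Lemma sqrI : I ^+ 2 = -1.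
Proof. by rewrite expr2; apply: complex_eqP; rewrite ?ImI ?ReI /cplx /= ?oppr0. Qed.

Lemma neq0I : I != 0.
Proof. by apply/eqP => /(congr1 (@complex.Im R)) /= /eqP; rewrite oner_eq0. Qed.

Lemma trap_inv k (a b : C) :
  trap k (fun z => z^-1) (I * a) (I * b) = trap k (fun z => z^-1) a b.
Proof.
have E : (fun z : C => (I * z)^-1) = (fun z : C => I^-1 * z^-1).
  by apply/funext => z; rewrite invfM.
by rewrite trap_rot E trapZ mulrA divff ?mul1r// neq0I.
Qed.

Lemma trap_inv2 k (a b : C) :
  trap k (fun z => z^-2) (I * a) (I * b) = - I * trap k (fun z => z^-2) a b.
Proof.
have E : (fun z : C => (I * z)^-2) = (fun z : C => -1 * z^-2).
  by apply/funext => z; rewrite exprMn sqrI invfM invrN1.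
by rewrite trap_rot E trapZ mulrA mulrN1.
Qed.

Definition csq k q (h : R) := sq k q (- h) (- h) (2 * h).

(** The corners of the centred square are the orbit of [a] under quarter turns, so that each side is
    a rotation of the first. *)
Lemma csqE k q h (a := Complex (- h) (- h) : C) : csq k q h =
  trap k q a (I * a) + trap k q (I * a) (I * (I * a))
  + trap k q (I * (I * a)) (I * (I * (I * a)))
  + trap k q (I * (I * (I * a))) (I * (I * (I * (I * a)))).
Proof.
rewrite /csq /sq /quad; congr (_ + _ + _ + _); congr (trap k q);
  apply: complex_eqP; rewrite ?ImI ?ReI ?ImI ?ReI ?ImI ?ReI ?ImI ?ReI /=; ring.
Qed.

(* A quarter turn multiplies z^-2 dz by -i, so that the four sides cancel. *)
Lemma csq_inv2 k h : csq k (fun z => z^-2) h = 0.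
Proof.
rewrite csqE !trap_inv2; set T := trap _ _ _ _.
have := sqrI; set i := I => i2.
have -> : T + - i * T + - i * (- i * T) + - i * (- i * (- i * T)) = (1 + i ^+ 2) * (T * (1 - i)).
  by ring.
by rewrite i2 subrr mul0r.
Qed.

Lemma ImM z w : Im (z * w) = Re z * Im w + Im z * Re w.
Proof. by case: z w => a b [c d]; rewrite /cplx /=; ring. Qed.

Lemma ImN z : Im (- z) = - Im z. Proof. by rewrite raddfN. Qed.
Lemma ReN z : Re (- z) = - Re z. Proof. by rewrite raddfN. Qed.

Lemma Im_le_N z : Im z <= N z.
Proof.
case: z => a b; rewrite /normc /=; apply: le_trans (ler_norm _) _.
by rewrite -sqrtr_sqr; apply: ler_wsqrtr; rewrite lerDr sqr_ge0.
Qed.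

Lemma trap_Im_ge (P : set C) q rho k a b c : midclosed P ->
  (forall z, P z -> Im z = c) -> P a -> P b -> Re a <= Re b ->
  (forall z, P z -> rho <= Im (q z)) ->
  rho * (Re b - Re a) <= Im (trap k q a b).
Proof.
move=> mP Pc; elim: k a b => [|k IH] a b Pa Pb ab qr /=.
  rewrite Im_half ImM !ReD !ReN !ImD !ImN (Pc a)// (Pc b)// subrr mul0r addr0.
  have := qr _ Pa; have := qr _ Pb; nra.
have Pm := mP _ _ Pa Pb.
rewrite ImD; have := IH _ _ Pa Pm _ qr; have := IH _ _ Pm Pb _ qr.
by rewrite !half2E => h1 h2; have {}h1 := h1 ltac:(lra); have {}h2 := h2 ltac:(lra); lra.
Qed.

(* The trapezoid sums of dz / z need not be 2 pi i; only a lower bound is used. *)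
Lemma csq_inv_ge k h : 0 < h -> 4 <= N (csq k (fun z => z^-1) h).
Proof.
move=> h0; rewrite csqE !trap_inv; set T := trap _ _ _ _.
suff : 1 <= Im T by move=> H; apply: le_trans (Im_le_N _); rewrite !ImD; lra.
pose P : set C := [set z | Im z = - h /\ - h <= Re z <= h].
have mP : midclosed P.
  move=> a b [a1 /andP[a2 a3]] [b1 /andP[b2 b3]]; rewrite /P /= !half2E a1 b1.
  by split; [field|apply/andP; split; lra].
(* On the lower side the imaginary part of [z^-1] is [h / (x ^+ 2 + h ^+ 2)], at least [(2 * h)^-1];
   the length being [2 * h], each side contributes at least 1. *)
have H : (2 * h)^-1 * (Re (I * Complex (- h) (- h)) - Re (Complex (- h) (- h) : C)) = 1.
  by rewrite ReI /=; field; rewrite gt_eqF.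
rewrite -H; apply: (trap_Im_ge (c := - h) k mP).
- by move=> z [].
- by split => //=; apply/andP; split; lra.
- by split; rewrite ?ImI ?ReI //=; apply/andP; split; lra.
- by rewrite ReI /=; lra.
case=> x y [/= -> /andP[x1 x2]]; rewrite /cplx /= sqrrN mulNr opprK.
rewrite ler_pdivlMr; last by have := sqr_ge0 x; nra.
rewrite mulrC ler_pdivrMr ?mulr_gt0//; nra.
Qed.

Lemma bd_csq (h : R) z : 0 < h -> bd_sq (- h) (- h) (2 * h) z -> h <= N z.
Proof.
move=> h0 [_ bd]; rewrite /normc; case: z bd => a b /= bd.
rewrite [leLHS](_ : h = Num.sqrt (h ^+ 2)); last by rewrite sqrtr_sqr gtr0_norm.
apply: ler_wsqrtr; have := sqr_ge0 a; have := sqr_ge0 b.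
case: bd => [->|[->|[->|->]]]; nra.
Qed.

Lemma abs_Re_N z : `|Re z| <= N z.
Proof.
case: z => a b; rewrite /normc /= -sqrtr_sqr.
by apply: ler_wsqrtr; rewrite lerDl sqr_ge0.
Qed.

Lemma abs_Im_N z : `|Im z| <= N z.
Proof.
case: z => a b; rewrite /normc /= -sqrtr_sqr.
by apply: ler_wsqrtr; rewrite lerDr sqr_ge0.
Qed.

Lemma in_csq (h : R) t : N t <= h -> in_sq (- h) (- h) (2 * h) t.
Proof.
move=> th; have := abs_Re_N t; have := abs_Im_N t.
rewrite !ler_norml => /andP[a b] /andP[c d].
by split; apply/andP; split; lra.
Qed.

Lemma N0 : N 0 = 0. Proof. by rewrite normc0. Qed.

(** Cauchy's formula without a value for the sum of dz / (z - t): the difference of the two sides is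
    the sum of the difference quotient, which is bounded near [t], so that [cauchy_punctured]
    applies. *)
Lemma cauchy_square f (h : R) t : 0 < h -> N t <= h / 2 ->
  (forall z, in_sq (- h) (- h) (2 * h) z -> differentiable f z) ->
  forall e : R, 0 < e -> exists k0, forall k, (k0 <= k)%N ->
    N (csq k (fun z => f z / (z - t)) h - f t * csq k (fun z => (z - t)^-1) h) <= e.
Proof.
move=> h0 th df e e0.
have tsq : in_sq (- h) (- h) (2 * h) t by apply: in_csq; lra.
have h20 : 0 < 2 * h by lra.
pose q (z : C) : C := (f z - f t) * (z - t)^-1.
have dq z : in_sq (- h) (- h) (2 * h) z -> z != t -> differentiable q z.
  move=> zs zt; apply: (@differentiableM _ _ (fun z => f z - f t) (fun z => (z - t)^-1)).
    by apply: differentiableB; [exact: df|exact: differentiable_cst].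
  apply: (@differentiableV _ _ (fun z => z - t)); rewrite ?subr_eq0//.
have bq : exists M, exists2 d : R, 0 < d & forall z, N (z - t) < d -> N (q z) <= M.
  have := diff_N (df _ tsq); set v := 'd f t 1 => hv.
  have [d d0 hd] := hv 1 ltr01; exists (N v + 1), d => // z zd.
  have [->|zt] := eqVneq z t; first by rewrite /q subrr mul0r N0; have := N_ge0 v; lra.
  have zt0 : z - t != 0 by rewrite subr_eq0.
  have -> : q z = v + (f z - f t - v * (z - t)) / (z - t) by rewrite /q; field.
  apply: le_trans (N_D _ _) _; rewrite lerD2l normcM normcV ler_pdivrMr ?hd//.
  rewrite lt_neqAle N_ge0 andbT eq_sym; apply: contra zt0 => /eqP /eq0_normc ->//.
have [k0 hk0] := cauchy_punctured h20 dq bq e0; exists k0 => k /hk0.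
rewrite /csq /sq -mulNr -quadZ -quadD; congr (N (quad k _ _ _ _ _) <= e).
by apply/funext => z; rewrite /q /= mulNr -mulrBl.
Qed.

Lemma csqD k q1 q2 h : csq k (fun z => q1 z + q2 z) h = csq k q1 h + csq k q2 h.
Proof. exact: quadD. Qed.

Lemma csqZ k u q h : csq k (fun z => u * q z) h = u * csq k q h.
Proof. exact: quadZ. Qed.

Lemma csq_le k q (h M : R) : 0 < h -> (forall z, z != 0 -> in_sq (- h) (- h) (2 * h) z ->
  h <= N z -> N (q z) <= M) -> N (csq k q h) <= 8 * M * h.
Proof.
move=> h0 qM; have h20 : 0 <= 2 * h by lra.
apply: le_trans (sq_le k h20 _) (_ : 4 * M * (2 * h) <= _) => [z zs|]; last by lra.
have zh := bd_csq h0 zs; apply: qM => //; last by case: zs.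
by apply/eqP => z0; move: zh; rewrite z0 N0; lra.
Qed.

(** Expanding 1 / (z - t) to second order turns Cauchy's formula into [D t * c k 0 = t * L k] up to
    [K * N t ^+ 2]. Neither [c k 0] nor [L k] is known to converge in [k]; so [L k] is eliminated
    between two points [t] and [t'], the factor [c k 0] is removed by its lower bound 4, and [t'] is
    taken close to 0. *)
Lemma hol_quadratic_estimate f (h M : R) : 0 < h ->
  (forall z, in_sq (- h) (- h) (2 * h) z -> differentiable f z) ->
  (forall z, in_sq (- h) (- h) (2 * h) z -> N (f z) <= M) ->
  forall t, N t <= h / 2 ->
    N (f t - f 0 - 'd f 0 1 * t) <= 8 * M / h ^+ 2 * (N t) ^+ 2.
Proof.
move=> h0 df fM.
have N00 : N 0 <= h / 2 by rewrite N0; lra.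
have M0 : 0 <= M by apply: le_trans (fM 0 _); [exact: N_ge0|apply: in_csq; lra].
pose A k t := csq k (fun z => f z / (z - t)) h.
pose c k t := csq k (fun z => (z - t)^-1) h.
pose L k := csq k (fun z => f z / z ^+ 2) h.
have c0E k : c k 0 = csq k (fun z => z^-1) h.
  by rewrite /c; congr csq; apply/funext => z; rewrite subr0.
have c0ge k : 4 <= N (c k 0) by rewrite c0E csq_inv_ge.
have remE t z : N t <= h / 2 -> h <= N z -> z != 0 ->
   N ((z - t)^-1 - z^-1 - t * z^-2) <= 2 / h ^+ 3 * N t ^+ 2.
  move=> th zh z0; have zt : h / 2 <= N (z - t).
    by have := N_D (z - t) t; rewrite subrK; lra.
  have zt0 : z - t != 0 by apply/eqP => E; move: zt; rewrite E N0; lra.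
  have -> : (z - t)^-1 - z^-1 - t * z^-2 = t ^+ 2 * (z^-1 * (z^-1 * (z - t)^-1)) by field; rewrite zt0.
  rewrite expr2 !normcM !normcV -!expr2 mulrC ler_wpM2r ?sqr_ge0//.
  have -> : 2 / h ^+ 3 = h^-1 * (h^-1 * (h / 2)^-1) by field; rewrite gt_eqF.
  have i1 : (N z)^-1 <= h^-1 by rewrite lef_pV2 ?posrE//; lra.
  have i2 : (N (z - t))^-1 <= (h / 2)^-1 by rewrite lef_pV2 ?posrE//; lra.
  by rewrite !ler_pM ?mulr_ge0 ?invr_ge0 ?N_ge0.
have h3 : 0 <= 2 / h ^+ 3 by rewrite divr_ge0 ?exprn_ge0// ltW.
have B1 k t : N t <= h / 2 -> N (A k t - A k 0 - t * L k) <= 16 * M / h ^+ 2 * N t ^+ 2.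
  move=> th; have -> : A k t - A k 0 - t * L k = csq k (fun z => f z * ((z - t)^-1 - z^-1 - t * z^-2)) h.
    rewrite /A /L -mulNr -[- csq k _ h]mulN1r -!csqZ -!csqD; congr csq.
    by apply/funext => z; rewrite subr0; ring.
  apply: le_trans (csq_le (M := M * (2 / h ^+ 3 * N t ^+ 2)) _ h0 _) _.
    move=> z z0 zs zh; rewrite normcM; apply: ler_pM; rewrite ?N_ge0//; first exact: fM.
    exact: remE.
  by rewrite le_eqVlt; apply/orP; left; apply/eqP; field; rewrite gt_eqF.
(* The first order term is the sum of [z^-2], which is exactly 0. *)
have B2 k t : N t <= h / 2 -> N (c k t - c k 0) <= 16 / h ^+ 2 * N t ^+ 2.
  move=> th; have -> : c k t - c k 0 = csq k (fun z => (z - t)^-1 - z^-1 - t * z^-2) h.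
    have -> : (fun z => (z - t)^-1 - z^-1 - t * z^-2) =
        (fun z : C => (z - t)^-1 + -1 * (z - 0)^-1 + - t * z^-2).
      by apply/funext => z; rewrite subr0; ring.
    by rewrite !csqD !csqZ csq_inv2 mulr0 addr0 mulN1r.
  apply: le_trans (csq_le (M := 2 / h ^+ 3 * N t ^+ 2) _ h0 _) _.
    by move=> z z0 zs zh; exact: remE.
  by rewrite le_eqVlt; apply/orP; left; apply/eqP; field; rewrite gt_eqF.
(* 32 is 16 from the change of [A] plus 16 from [f t] times the change of [c]; the division by 4
   gives the final 8. *)
pose D t := f t - f 0; pose K := 32 * M / h ^+ 2.
have K0 : 0 <= K by rewrite divr_ge0 ?sqr_ge0// mulr_ge0.
have claim1 t (e : R) : N t <= h / 2 -> 0 < e -> exists k0, forall k, (k0 <= k)%N ->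
    N (D t * c k 0 - t * L k) <= K * N t ^+ 2 + e.
  move=> th e0; have e20 : 0 < e / 2 by lra.
  have [k1 h1] := cauchy_square h0 th df e20.
  have [k2 h2] := cauchy_square h0 N00 df e20.
  exists (maxn k1 k2) => k; rewrite geq_max => /andP[/h1 {}h1 /h2 {}h2].
  have -> : D t * c k 0 - t * L k = (A k t - A k 0 - t * L k) - f t * (c k t - c k 0)
      - (A k t - f t * c k t) + (A k 0 - f 0 * c k 0) by rewrite /D; ring.
  apply: le_trans (N_D _ _) _; apply: le_trans (lerD (N_D _ _) (lexx _)) _.
  apply: le_trans (lerD (lerD (N_D _ _) (lexx _)) (lexx _)) _.
  rewrite [N (- (f t * _))]normcN [N (- (_ - _))]normcN normcM.
  have b3 : N (f t) * N (c k t - c k 0) <= M * (16 / h ^+ 2 * N t ^+ 2).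
    apply: ler_pM; rewrite ?N_ge0//; last exact: B2.
    by apply: fM; apply: in_csq; lra.
  have := B1 k t th; rewrite -/(A k t) -/(c k t) in h1; rewrite -/(A k 0) -/(c k 0) in h2.
  have -> : K * N t ^+ 2 = 16 * M / h ^+ 2 * N t ^+ 2 + M * (16 / h ^+ 2 * N t ^+ 2) by rewrite /K; ring.
  lra.
have claim2 t t' : N t <= h / 2 -> N t' <= h / 2 ->
    4 * N (D t * t' - D t' * t) <= K * (N t ^+ 2 * N t' + N t' ^+ 2 * N t).
  move=> th t'h; apply/ler_addgt0Pr => e e0.
  have p0 : 0 < N t + N t' + 1 by have := N_ge0 t; have := N_ge0 t'; lra.
  have e'0 : 0 < e / (N t + N t' + 1) by rewrite divr_gt0.
  have [k1 h1] := claim1 _ _ th e'0; have [k2 h2] := claim1 _ _ t'h e'0.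
  have {}h1 := h1 (maxn k1 k2) (leq_maxl _ _).
  have {}h2 := h2 (maxn k1 k2) (leq_maxr _ _); set k := maxn k1 k2 in h1 h2.
  apply: (@le_trans _ _ (N (c k 0) * N (D t * t' - D t' * t))); first by rewrite ler_wpM2r ?N_ge0.
  rewrite -normcM.
  have -> : c k 0 * (D t * t' - D t' * t) = (D t * c k 0 - t * L k) * t' - (D t' * c k 0 - t' * L k) * t by ring.
  apply: le_trans (N_D _ _) _; rewrite normcN !normcM.
  set e' := e / _ in h1 h2; have ee : e' * (N t + N t') <= e.
    rewrite /e' mulrAC ler_pdivrMr// ler_pM2l//; lra.
  have := ler_wpM2r (N_ge0 t') h1; have := ler_wpM2r (N_ge0 t) h2; lra.
have d0 : differentiable f 0 by apply: df; apply: in_csq; lra.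
move=> t th; set v := 'd f 0 1.
suff : 4 * N (f t - f 0 - v * t) <= K * N t ^+ 2.
  by rewrite /K => H; rewrite -(ler_pM2l (x := 4))//; apply: le_trans H _; rewrite le_eqVlt; apply/orP; left; apply/eqP; ring.
apply/ler_addgt0Pr => e e0; set s := N t; have s0 : 0 <= s := N_ge0 t.
have e1 : 0 < e / (8 * (s + 1)) by rewrite divr_gt0// mulr_gt0//; lra.
have [d d_gt0 hd] := diff_N d0 e1.
have Ks0 : 0 < 2 * (K * s + 1) by have := mulr_ge0 K0 s0; lra.
(* The modulus of [t']: small enough for the derivative at 0, for [claim2], and for the leftover
   [K * r * s] to be absorbed by [e]. *)
pose r := Num.min (d / 2) (Num.min (h / 2) (e / (2 * (K * s + 1)))).
have r0 : 0 < r by rewrite !lt_min !divr_gt0.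
have [r1 r2 r3] : [/\ r <= d / 2, r <= h / 2 & r <= e / (2 * (K * s + 1))].
  by rewrite /r !ge_min !lexx !orbT.
pose t' : C := Complex r 0; have Nt' : N t' = r.
  by rewrite /t' /normc expr0n addr0 sqrtr_sqr gtr0_norm.
have := hd t'; rewrite subr0 Nt' => /(_ ltac:(lra)) hr.
have := claim2 t t' th; rewrite Nt' -/s => /(_ r2) h2.
rewrite -(ler_pM2r r0).
have -> : 4 * N (f t - f 0 - v * t) * r = 4 * N (D t * t' - v * t * t').
  by rewrite -mulrA -[in LHS]Nt' -normcM /D; congr (4 * N _); ring.
have -> : D t * t' - v * t * t' = D t * t' - D t' * t + (D t' - v * t') * t by ring.
apply: le_trans (ler_wpM2l _ (N_D _ _)) _ => //.
rewrite normcM -/s mulrDr.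
have := ler_wpM2r s0 hr; rewrite -/v /D => hr'.
have e2 : e / (8 * (s + 1)) * 8 * s <= e.
  rewrite (_ : e / _ * 8 * s = e * s / (s + 1)); last by field; apply/eqP; lra.
  by rewrite ler_pdivrMr ?ler_pM2l//; lra.
have e3 : r * (2 * (K * s)) <= e.
  move: r3; rewrite ler_pdivlMr// => r3; apply: le_trans r3; rewrite ler_pM2l//; lra.
have e4 := ler_wpM2r (ltW r0) e2; have e5 := ler_wpM2r (ltW r0) e3.
rewrite /D in h2 *; set E := e / _ in hr' e4; move: h2 hr' e4 e5; set a := N _; set b := N _; clear; lra.
Qed.

End Squares.

(** * Derivatives of holomorphic functions *)

Import ComplexField.Normc.

(** * Real-valued norms, differentials and completeness *)

Section RealNorm.
Local Notation Re := complex.Re.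
Local Notation Im := complex.Im.
Variable R : realType.
Local Notation C := (cplx R).

(** The norm of a module over [C] takes its values in [C]; the real part moves estimates to the
    ordered field [R]. *)
Definition nrm (V : normedModType C) (w : V) : R := Re (`|w| : C).

Section NormedModule.
Variable V : normedModType C.
Implicit Types v w : V.

Lemma nrmE w : `|w| = Complex (nrm w) 0 :> C.
Proof.
have : 0 <= `|w| :> C by [].
by rewrite /nrm /cplx lecE /= => /andP[/eqP E _]; case: (`|w| : R[i]) E => a b /= ->.
Qed.

Lemma nrm_ge0 w : 0 <= nrm w.
Proof.
have : 0 <= `|w| :> C by [].
by rewrite nrmE /cplx lecR.
Qed.

Lemma nrmD v w : nrm (v + w) <= nrm v + nrm w.
Proof. have := ler_normD v w; rewrite !nrmE.
have -> : Complex (nrm v) 0 + Complex (nrm w) 0 = Complex (nrm v + nrm w) 0 :> C.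
  by apply: complex_eqP; rewrite /cplx /= ?addr0.
by rewrite /cplx lecR. Qed.

Lemma nrmN w : nrm (- w) = nrm w.
Proof. by rewrite /nrm normrN. Qed.

Lemma nrmBD v w : nrm (v - w) <= nrm v + nrm w.
Proof. by rewrite -(nrmN w) nrmD. Qed.

Lemma nrmB v w : nrm (v - w) = nrm (w - v).
Proof. by rewrite -nrmN opprB. Qed.

Lemma nrm0 : nrm (0 : V) = 0.
Proof. by rewrite /nrm normr0. Qed.

Lemma nrm_eq0 w : nrm w = 0 -> w = 0.
Proof. by move=> E; apply/eqP; rewrite -normr_eq0 nrmE E. Qed.

Lemma nearN (P : V -> Prop) x : (\forall y \near x, P y) <->
  exists2 d : R, 0 < d & forall y, nrm (y - x) < d -> P y.
Proof.
split => [/nbhs_ballP[d d0 hd]|[d d0 hd]].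
  have dE : d = Complex (Re d) 0 :> C.
    by move: d0; rewrite /= /cplx ltcE => /andP[/eqP /= E _]; case: (d) E => a b /= ->.
  exists (Re d); first by move: d0; rewrite /= /cplx ltcE /= => /andP[].
  move=> y yd; apply: hd; rewrite -ball_normE /ball_ /= -normrN opprB nrmE dE /cplx.
  by rewrite ltcR.
apply/nbhs_ballP; exists (Complex d 0); first by rewrite /= /cplx ltcR.
move=> y; rewrite -ball_normE /ball_ /= -normrN opprB nrmE /cplx ltcR.
exact: hd.
Qed.

End NormedModule.

Lemma nrmC (z : C) : nrm z = normc z.
Proof. by rewrite /nrm normE. Qed.

Lemma nrmZ (V : normedModType C) (a : C) (w : V) : nrm (a *: w) = nrm a * nrm w.
Proof.
have := normrZ a w; rewrite !nrmE => /(congr1 (@complex.Re R)) /= ->.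
by rewrite /cplx /=; ring.
Qed.

Lemma nrmM (a b : C) : nrm (a * b) = nrm a * nrm b.
Proof. by rewrite !nrmC normcM. Qed.

Lemma nrmV (a : C) : nrm a^-1 = (nrm a)^-1.
Proof. by rewrite !nrmC normcV. Qed.

Definition creal (r : R) : C := Complex r 0.

Lemma nrm_creal (r : R) : 0 <= r -> nrm (creal r) = r.
Proof. by move=> r0; rewrite nrmC /normc /= expr0n addr0 sqrtr_sqr ger0_norm. Qed.

Lemma creal_neq0 (r : R) : 0 < r -> creal r != 0.
Proof. by move=> r0; apply/eqP => /(congr1 (@complex.Re R)) /= E; rewrite E ltxx in r0. Qed.

Section Differentiability.
Variables V W : normedModType C.
Implicit Types f g : V -> W.

Lemma diff_nrm f x : differentiable f x -> forall e : R, 0 < e ->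
  exists2 d : R, 0 < d & forall w, nrm w < d ->
    nrm (f (x + w) - f x - 'd f x w) <= e * nrm w.
Proof.
move=> df e e0; have e0' : 0 < creal e by rewrite /creal /cplx ltcR.
have /nearN[d d0 hd] := diff_eps df e0'; exists d => // w wd.
have := hd (x + w); rewrite [x + w - x]addrAC subrr add0r => /(_ wd).
have E (a b : R) : Complex a 0 * Complex b 0 = Complex (a * b) 0 :> C.
  by rewrite /cplx; apply: complex_eqP => /=; ring.
by rewrite !nrmE /creal E /cplx lecR.
Qed.

Lemma nrm_diff f x (df : {linear V -> W}) : continuous df ->
  (forall e : R, 0 < e -> exists2 d : R, 0 < d & forall w, nrm w < d ->
     nrm (f (x + w) - f x - df w) <= e * nrm w) ->
  differentiable f x /\ 'd f x = df :> (V -> W).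
Proof.
move=> cdf h; apply: eps_diff => // e e0.
have eE : e = Complex (Re e) 0 :> C.
  by move: e0; rewrite /cplx ltcE => /andP[/eqP /= E _]; case: (e) E => a b /= ->.
have e0' : 0 < Re e by move: e0; rewrite /cplx ltcE => /andP[].
have [d d0 hd] := h _ e0'; apply/nearN; exists d => // y yd.
have := hd _ yd; rewrite (addrC x) subrK eE !nrmE.
have E (a b : R) : Complex a 0 * Complex b 0 = Complex (a * b) 0 :> C.
  by rewrite /cplx; apply: complex_eqP => /=; ring.
by rewrite E /cplx lecR.
Qed.

Lemma bounded_linear_cont (L : {linear V -> W}) (B : R) :
  (forall w, nrm (L w) <= B * nrm w) -> continuous L.
Proof.
move=> LB x; apply/cvgrPdist_le => /= e e0.
have eE : e = Complex (Re e) 0 :> C.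
  by move: e0; rewrite /cplx ltcE => /andP[/eqP /= E _]; case: (e) E => a b /= ->.
have e0' : 0 < Re e by move: e0; rewrite /cplx ltcE => /andP[].
apply/nearN; exists (Re e / (`|B| + 1)); first by rewrite divr_gt0// ltr_wpDl.
move=> y; rewrite ltr_pdivlMr ?ltr_wpDl// => yd.
rewrite nrmE eE /cplx lecR -nrmN opprB -linearB.
by have := LB (y - x); have := ler_norm B; have := nrm_ge0 (y - x); nra.
Qed.

Lemma near_differentiable f g x : (\forall y \near x, f y = g y) ->
  differentiable f x -> differentiable g x /\ 'd g x = 'd f x :> (V -> W).
Proof.
move=> /nearN[d d0 hd] df; apply: nrm_diff => [|e e0]; first exact: diff_continuous.
have [d' d'0 hd'] := diff_nrm df e0; exists (Num.min d d'); first by rewrite lt_min d0.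
move=> w; rewrite lt_min => /andP[w1 w2].
by rewrite -!hd ?hd'// ?subrr ?nrm0// addrAC subrr add0r.
Qed.

Fact dd_key : unit. Proof. exact: tt. Qed.

(* Locked, so that failing unifications do not unfold ['d]. *)
Definition dd f x w : W := locked_with dd_key ('d f x w).

Lemma ddE f x w : dd f x w = 'd f x w.
Proof. by rewrite /dd unlock. Qed.

Lemma dd_derive f x w : differentiable f x -> 'D_w f x = dd f x w.
Proof. by move=> df; rewrite ddE; exact: deriveE. Qed.

Lemma diff_dd f x : differentiable f x -> forall e : R, 0 < e ->
  exists2 d : R, 0 < d & forall w, nrm w < d ->
    nrm (f (x + w) - f x - dd f x w) <= e * nrm w.
Proof.
move=> df e e0; have [d d0 hd] := diff_nrm df e0; exists d => // w wd.
by rewrite ddE; exact: hd.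
Qed.

Lemma near_dd f g x : (\forall y \near x, f y = g y) ->
  differentiable f x -> differentiable g x /\ forall w, dd g x w = dd f x w.
Proof.
move=> fg df; have [dg E] := near_differentiable fg df; split; first exact: dg.
by move=> w; rewrite ddE [RHS]ddE; exact: (congr1 (fun F : V -> W => F w) E).
Qed.

End Differentiability.

(** Completeness of [R], applied to the images of [F] under the real and imaginary parts, which do
    not increase distances. *)
Lemma complete_filter (F : set_system C) : ProperFilter F ->
  (forall e : R, 0 < e -> exists z, F [set y | nrm (y - z) <= e]) ->
  exists l : C, forall e : R, 0 < e -> F [set y | nrm (y - l) <= e].
Proof.
move=> FF hF.
have part (p : C -> R) : (forall a b, `|p a - p b| <= nrm (a - b)) ->
    exists l : R, forall e : R, 0 < e -> F [set y | `|p y - l| <= e].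
  move=> hp; have : cvg (p @ F).
    apply: cauchy_cvg; apply: cauchy_exP => e e0.
    have e20 : 0 < e / 2 by lra.
    have [z hz] := hF _ e20; exists (p z).
    rewrite /fmap /=; apply: filterS hz => y /= yz; rewrite -ball_normE /ball_ /= distrC.
    by apply: le_lt_trans (hp _ _) _; apply: le_lt_trans yz _; lra.
  move=> cv; exists (lim (p @ F)) => e e0.
  have /cvgrPdist_le/(_ e e0) : p @ F --> lim (p @ F) by exact: cv.
  by apply: filterS => y; rewrite distrC.
have [a ha] := part (@complex.Re R) (fun a b => ltac:(rewrite nrmC -raddfB; exact: abs_Re_N)).
have [b hb] := part (@complex.Im R) (fun a b => ltac:(rewrite nrmC -raddfB; exact: abs_Im_N)).
exists (Complex a b) => e e0; have e20 : 0 < e / 2 by lra.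
apply: filterS2 (ha _ e20) (hb _ e20) => y /= ya yb.
rewrite nrmC (_ : y - _ = Complex (Re y - a) 0 + Complex 0 (Im y - b)); last first.
  by apply: complex_eqP; rewrite raddfB /= ?addr0 ?add0r.
apply: le_trans (N_D _ _) _; rewrite /normc expr0n /= addr0 add0r !sqrtr_sqr; lra.
Qed.

Lemma seq_complete (u : nat -> C) (M : R) :
  (forall n, nrm (u n.+1 - u n) <= M / 2 ^+ n) ->
  exists l, forall e : R, 0 < e -> \forall n \near \oo, nrm (u n - l) <= e.
Proof.
move=> hu; have M0 : 0 <= M by have := hu 0%N; rewrite expr0 divr1; apply: le_trans; exact: nrm_ge0.
have dist n k : nrm (u (n + k)%N - u n) <= 2 * M / 2 ^+ n * (1 - 1 / 2 ^+ k).
  elim: k => [|k IH]; first by rewrite addn0 subrr nrm0 expr0 divr1 subrr mulr0.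
  rewrite (_ : u (n + k.+1)%N - u n = (u (n + k).+1 - u (n + k)%N) + (u (n + k)%N - u n)); last first.
    by rewrite addnS addrA subrK.
  apply: le_trans (nrmD _ _) _; apply: le_trans (lerD (hu _) IH) _.
  rewrite le_eqVlt; apply/orP; left; apply/eqP; rewrite exprD exprS; field.
  by rewrite !expf_neq0.
have [l hl] : exists l : C, forall e : R, 0 < e -> (u @ \oo) [set y | nrm (y - l) <= e].
  apply: complete_filter => e e0.
  have [n hn] : exists n, 2 * M / 2 ^+ n <= e.
    have [n hn] : exists n : nat, 2 * M / e < n%:R by exists (Num.truncn (2 * M / e)).+1; rewrite truncnS_gt.
    exists n; rewrite ler_pdivrMr ?exprn_gt0// [e * _]mulrC -ler_pdivrMr//; apply: ltW.
    by apply: lt_le_trans hn _; rewrite -natrX ler_nat ltnW// ltn_expl.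
  exists (u n); exists n => // m /= nm.
  rewrite -(subnKC nm); apply: le_trans (dist _ _) _; apply: le_trans hn.
  have : 0 <= 2 * M / 2 ^+ n by rewrite divr_ge0 ?exprn_ge0 ?mulr_ge0.
  have : 0 <= 1 / 2 ^+ (m - n) :> R by rewrite divr_ge0 ?exprn_ge0.
  nra.
by exists l => e /hl.
Qed.

Lemma scaled_square_le (t e K s : R) : 0 < t -> 0 <= K * s ^+ 2 ->
  t * (4 * (K * s ^+ 2 + 1)) <= e -> 2 * (K * (t * s) ^+ 2) <= e / 2 * t.
Proof.
move=> t0 ks te; rewrite (_ : 2 * _ = (t * (2 * (K * s ^+ 2))) * t); last by ring.
by rewrite ler_wpM2r// ?ltW//; lra.
Qed.

Lemma scaled_step_le (K n d e t : R) : 0 <= K -> 0 <= n -> n < d ->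
  d * (8 * (K + 1)) = e * t -> 2 * K * n <= e / 4 * t.
Proof. by move=> k0 n0 nd E; have := ler_wpM2l k0 (ltW nd); lra. Qed.

(** * Cauchy estimates, Goursat's theorem and symmetry of second derivatives *)

Section Cauchy.
Variable V : normedModType C.
Implicit Types (G : V -> C) (v w y z : V).

Lemma diff_line G y w (t : C) : differentiable G (y + t *: w) ->
  differentiable (fun t : C => G (y + t *: w)) t /\
  'd (fun t : C => G (y + t *: w)) t 1 = 'd G (y + t *: w) w.
Proof.
move=> dG; pose l (t : C) := y + t *: w.
have dl : is_diff t l (fun s : C => s *: w).
  by apply: (@is_diff_eq _ _ _ (cst y + (fun t : C => t *: w))); exact: add0r.
have dg : is_diff (l t) G ('d G (l t)) by apply: DiffDef.
have dGl : is_diff t (G \o l) ('d G (l t) \o (fun s : C => s *: w)) by exact: is_diff_comp.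
split; first exact: (@ex_diff _ _ _ _ _ _ _ dGl).
by rewrite (@diff_val _ _ _ _ _ _ _ dGl) /= scale1r.
Qed.

Lemma ddZ (f : V -> C) x a w : dd f x (a *: w) = a * dd f x w.
Proof. by rewrite !ddE linearZ. Qed.

Lemma ddP (f : V -> C) x a u w : dd f x (a *: u + w) = a * dd f x u + dd f x w.
Proof. by rewrite !ddE linearP. Qed.

Section Estimates.
Variables (G : V -> C) (z : V) (rho M : R).
Hypothesis rho0 : 0 < rho.
Hypothesis dG : forall y, nrm (y - z) < rho -> differentiable G y.
Hypothesis GM : forall y, nrm (y - z) < rho -> nrm (G y) <= M.

Lemma estimates_ge0 : 0 <= M.
Proof. by apply: le_trans (nrm_ge0 _) (GM (y := z) _); rewrite subrr nrm0. Qed.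

(** The one-variable estimate on the complex line through [y] in direction [w], read at the
    parameter 1. *)
Lemma quadratic_estimate y w : nrm (y - z) <= rho / 2 -> nrm w <= rho / 16 ->
  nrm (G (y + w) - G y - dd G y w) <= 512 * M / rho ^+ 2 * nrm w ^+ 2.
Proof.
move=> yz wr; have rr := rho0; have M0 := estimates_ge0.
have [->|w0] := eqVneq w 0; first by rewrite addr0 subrr ddE linear0 subrr !nrm0 expr0n mulr0.
have nw : 0 < nrm w.
  by rewrite lt_neqAle nrm_ge0 andbT eq_sym; apply: contra w0 => /eqP /nrm_eq0 ->.
(* On the square of half side [h] the increment [t *: w] has norm at most [2 * h * nrm w = rho / 4],
   so the line stays in the ball. The condition [1 <= h / 2] is the bound on [w], and 512 is 8 times
   64. *)
pose h := rho / (8 * nrm w); have h0 : 0 < h by rewrite divr_gt0// mulr_gt0.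
have inr t : in_sq (- h) (- h) (2 * h) t -> nrm (y + t *: w - z) < rho.
  move=> [/andP[a1 a2] /andP[b1 b2]].
  rewrite addrAC; apply: le_lt_trans (nrmD _ _) _; rewrite nrmZ.
  have : nrm t <= 2 * h - 0.
    rewrite nrmC (_ : t = Complex (Re t) 0 + Complex 0 (Im t) :> C); last first.
      by apply: complex_eqP; rewrite /= ?addr0 ?add0r.
    apply: le_trans (N_D _ _) _; rewrite /normc expr0n /= addr0 add0r !sqrtr_sqr.
    have : `|Re t| <= h by rewrite ler_norml; apply/andP; split; lra.
    have : `|Im t| <= h by rewrite ler_norml; apply/andP; split; lra.
    lra.
  rewrite subr0 => tb; have := ler_wpM2r (ltW nw) tb.
  rewrite (_ : 2 * h * nrm w = rho / 4); last by rewrite /h; field; rewrite gt_eqF.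
  lra.
pose f (t : C) : C := G (y + t *: w).
have df t : in_sq (- h) (- h) (2 * h) t -> differentiable f t.
  by move=> /inr /dG /diff_line[].
have fM t : in_sq (- h) (- h) (2 * h) t -> normc (f t) <= M.
  by move=> /inr /GM; rewrite nrmC.
have := hol_quadratic_estimate h0 df fM (t := 1).
have dG0 : differentiable G (y + (0 : C) *: w) by rewrite scale0r addr0; apply: dG; lra.
rewrite (diff_line dG0).2 -ddE /f scale0r scale1r addr0 mulr1 normc1 expr1n mulr1 -nrmC.
have -> : 8 * M / h ^+ 2 = 512 * M / rho ^+ 2 * nrm w ^+ 2.
  by rewrite /h; field; rewrite !gt_eqF.
apply; rewrite /h ler_pdivlMr// ler_pdivlMr ?mulr_gt0//; lra.
Qed.

(** At an increment of norm [rho / 16] the linear part differs by at most [2 * M] from an increment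
    of [G], itself of norm at most [2 * M]; scaling gives the factor 64. *)
Lemma cauchy_estimate y w : nrm (y - z) <= rho / 2 ->
  nrm (dd G y w) <= 64 * M / rho * nrm w.
Proof.
move=> yz; have rr := rho0; have M0 := estimates_ge0.
have [->|w0] := eqVneq w 0; first by rewrite ddE linear0 !nrm0 mulr0.
have nw : 0 < nrm w.
  by rewrite lt_neqAle nrm_ge0 andbT eq_sym; apply: contra w0 => /eqP /nrm_eq0 ->.
pose a := rho / (16 * nrm w); have a0 : 0 < a by rewrite divr_gt0// mulr_gt0.
have nr : nrm (creal a *: w) = rho / 16.
  by rewrite nrmZ nrm_creal ?ltW// /a; field; rewrite gt_eqF.
have := quadratic_estimate yz (w := creal a *: w); rewrite nr => /(_ (lexx _)).
have -> : 512 * M / rho ^+ 2 * (rho / 16) ^+ 2 = 2 * M by field; rewrite gt_eqF.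
move=> q.
have b1 : nrm (G (y + creal a *: w)) <= M.
  by apply: GM; rewrite addrAC; apply: le_lt_trans (nrmD _ _) _; rewrite nr; lra.
have b2 : nrm (G y) <= M by apply: GM; lra.
have : nrm (dd G y (creal a *: w)) <= 4 * M.
  rewrite (_ : dd G y (creal a *: w) = (G (y + creal a *: w)) - (G y)
     - (G (y + creal a *: w) - G y - dd G y (creal a *: w))); last first.
    by rewrite opprB addrC subrK.
  apply: le_trans (nrmD _ _) _; apply: le_trans (lerD (nrmD _ _) (lexx _)) _.
  rewrite !nrmN; lra.
rewrite ddZ nrmM (nrm_creal (ltW a0)) => H; rewrite -(ler_pM2l a0); apply: le_trans H _.
by rewrite le_eqVlt; apply/orP; left; apply/eqP; rewrite /a; field; rewrite !gt_eqF.
Qed.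

End Estimates.

Definition quot G v (h : C) y : C := (G (y + h *: v) - G y) * h^-1.

(** [quot_rate] controls the convergence of difference quotients to the derivative, [quot_sup] their
    size (64 from the Cauchy estimate and 32 = 512 / 16 from the rate), and [quot_curv] is the
    constant of the quadratic estimate for the quotients on the ball of radius [rho / 2]. *)
Definition quot_rate v (rho M : R) := 512 * M / rho ^+ 2 * nrm v ^+ 2.
Definition quot_sup v (rho M : R) := 96 * M / rho * nrm v.
Definition quot_curv v (rho M : R) := 512 * quot_sup v rho M / (rho / 2) ^+ 2.

Section Derivative.
Variables (G : V -> C) (z v : V) (rho M : R).
Hypothesis rho0 : 0 < rho.
Hypothesis dG : forall y, nrm (y - z) < rho -> differentiable G y.
Hypothesis GM : forall y, nrm (y - z) < rho -> nrm (G y) <= M.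

Definition small (h : C) := h != 0 /\ nrm h * nrm v <= rho / 16.

Let g y : C := dd G y v.
Let K1 := quot_rate v rho M.
Let B := quot_sup v rho M.
Let K2 := quot_curv v rho M.

Lemma nrm_gt0 (h : C) : h != 0 -> 0 < nrm h.
Proof.
by move=> h0; rewrite lt_neqAle nrm_ge0 andbT eq_sym; apply: contra h0 => /eqP /nrm_eq0 ->.
Qed.

Lemma quot_cvg h y : small h -> nrm (y - z) <= rho / 2 ->
  nrm (quot G v h y - g y) <= K1 * nrm h.
Proof.
move=> [h0 hv] yz; have rr := rho0; have nh := nrm_gt0 h0.
have := quadratic_estimate rho0 dG GM yz (w := h *: v); rewrite nrmZ => /(_ hv).
rewrite ddZ => q.
rewrite (_ : quot G v h y - g y = (G (y + h *: v) - G y - h * dd G y v) * h^-1); last first.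
  by rewrite /quot /g; field.
rewrite nrmM nrmV ler_pdivrMr//; apply: le_trans q _.
by rewrite /K1 /quot_rate le_eqVlt; apply/orP; left; apply/eqP; ring.
Qed.

Lemma K1_ge0 : 0 <= K1.
Proof.
have M0 : 0 <= M := estimates_ge0 rho0 GM.
apply: mulr_ge0; last exact: sqr_ge0.
by apply: divr_ge0; [exact: mulr_ge0 (ler0n _ _) M0|exact: sqr_ge0].
Qed.

Lemma K2_ge0 : 0 <= K2.
Proof.
have b0 : 0 <= B.
  apply: mulr_ge0; last exact: nrm_ge0.
  by apply: divr_ge0 (ltW rho0); exact: mulr_ge0 (ler0n _ _) (estimates_ge0 rho0 GM).
by apply: divr_ge0; [exact: mulr_ge0 (ler0n _ _) b0|exact: sqr_ge0].
Qed.

Lemma quot_bound h y : small h -> nrm (y - z) <= rho / 2 -> nrm (quot G v h y) <= B.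
Proof.
move=> sh yz; have rr := rho0; have := quot_cvg sh yz; have := cauchy_estimate rho0 dG GM v yz.
have M0 := estimates_ge0 rho0 GM.
have : K1 * nrm h <= 32 * M / rho * nrm v.
  have [_ hv] := sh; rewrite (_ : K1 * nrm h = 512 * M / rho ^+ 2 * nrm v * (nrm h * nrm v)); last by rewrite /K1 /quot_rate; ring.
  have c0 : 0 <= 512 * M / rho ^+ 2 * nrm v.
    apply: mulr_ge0; last exact: nrm_ge0.
    by apply: divr_ge0; [exact: mulr_ge0 (ler0n _ _) M0|exact: sqr_ge0].
  apply: le_trans (ler_wpM2l c0 hv) _.
  by rewrite le_eqVlt; apply/orP; left; apply/eqP; field; rewrite gt_eqF.
have := nrmD (quot G v h y - g y) (g y); rewrite subrK /B /quot_sup -/(g y); lra.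
Qed.

Lemma quot_diff h y : small h -> nrm (y - z) < rho / 2 ->
  differentiable (quot G v h) y /\
  forall w, dd (quot G v h) y w = (dd G (y + h *: v) w - dd G y w) * h^-1.
Proof.
move=> [h0 hv] yz; have rr := rho0.
have d1 : differentiable G (y + h *: v).
  by apply: dG; rewrite addrAC; apply: le_lt_trans (nrmD _ _) _; rewrite nrmZ; lra.
have d2 : differentiable G y by apply: dG; lra.
have ds : is_diff y (shift (h *: v)) id.
  by apply: (@is_diff_eq _ _ _ (id + cst (h *: v))); exact: addr0.
have dg1 : is_diff (shift (h *: v) y) G ('d G (y + h *: v)) by apply: DiffDef.
have dg2 : is_diff y G ('d G y) by apply: DiffDef.
have dgs : is_diff y (G \o shift (h *: v)) ('d G (y + h *: v) \o id) by exact: is_diff_comp.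
pose D1 : V -> C := 'd G (y + h *: v); pose D2 : V -> C := 'd G y.
have dq : is_diff y (h^-1 *: ((G \o shift (h *: v)) - G)) (h^-1 *: ((D1 \o id) - D2)).
  exact: is_diffZ.
have E : quot G v h = h^-1 *: ((G \o shift (h *: v)) - G) by apply/funext => w; exact: mulrC.
rewrite E; split; first exact: (@ex_diff _ _ _ _ _ _ _ dq).
move=> w; rewrite !ddE; transitivity (h^-1 * (D1 w - D2 w)); last by rewrite mulrC.
have F := @diff_val _ _ _ _ _ _ _ dq.
by transitivity ((h^-1 *: ((D1 \o id) - D2)) w) => //; rewrite -F.
Qed.

Lemma quot_quadratic h y w : small h -> nrm (y - z) <= rho / 4 ->
  nrm w <= rho / 32 ->
  nrm (quot G v h (y + w) - quot G v h y - dd (quot G v h) y w) <= K2 * nrm w ^+ 2.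
Proof.
move=> sh yz wr; have rr := rho0; have r2 : 0 < rho / 2 by lra.
apply: (@quadratic_estimate (quot G v h) z (rho / 2) B r2).
- by move=> y' yz'; have [] := quot_diff sh yz'.
- by move=> y' yz'; apply: quot_bound => //; lra.
- lra.
- lra.
Qed.

(** Replacing the quotient by its limit [g] costs [K1 * nrm h] at each of the two points. *)
Lemma dquot_quadratic h y w : small h -> nrm (y - z) <= rho / 4 ->
  nrm w <= rho / 32 ->
  nrm (g (y + w) - g y - dd (quot G v h) y w) <= K2 * nrm w ^+ 2 + 2 * K1 * nrm h.
Proof.
move=> sh yz wr; have rr := rho0; have q := quot_quadratic sh yz wr.
have c1 : nrm (quot G v h y - g y) <= K1 * nrm h by apply: quot_cvg => //; lra.
have c2 : nrm (quot G v h (y + w) - g (y + w)) <= K1 * nrm h.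
  apply: quot_cvg => //; rewrite addrAC; apply: le_trans (nrmD _ _) _; lra.
rewrite (_ : g (y + w) - g y - _ = (quot G v h (y + w) - quot G v h y - dd (quot G v h) y w)
   - (quot G v h (y + w) - g (y + w)) + (quot G v h y - g y)); last by ring.
apply: le_trans (nrmD _ _) _; apply: le_trans (lerD (nrmD _ _) (lexx _)) _.
rewrite nrmN; lra.
Qed.

Lemma dquot_bounded h y w : small h -> nrm (y - z) <= rho / 4 ->
  nrm (dd (quot G v h) y w) <= 64 * B / (rho / 2) * nrm w.
Proof.
move=> sh yz; have rr := rho0; have r2 : 0 < rho / 2 by lra.
apply: (@cauchy_estimate (quot G v h) z (rho / 2) B r2).
- by move=> y' yz'; have [] := quot_diff sh yz'.
- by move=> y' yz'; apply: quot_bound => //; lra.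
- lra.
Qed.

(* The differentials of the difference quotients converge because these quotients
   satisfy the quadratic estimate with a constant independent of the step. *)
Lemma dquot_lim y w : nrm (y - z) <= rho / 4 -> exists l : C, forall e : R, 0 < e ->
  exists2 d : R, 0 < d & forall h, small h -> nrm h < d ->
    nrm (dd (quot G v h) y w - l) <= e.
Proof.
move=> yz; have rr := rho0; have k1 := K1_ge0.
have k2 := K2_ge0.
pose L h : C := dd (quot G v h) y w.
have cau (e : R) : 0 < e -> exists2 d : R, 0 < d & forall h h', small h -> small h' ->
    nrm h < d -> nrm h' < d -> nrm (L h - L h') <= e.
  (* The direction is scaled by [tau]: after division by [tau] the quadratic error is of order
     [tau], hence small uniformly in [h], and the error [K1 * nrm h / tau] is then made small by the
     choice of [d]. *)
  move=> e0; pose tau := Num.min (rho / (32 * (nrm w + 1))) (e / (4 * (K2 * nrm w ^+ 2 + 1))).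
  have w1 : 0 < nrm w + 1 by have := nrm_ge0 w; lra.
  have kw : 0 <= K2 * nrm w ^+ 2 by apply: mulr_ge0 k2 (sqr_ge0 _).
  have tau0 : 0 < tau.
    by rewrite lt_min; apply/andP; split; apply: divr_gt0 => //; apply: mulr_gt0 => //; rewrite ?ltr0n//; lra.
  have [t1 t2] : tau <= rho / (32 * (nrm w + 1)) /\ tau <= e / (4 * (K2 * nrm w ^+ 2 + 1)).
    by rewrite /tau !ge_min !lexx orbT.
  have ta1 : tau * (32 * (nrm w + 1)) <= rho by rewrite -ler_pdivlMr//; apply: mulr_gt0 => //; rewrite ltr0n.
  have ta2 : tau * (4 * (K2 * nrm w ^+ 2 + 1)) <= e.
    by rewrite -ler_pdivlMr//; apply: mulr_gt0 => //; lra.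
  have nt := nrm_creal (ltW tau0).
  have tw : nrm (creal tau *: w) <= rho / 32 by rewrite nrmZ nt; lra.
  pose d := e * tau / (8 * (K1 + 1)).
  have d0 : 0 < d.
    by apply: divr_gt0; [exact: mulr_gt0|apply: mulr_gt0; [rewrite ltr0n|lra]].
  have dE : d * (8 * (K1 + 1)) = e * tau.
    by rewrite /d divfK// gt_eqF//; apply: mulr_gt0; [rewrite ltr0n|lra].
  exists d => // h h' sh sh' hd hd'.
  have := dquot_quadratic sh yz tw; have := dquot_quadratic sh' yz tw.
  have lz k : dd (quot G v k) y (creal tau *: w) = creal tau * L k by exact: ddZ.
  pose A := g (y + creal tau *: w) - g y.
  rewrite (lz h) (lz h') (nrmZ _ w) nt -/A => q' q.
  have : nrm (creal tau * (L h - L h')) <= 2 * (K2 * (tau * nrm w) ^+ 2) + 2 * K1 * nrm h + 2 * K1 * nrm h'.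
    have rg (a X Y b : C) : a * (X - Y) = (b - a * Y) - (b - a * X) by ring.
    rewrite (rg _ _ _ A).
    by apply: le_trans (le_trans (nrmBD _ _) (lerD q' q)) _; rewrite le_eqVlt; apply/orP; left; apply/eqP; ring.
  rewrite nrmM nt => q2; rewrite -(ler_pM2l tau0); apply: le_trans q2 _.
  have i1 := scaled_square_le tau0 kw ta2.
  have i2 := scaled_step_le k1 (nrm_ge0 h) hd dE.
  have i3 := scaled_step_le k1 (nrm_ge0 h') hd' dE.
  apply: le_trans (lerD (lerD i1 i2) i3) _.
  by rewrite le_eqVlt; apply/orP; left; apply/eqP; field.
pose F := filter_from [set d : R | 0 < d] (fun d => L @` [set h | small h /\ nrm h < d]).
have FF : ProperFilter F.
  apply: filter_from_proper; first apply: filter_from_filter.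
  - by exists 1 => /=.
  - move=> i j i0 j0; exists (Num.min i j); first by rewrite /= lt_min i0.
    move=> x [h [sh]]; rewrite lt_min => /andP[hi hj] <-.
    by split; exists h.
  - move=> d d0 /=; pose s := Num.min (d / 2) (rho / (16 * (nrm v + 1))).
    have v1 : 0 < nrm v + 1 by have := nrm_ge0 v; lra.
    have s0 : 0 < s.
      rewrite lt_min; apply/andP; split; apply: divr_gt0 => //.
      by apply: mulr_gt0 => //; rewrite ltr0n.
    have [s1 s2] : s <= d / 2 /\ s <= rho / (16 * (nrm v + 1)).
      by rewrite /s !ge_min !lexx orbT.
    have s3 : s * (16 * (nrm v + 1)) <= rho by rewrite -ler_pdivlMr//; apply: mulr_gt0 => //; rewrite ltr0n.
    have ns := nrm_creal (ltW s0).
    exists (L (creal s)), (creal s) => //; rewrite /small /= ns; split; last lra.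
    by split; [exact: creal_neq0|lra].
have [e e0|l hl] := complete_filter FF.
  have [d d0 hd] := cau e e0.
  have [x [h [sh hh] _]] : exists x, (L @` [set h | small h /\ nrm h < d]) x.
    by apply: (@filter_ex _ F); exists d.
  by exists (L h), d => // _ [h' [sh' hh'] <-] /=; apply: hd.
exists l => e e0; have [d d0 hd] := hl e e0; exists d => // h sh hh.
by apply: hd; exists h.
Qed.

Lemma dquot_lim_linear y : nrm (y - z) <= rho / 4 -> exists l : {linear V -> C},
  continuous l /\ forall w (e : R), 0 < e ->
  exists2 d : R, 0 < d & forall h, small h -> nrm h < d ->
    nrm (dd (quot G v h) y w - l w) <= e.
Proof.
move=> yz; have rr := rho0; have [l hl] := choice (fun w => dquot_lim w yz).
have ex d : 0 < d -> exists h, small h /\ nrm h < d.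
  move=> d0; pose s := Num.min (d / 2) (rho / (16 * (nrm v + 1))).
  have v1 : 0 < nrm v + 1 by have := nrm_ge0 v; lra.
  have s0 : 0 < s.
    rewrite lt_min; apply/andP; split; apply: divr_gt0 => //.
    by apply: mulr_gt0 => //; rewrite ltr0n.
  have [s1 s2] : s <= d / 2 /\ s <= rho / (16 * (nrm v + 1)).
    by rewrite /s !ge_min !lexx orbT.
  have s3 : s * (16 * (nrm v + 1)) <= rho by rewrite -ler_pdivlMr//; apply: mulr_gt0 => //; rewrite ltr0n.
  have ns := nrm_creal (ltW s0).
  exists (creal s); rewrite /small ns; split; last lra.
  by split; [exact: creal_neq0|lra].
have lin : linear l.
  move=> a u w; apply/eqP; rewrite -subr_eq0; apply/eqP/nrm_eq0/eqP.
  rewrite eq_le nrm_ge0 andbT; apply/ler_addgt0Pr => e e0; rewrite add0r.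
  have a1 : 0 < nrm a + 2 by have := nrm_ge0 a; lra.
  pose e' := e / (nrm a + 2); have e'0 : 0 < e' by apply: divr_gt0.
  have e'E : e' * (nrm a + 2) = e by rewrite /e' divfK// gt_eqF.
  have [d1 d10 h1] := hl (a *: u + w) _ e'0; have [d2 d20 h2] := hl u _ e'0.
  have [d3 d30 h3] := hl w _ e'0.
  have [|h [sh]] := ex (Num.min d1 (Num.min d2 d3)); first by rewrite !lt_min d10 d20.
  rewrite !lt_min => /and3P[hd1 hd2 hd3].
  have {}h1 := h1 h sh hd1; have {}h2 := h2 h sh hd2; have {}h3 := h3 h sh hd3.
  rewrite ddP in h1.
  have -> : a *: l u + l w = a * l u + l w by [].
  set X := dd _ _ u in h1 h2; set Y := dd _ _ w in h1 h3.
  rewrite (_ : l (a *: u + w) - _ = a * (X - l u) + (Y - l w) - (a * X + Y - l (a *: u + w))); last by ring.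
  apply: le_trans (nrmD _ _) _; apply: le_trans (lerD (nrmD _ _) (lexx _)) _.
  rewrite nrmN nrmM; have := ler_wpM2l (nrm_ge0 a) h2; lra.
pose lM := GRing.isLinear.Build _ _ _ _ _ lin.
pose lL : {linear V -> C} := HB.pack l lM.
exists lL; split => //.
apply: (@bounded_linear_cont _ _ lL (64 * B / (rho / 2))) => w.
apply/ler_addgt0Pr => e e0; have [d d0 hd] := hl w _ e0.
have [h [sh hh]] := ex d d0; have := hd h sh hh; have := dquot_bounded w sh yz.
have := nrmD (l w - dd (quot G v h) y w) (dd (quot G v h) y w).
rewrite subrK nrmB /=; lra.
Qed.

Lemma dquot_lim_quadratic y w (l : V -> C) : nrm (y - z) <= rho / 4 ->
  (forall (e : R), 0 < e -> exists2 d : R, 0 < d & forall h, small h -> nrm h < d ->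
     nrm (dd (quot G v h) y w - l w) <= e) ->
  nrm w <= rho / 32 -> nrm (g (y + w) - g y - l w) <= K2 * nrm w ^+ 2.
Proof.
move=> yz hl wr; have rr := rho0; have k1 := K1_ge0; apply/ler_addgt0Pr => e e0.
have e20 : 0 < e / 2 by lra.
have [d d0 hd] := hl _ e20.
pose s := Num.min (Num.min (d / 2) (e / (4 * (K1 + 1)))) (rho / (16 * (nrm v + 1))).
have v1 : 0 < nrm v + 1 by have := nrm_ge0 v; lra.
have s0 : 0 < s.
  rewrite !lt_min; apply/andP; split; first (apply/andP; split); apply: divr_gt0 => //.
    by apply: mulr_gt0 => //; lra.
  by apply: mulr_gt0 => //; rewrite ltr0n.
have [s1 s2 s3] : [/\ s <= d / 2, s <= e / (4 * (K1 + 1)) & s <= rho / (16 * (nrm v + 1))].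
  by rewrite /s !ge_min !lexx !orbT.
have s4 : s * (16 * (nrm v + 1)) <= rho by rewrite -ler_pdivlMr//; apply: mulr_gt0 => //; rewrite ltr0n.
have s5 : s * (4 * (K1 + 1)) <= e by rewrite -ler_pdivlMr//; apply: mulr_gt0 => //; lra.
have ns := nrm_creal (ltW s0).
have sh : small (creal s) by rewrite /small ns; split; [exact: creal_neq0|lra].
have := hd _ sh; rewrite ns => /(_ ltac:(lra)) h1.
have := dquot_quadratic sh yz wr; rewrite ns => h2.
rewrite (_ : g (y + w) - g y - l w = (g (y + w) - g y - dd (quot G v (creal s)) y w) + (dd (quot G v (creal s)) y w - l w)); last by ring.
apply: le_trans (nrmD _ _) _.
have : 2 * K1 * s <= e / 2 by have := ltW s0; lra.
lra.
Qed.

(** Goursat's theorem: the quadratic estimate for the quotients has a constant independent of [h],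
    so it survives the limit. *)
Lemma derivative_differentiable y : nrm (y - z) <= rho / 4 ->
  differentiable (fun y => dd G y v : C) y.
Proof.
move=> yz; have rr := rho0; have [l [cl hl]] := dquot_lim_linear yz.
have k2 := K2_ge0.
have [] // := @nrm_diff V C (fun y => dd G y v) y l cl _ => e e0.
exists (Num.min (rho / 32) (e / (K2 + 1))).
  by rewrite lt_min; apply/andP; split; apply: divr_gt0 => //; lra.
move=> w; rewrite lt_min => /andP[w1 w2].
rewrite ltr_pdivlMr in w2; last by lra.
apply: le_trans (dquot_lim_quadratic yz (hl w) (ltW w1)) _.
by rewrite expr2 mulrA ler_wpM2r ?nrm_ge0//; have := nrm_ge0 w; lra.
Qed.

End Derivative.

Lemma near_bounds G z : (\forall y \near z, differentiable G y) ->
  exists2 rho : R, 0 < rho & exists M : R, forall y, nrm (y - z) < rho ->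
    differentiable G y /\ nrm (G y) <= M.
Proof.
move=> dG; have dGz : differentiable G z by exact: nbhs_singleton dG.
have /nearN[d d0 hd] := dG.
have c : {for z, continuous G} by exact: differentiable_continuous.
have /nearN[d' d'0 hd'] : \forall y \near z, nrm (G y - G z) < 1.
  have /(_ (fun u => nrm (u - G z) < 1)) := c; apply.
  by apply: (proj2 (@nearN C (fun u => nrm (u - G z) < 1) (G z))); exists 1.
exists (Num.min d d'); first by rewrite lt_min d0.
exists (nrm (G z) + 1) => y; rewrite lt_min => /andP[/hd y1 /hd' y2]; split => //.
have := nrmD (G y - G z) (G z); rewrite subrK; lra.
Qed.

Lemma derive_hol G z v : (\forall y \near z, differentiable G y) ->
  \forall y \near z, differentiable (fun y => 'D_v G y) y.
Proof.
move=> /near_bounds[rho rho0 [M h]].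
have dG y : nrm (y - z) < rho -> differentiable G y by move=> /h[].
have GM y : nrm (y - z) < rho -> nrm (G y) <= M by move=> /h[].
apply/nearN; exists (rho / 4); first by lra.
move=> y yz; have [] // := @near_dd V C (fun y => dd G y v) (fun y => 'D_v G y) y.
  apply/nearN; exists (rho / 4); first by lra.
  move=> y' y'y; rewrite dd_derive//; apply: dG.
  by have := nrmD (y' - y) (y - z); rewrite addrA subrK; lra.
by apply: (derivative_differentiable v rho0 dG GM); exact: ltW.
Qed.

(** The second difference is symmetric in [u] and [v], while its limit involves one order of
    differentiation; comparing the two instances proves [derive_sym]. *)
Lemma second_difference G z u v (rho M : R) : 0 < rho ->
  (forall y, nrm (y - z) < rho -> differentiable G y) ->
  (forall y, nrm (y - z) < rho -> nrm (G y) <= M) ->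
  forall e : R, 0 < e -> exists2 d : R, 0 < d & forall t : R, 0 < t < d ->
  nrm (G (z + creal t *: u + creal t *: v) - G (z + creal t *: u)
       - G (z + creal t *: v) + G z
       - creal t ^+ 2 * dd (fun y => dd G y v : C) z u) <= e * t ^+ 2.
Proof.
move=> rho0 dG GM e e0; have zz : nrm (z - z) <= rho / 4 by rewrite subrr nrm0; lra.
pose g y : C := dd G y v.
have dg : differentiable g z := derivative_differentiable v rho0 dG GM zz.
have u1 : 0 < nrm u + 1 by have := nrm_ge0 u; lra.
have e1 : 0 < e / (2 * (nrm u + 1)) by apply: divr_gt0 => //; apply: mulr_gt0.
have [d d0 hd] := diff_dd dg e1.
pose K2 := quot_curv u rho M.
have k2 : 0 <= K2 := K2_ge0 u rho0 GM.
pose L := K2 * nrm v ^+ 2 + 1.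
have L0 : 0 < L by have := mulr_ge0 k2 (sqr_ge0 (nrm v)); rewrite /L; lra.
have v1 : 0 < nrm v + 1 by have := nrm_ge0 v; lra.
exists (Num.min (Num.min (d / (nrm u + 1)) (e / (2 * L)))
   (Num.min (rho / (32 * (nrm u + 1))) (rho / (32 * (nrm v + 1))))).
  rewrite !lt_min; apply/andP; split; apply/andP; split; apply: divr_gt0 => //.
  - exact: mulr_gt0.
  - by apply: mulr_gt0 => //; rewrite ltr0n.
  - by apply: mulr_gt0 => //; rewrite ltr0n.
move=> t /andP[t0]; rewrite !lt_min => /andP[/andP[t1 t2] /andP[t3 t4]].
rewrite ltr_pdivlMr// in t1; rewrite ltr_pdivlMr in t2; last exact: mulr_gt0.
rewrite ltr_pdivlMr in t3; last by apply: mulr_gt0 => //; rewrite ltr0n.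
rewrite ltr_pdivlMr in t4; last by apply: mulr_gt0 => //; rewrite ltr0n.
have nt := nrm_creal (ltW t0); have tn0 : creal t != 0 := creal_neq0 t0.
have sm : small u rho (creal t) by split => //; rewrite nt; lra.
have tv : nrm (creal t *: v) <= rho / 32 by rewrite nrmZ nt; lra.
have := quot_quadratic rho0 dG GM sm zz tv.
have [|_ dq] := quot_diff (z := z) (v := u) rho0 dG sm (y := z); first by rewrite subrr nrm0; lra.
rewrite -/K2 (dq (creal t *: v)) => q.
have lz y : dd G y (creal t *: v) = creal t * g y by exact: ddZ.
rewrite (lz z) (lz (z + creal t *: u)) in q.
have := hd (creal t *: u); rewrite (nrmZ _ u) nt => /(_ ltac:(lra)).
rewrite (_ : dd g z (creal t *: u) = creal t * dd g z u); last exact: ddZ.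
rewrite (nrmZ _ v) nt in q; move=> h.
(* The second difference is [creal t] times an increment of the quotient in direction [u]. The error
   splits into the quadratic remainder of that quotient and the first order remainder of [g] along
   [u]. *)
rewrite (_ : _ - _ = creal t * (quot G u (creal t) (z + creal t *: v) - quot G u (creal t) z -
    (creal t * g (z + creal t *: u) - creal t * g z) / creal t) +
    creal t * (g (z + creal t *: u) - g z - creal t * dd g z u)); last first.
  by rewrite /quot [z + creal t *: v + _]addrAC; field.
apply: le_trans (nrmD _ _) _; rewrite !nrmM nt.
have q2 := ler_wpM2l (ltW t0) q; have h2 := ler_wpM2l (ltW t0) h.
apply: le_trans (lerD q2 h2) _.
have i1 : t * (K2 * (t * nrm v) ^+ 2) <= e / 2 * t ^+ 2.
  rewrite (_ : t * _ = (t * (K2 * nrm v ^+ 2)) * t ^+ 2); last by ring.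
  apply: ler_wpM2r; first exact: sqr_ge0.
  by move: t2; rewrite /L; lra.
have i2 : t * (e / (2 * (nrm u + 1)) * (t * nrm u)) <= e / 2 * t ^+ 2.
  rewrite (_ : t * _ = (e * nrm u / (2 * (nrm u + 1))) * t ^+ 2); last by field; rewrite gt_eqF.
  apply: ler_wpM2r; first exact: sqr_ge0.
  rewrite ler_pdivrMr; last exact: mulr_gt0.
  lra.
lra.
Qed.

Lemma derive_sym G z u v : (\forall y \near z, differentiable G y) ->
  'D_u ('D_v G) z = 'D_v ('D_u G) z.
Proof.
move=> nG; have [rho rho0 [M h]] := near_bounds nG.
have dG y : nrm (y - z) < rho -> differentiable G y by move=> /h[].
have GM y : nrm (y - z) < rho -> nrm (G y) <= M by move=> /h[].
have zz : nrm (z - z) <= rho / 4 by rewrite subrr nrm0; lra.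
have E a b : 'D_a ('D_b G) z = dd (fun y => dd G y b : C) z a.
  have dg := derivative_differentiable b rho0 dG GM zz.
  have [|d1 d2] := @near_dd V C (fun y => dd G y b) ('D_b G) z _ dg.
    apply/nearN; exists rho => // y' y'y; rewrite dd_derive//; exact: dG.
  by rewrite (dd_derive _ d1) d2.
apply: etrans (E u v) _; apply: etrans _ (esym (E v u)).
apply: subr0_eq; apply: nrm_eq0; apply/eqP.
rewrite eq_le nrm_ge0 andbT; apply/ler_addgt0Pr => e e0; rewrite add0r.
have e20 : 0 < e / 2 by lra.
have [d1 d10 h1] := second_difference u v rho0 dG GM e20.
have [d2 d20 h2] := second_difference v u rho0 dG GM e20.
pose t := Num.min d1 d2 / 2.
have t0 : 0 < t by apply: divr_gt0 => //; rewrite lt_min d10.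
have [m1 m2] : Num.min d1 d2 <= d1 /\ Num.min d1 d2 <= d2 by rewrite !ge_min !lexx orbT.
have {}h1 := h1 t ltac:(apply/andP; split => //; rewrite /t in t0 *; lra).
have {}h2 := h2 t ltac:(apply/andP; split => //; rewrite /t in t0 *; lra).
have nt := nrm_creal (ltW t0).
rewrite -(@ler_pM2r _ (t ^+ 2)) ?exprn_gt0//.
set A := dd _ _ u in h1 *; set A' := dd _ _ v in h2 *.
rewrite -[t ^+ 2 in leLHS]/(t * t) -nt -!nrmM -expr2.
rewrite [z + creal t *: v + _]addrAC in h2.
set S := G (z + creal t *: u + creal t *: v) in h1 h2.
set S1 := G _ in h1 h2; set S2 := G (z + creal t *: v) in h1 h2; set S0 := G z in h1 h2.
rewrite (_ : _ * _ = (S - S2 - S1 + S0 - creal t ^+ 2 * A') - (S - S1 - S2 + S0 - creal t ^+ 2 * A)); last by ring.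
apply: le_trans (nrmD _ _) _; rewrite nrmN nt; lra.
Qed.

End Cauchy.

End RealNorm.

(** * Polynomial maps and local inverses *)

Section PolynomialInduction.
Variables (C : numClosedFieldType) (N : nat).
Implicit Types (p q : mpoly N C) (v : 'rV[C]_N).

Lemma mpoly_ring_ind (P : mpoly N C -> Prop) :
  (forall c, P (mpolyC N c)) -> (forall i, P (mpolyX C (mnm1 i))) ->
  (forall p q, P p -> P q -> P (p + q)) ->
  (forall p q, P p -> P q -> P (p * q)) -> forall p, P p.
Proof.
move=> PC PX PD PM p; rewrite (mpolyE p).
have P0 : P 0 by rewrite -mpolyC0.
have P1 : P 1 by rewrite -mpolyC1.
apply: (big_ind P); [exact: P0|exact: PD|] => m _.
rewrite -mul_mpolyC; apply: (PM) => //; rewrite mpolyXE_id.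
apply: (big_ind P); [exact: P1|exact: PM|] => i _.
by elim: (m i) => [|k IH]; rewrite ?expr0// exprS; apply: (PM).
Qed.

Lemma pevalD p q v : peval (p + q) v = peval p v + peval q v.
Proof. exact: mevalD. Qed.

Lemma pevalM p q v : peval (p * q) v = peval p v * peval q v.
Proof. exact: mevalM. Qed.

Lemma pevalC c v : peval (mpolyC N c) v = c.
Proof. exact: mevalC. Qed.

Lemma pevalX i v : peval (mpolyX C (mnm1 i)) v = v 0 i.
Proof. exact: mevalXU. Qed.

Lemma peval_sum I (r : seq I) (P : pred I) (F : I -> mpoly N C) v :
  peval (\sum_(i <- r | P i) F i) v = \sum_(i <- r | P i) peval (F i) v.
Proof. exact: raddf_sum. Qed.

Lemma peval_prod I (r : seq I) (P : pred I) (F : I -> mpoly N C) v :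
  peval (\prod_(i <- r | P i) F i) v = \prod_(i <- r | P i) peval (F i) v.
Proof. exact: rmorph_prod. Qed.

Lemma peval_det k (A : 'M[mpoly N C]_k) v :
  peval (\det A) v = \det (\matrix_(i, j) peval (A i j) v).
Proof.
rewrite /peval -det_map_mx; congr (\det _).
by apply/matrixP => i j; rewrite !mxE.
Qed.

Definition grad p v (u : 'rV[C]_N) : C :=
  \sum_k peval (mderiv k p) v * u 0 k.

Lemma gradD p q v u : grad (p + q) v u = grad p v u + grad q v u.
Proof.
by rewrite /grad -big_split; apply: eq_bigr => k _; rewrite mderivD pevalD mulrDl.
Qed.

Lemma gradM p q v u :
  grad (p * q) v u = grad p v u * peval q v + peval p v * grad q v u.
Proof.
rewrite /grad mulr_suml mulr_sumr -big_split; apply: eq_bigr => k _ /=.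
by rewrite mderivM pevalD !pevalM; ring.
Qed.

Lemma gradC c v u : grad (mpolyC N c) v u = 0.
Proof.
rewrite /grad big1// => k _.
by rewrite mderivC -mpolyC0 pevalC mul0r.
Qed.

Lemma gradX i v u : grad (mpolyX C (mnm1 i)) v u = u 0 i.
Proof.
rewrite /grad (bigD1 i)//= big1 ?addr0 => [|k ki].
  rewrite mderivX mnm1E eqxx scale1r.
  have -> : mnm_sub (mnm1 i) (mnm1 i) = @mnm0 N.
    by apply/mnmP => j; rewrite mnmBE subnn mnm0E.
  by rewrite mpolyX0 -mpolyC1 pevalC mul1r.
by rewrite mderivX mnm1E eq_sym (negPf ki) scale0r -mpolyC0 pevalC mul0r.
Qed.

Lemma grad_linear p v a u u' :
  grad p v (a *: u + u') = a * grad p v u + grad p v u'.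
Proof.
rewrite /grad mulr_sumr -big_split; apply: eq_bigr => k _ /=.
by rewrite !mxE; ring.
Qed.

End PolynomialInduction.

(** * Strict differentiability and the inverse function theorem *)

Section InverseFunction.
Variable R : realType.
Local Notation C := (cplx R).

Lemma nrm_ltP N (u : 'rV[C]_N) (e : R) : 0 < e ->
  nrm u < e <-> forall k, nrm (u 0 k) < e.
Proof.
move=> e0; have B : ball (0 : 'M[C]_(1, N)) (creal e) u <-> nrm u < e.
  by rewrite mx_norm_ball /ball_ /= sub0r normrN nrmE /creal /cplx ltcR.
split=> [/B[_ h] k|h].
  by have := h 0 k; rewrite -ball_normE /ball_ /= mxE sub0r normrN nrmE /creal /cplx ltcR.
apply/B; split=> [|i k]; first by rewrite /creal /cplx ltcR.
by rewrite -ball_normE /ball_ /= mxE sub0r normrN nrmE /creal /cplx ltcR ord1; exact: h.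
Qed.

Lemma nrm_coord N (u : 'rV[C]_N) k : nrm (u 0 k) <= nrm u.
Proof.
apply/ler_addgt0Pr => e e0; apply: ltW.
have p0 : 0 < nrm u + e by have := nrm_ge0 u; lra.
by move: k; apply/(nrm_ltP _ p0); lra.
Qed.

Lemma nrm_le_coord N (u : 'rV[C]_N) (e : R) : 0 <= e ->
  (forall k, nrm (u 0 k) <= e) -> nrm u <= e.
Proof.
move=> e0 h; apply/ler_addgt0Pr => d d0; apply: ltW.
have p0 : 0 < e + d by lra.
by apply/(nrm_ltP _ p0) => k; have := h k; lra.
Qed.

Lemma nrm_sum I (r : seq I) (P : pred I) (V : normedModType C) (F : I -> V) :
  nrm (\sum_(i <- r | P i) F i) <= \sum_(i <- r | P i) nrm (F i).
Proof.
elim/big_rec2: _ => [|i a b _ h]; first by rewrite nrm0.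
by apply: le_trans (nrmD _ _) _; rewrite lerD2l.
Qed.

Lemma coord_form_bound N (c : 'I_N -> C) : exists2 B : R, 0 <= B &
  forall u : 'rV[C]_N, nrm (\sum_k c k * u 0 k) <= B * nrm u.
Proof.
exists (\sum_k nrm (c k)); first by apply: sumr_ge0 => k _; exact: nrm_ge0.
move=> u; apply: le_trans (nrm_sum _ _ _) _; rewrite mulr_suml.
by apply: ler_sum => k _; rewrite nrmM ler_wpM2l ?nrm_ge0 ?nrm_coord.
Qed.

Lemma mulmx_bound N M (A : 'M[C]_(N, M)) : exists2 B : R, 0 <= B &
  forall u : 'rV[C]_N, nrm (u *m A) <= B * nrm u.
Proof.
have ex j : exists B : R, 0 <= B /\
    forall u : 'rV[C]_N, nrm (\sum_k A k j * u 0 k) <= B * nrm u.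
  by have [B B0 hB] := coord_form_bound (fun k => A k j); exists B.
have [b hb] := choice ex.
have b0 j : 0 <= b j by case: (hb j).
exists (\sum_j b j); first by apply: sumr_ge0.
move=> u; apply: nrm_le_coord; first by rewrite mulr_ge0 ?nrm_ge0 ?sumr_ge0.
move=> j; rewrite mxE (eq_bigr (fun k => A k j * u 0 k)) => [|k _]; last by rewrite mulrC.
have [_ /(_ u) h] := hb j; apply: le_trans h _; rewrite ler_wpM2r ?nrm_ge0//.
by rewrite (bigD1 j)//= lerDl sumr_ge0.
Qed.

Lemma nrm_le_dist (V : normedModType C) (x y : V) (c : R) :
  nrm (x - y) <= c -> nrm x <= nrm y + c.
Proof. by move=> h; have := nrmD (x - y) y; rewrite subrK; lra. Qed.

Lemma strict_continuity N (P : mpoly N C) (a x : 'rV[C]_N) (B d n : R) :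
  n <= 1 -> 0 <= B -> (forall u, nrm (grad P a u) <= B * nrm u) ->
  (forall v v', nrm (v - a) < d -> nrm (v' - a) < d ->
    nrm (peval P v - peval P v' - grad P a (v - v')) <= n * nrm (v - v')) ->
  0 < d -> nrm (x - a) < d -> nrm (x - a) < n / (B + 1) ->
  nrm (peval P x - peval P a) <= n.
Proof.
move=> n1 B0 hB hP d0 xd; have b1 : 0 < B + 1 by lra.
rewrite ltr_pdivlMr// => xn; have aa : nrm (a - a) < d by rewrite subrr nrm0.
have := nrmD (peval P x - peval P a - grad P a (x - a)) (grad P a (x - a)).
rewrite subrK => /le_trans; apply; apply: le_trans (lerD (hP _ _ xd aa) (hB _)) _.
apply: le_trans (ltW xn); rewrite -mulrDl mulrC ler_wpM2l ?nrm_ge0//.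
by rewrite addrC lerD2l.
Qed.

(** Both points move: this strict form makes the fixed-Jacobian iteration of [local_inverse] a
    contraction and also yields injectivity. It passes to sums and products. *)
Lemma poly_strict N (p : mpoly N C) (a : 'rV[C]_N) (e : R) : 0 < e ->
  exists2 d : R, 0 < d & forall v v', nrm (v - a) < d -> nrm (v' - a) < d ->
    nrm (peval p v - peval p v' - grad p a (v - v')) <= e * nrm (v - v').
Proof.
move: p e; apply: mpoly_ring_ind => [c|i|p q hp hq|p q hp hq] e e0.
- exists 1 => // v v' _ _; rewrite !pevalC gradC subrr subr0 nrm0.
  by rewrite mulr_ge0 ?nrm_ge0// ltW.
- exists 1 => // v v' _ _; rewrite !pevalX gradX !mxE subrr nrm0.
  by rewrite mulr_ge0 ?nrm_ge0// ltW.
- have e2 : 0 < e / 2 by lra.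
  have [d1 d10 h1] := hp _ e2; have [d2 d20 h2] := hq _ e2.
  exists (Num.min d1 d2); first by rewrite lt_min d10.
  move=> v v'; rewrite !lt_min => /andP[a1 a2] /andP[b1 b2].
  rewrite !pevalD gradD.
  have rg (f f' F g g' G : C) : f + g - (f' + g') - (F + G) = (f - f' - F) + (g - g' - G) by ring.
  rewrite rg; apply: le_trans (nrmD _ _) _.
  apply: le_trans (lerD (h1 _ _ a1 b1) (h2 _ _ a2 b2)) _.
  by rewrite -mulrDl -splitr.
have [F F0 hF] := coord_form_bound (fun k => peval (mderiv k p) a).
have [G G0 hG] := coord_form_bound (fun k => peval (mderiv k q) a).
have {}hF u : nrm (grad p a u) <= F * nrm u := hF u.
have {}hG u : nrm (grad q a u) <= G * nrm u := hG u.
(* [K] adds up the coefficients of the four error terms of the product rule displayed in [rg]. *)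
pose K := nrm (peval q a) + nrm (peval p a) + 2 + F + G.
have K0 : 0 < K by rewrite /K; have := nrm_ge0 (peval q a); have := nrm_ge0 (peval p a); lra.
pose n := Num.min 1 (e / K).
have n0 : 0 < n by rewrite lt_min ltr01 divr_gt0.
have n1 : n <= 1 by rewrite /n ge_min lexx.
have nK : n * K <= e by rewrite -ler_pdivlMr// /n ge_min lexx orbT.
have [d1 d10 h1] := hp _ n0; have [d2 d20 h2] := hq _ n0.
exists (Num.min (Num.min d1 d2) (Num.min (n / (F + 1)) (n / (G + 1)))).
  by rewrite !lt_min d10 d20 !divr_gt0//; lra.
move=> v v'; rewrite !lt_min => /andP[/andP[a1 a2] /andP[a3 a4]] /andP[/andP[b1 b2] /andP[b3 b4]].
have rg (f f' fa Fd g g' ga Gd : C) : f * g - f' * g' - (Fd * ga + fa * Gd) =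
    (f - f' - Fd) * g + Fd * (g - ga) + f' * (g - g' - Gd) + (f' - fa) * Gd by ring.
rewrite !pevalM gradM rg; set f := peval p v; set f' := peval p v'.
set g := peval q v; set g' := peval q v'; set fa := peval p a; set ga := peval q a.
set Fd := grad p a (v - v'); set Gd := grad q a (v - v').
apply: le_trans (nrmD _ _) _; apply: le_trans (lerD (nrmD _ _) (lexx _)) _.
apply: le_trans (lerD (lerD (nrmD _ _) (lexx _)) (lexx _)) _.
rewrite !nrmM.
have cg := strict_continuity n1 G0 hG h2 d20 a2 a4.
have cf := strict_continuity n1 F0 hF h1 d10 b1 b3.
rewrite -/g -/ga in cg; rewrite -/f' -/fa in cf.
have i1 := h1 _ _ a1 b1; have i2 := h2 _ _ a2 b2; rewrite -/f -/f' -/Fd in i1; rewrite -/g -/g' -/Gd in i2.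
have i3 := hF (v - v'); have i4 := hG (v - v'); rewrite -/Fd in i3; rewrite -/Gd in i4.
set D := nrm (v - v') in i1 i2 i3 i4 *; have D0 : 0 <= D := nrm_ge0 _.
have gb : nrm g <= nrm ga + 1 by apply: le_trans (nrm_le_dist cg) _; rewrite lerD2l.
have fb : nrm f' <= nrm fa + 1 by apply: le_trans (nrm_le_dist cf) _; rewrite lerD2l.
have j1 : nrm (f - f' - Fd) * nrm g <= n * D * (nrm ga + 1) := ler_pM (nrm_ge0 _) (nrm_ge0 _) i1 gb.
have j2 : nrm Fd * nrm (g - ga) <= F * D * n := ler_pM (nrm_ge0 _) (nrm_ge0 _) i3 cg.
have j3 : nrm f' * nrm (g - g' - Gd) <= (nrm fa + 1) * (n * D) := ler_pM (nrm_ge0 _) (nrm_ge0 _) fb i2.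
have j4 : nrm (f' - fa) * nrm Gd <= n * (G * D) := ler_pM (nrm_ge0 _) (nrm_ge0 _) cf i4.
apply: le_trans (lerD (lerD (lerD j1 j2) j3) j4) _.
rewrite (_ : _ + _ = n * K * D); last by rewrite /K; ring.
by rewrite ler_wpM2r.
Qed.

Lemma poly_diff N (p : mpoly N C) (a : 'rV[C]_N) :
  differentiable (peval p) a /\ forall w, dd (peval p) a w = grad p a w.
Proof.
have lin : linear (grad p a) by move=> b u u'; exact: grad_linear.
pose lM := GRing.isLinear.Build _ _ _ _ _ lin.
pose l : {linear 'rV[C]_N -> C} := HB.pack (grad p a) lM.
have [B _ hB] := coord_form_bound (fun k => peval (mderiv k p) a).
have cl : continuous l by exact: (@bounded_linear_cont _ _ _ l B).
have [|df E] := @nrm_diff _ _ _ (peval p) a l cl.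
  move=> e e0; have [d d0 hd] := poly_strict p a e0; exists d => // w wd.
  by have := hd (a + w) a; rewrite subrr nrm0 [a + w - a]addrAC subrr add0r; apply.
split; first exact: df.
by move=> w; rewrite ddE; exact: (congr1 (fun F : 'rV[C]_N -> C => F w) E).
Qed.

Lemma poly_near_neq0 N (p : mpoly N C) (a : 'rV[C]_N) : peval p a != 0 ->
  \forall v \near a, peval p v != 0.
Proof.
move=> pa; have c : {for a, continuous (peval p)}.
  exact: differentiable_continuous (poly_diff p a).1.
have /(_ (fun z => z != 0)) := c; apply.
apply: (proj2 (@nearN R C (fun z => z != 0) (peval p a))).
exists (nrm (peval p a)).
  by rewrite lt_neqAle nrm_ge0 andbT eq_sym; apply: contra pa => /eqP /nrm_eq0 ->.
by move=> y h; apply/eqP => y0; move: h; rewrite y0 sub0r nrmN ltxx.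
Qed.

(** The inverse of one plus the sum of the inverses, rather than a minimum, also serves an empty
    index type. *)
Lemma fin_pos_lower (I : finType) (d : I -> R) : (forall i, 0 < d i) ->
  exists2 m : R, 0 < m & forall i, m <= d i.
Proof.
move=> d0; have s0 : 0 <= \sum_i (d i)^-1 by apply: sumr_ge0 => i _; rewrite invr_ge0 ltW.
exists (1 + \sum_i (d i)^-1)^-1; first by rewrite invr_gt0; lra.
move=> i; rewrite -[leRHS]invrK lef_pV2 ?posrE ?invr_gt0//; last by lra.
rewrite (bigD1 i)//= addrCA lerDl addr_ge0// sumr_ge0// => j _.
by rewrite invr_ge0 ltW.
Qed.

Lemma absorb_half (x y z : R) : x <= y + z -> z <= 1 / 2 * x -> x <= 2 * y.
Proof. lra. Qed.

Lemma geometric_le (mu q : R) : 0 <= mu -> 0 <= q -> 2 * mu * (1 - q) <= 2 * mu.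
Proof. nra. Qed.

Lemma geometric_lt (mu d q : R) : 0 <= mu -> 2 * mu < d -> 0 <= q ->
  2 * mu * (1 - q) < d.
Proof. nra. Qed.

Lemma scaled_error_le (e b b' n : R) : 0 < b -> 0 <= b' -> 0 <= n -> 0 <= e ->
  b' * (e / (2 * b * (b' + 1)) * (2 * b * n)) <= e * n.
Proof.
move=> b0 b'0 n0 e0; have b1 : 0 < b' + 1 by lra.
rewrite (_ : _ * _ = e * n * (b' / (b' + 1))); last by field; rewrite !gt_eqF.
by rewrite ler_piMr ?mulr_ge0// ler_pdivrMr//; lra.
Qed.

Section Inverse.
Variables (N : nat) (P : 'I_N -> mpoly N C) (a : 'rV[C]_N).

Definition pmap (v : 'rV[C]_N) : 'rV[C]_N := \row_j peval (P j) v.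
Definition jac (v : 'rV[C]_N) : 'M[C]_N :=
  \matrix_(k, j) peval (mderiv k (P j)) v.

Lemma grad_jac j v u : grad (P j) v u = (u *m jac v) 0 j.
Proof. by rewrite mxE; apply: eq_bigr => k _; rewrite mxE mulrC. Qed.

Lemma pmap_strict b (e : R) : 0 < e -> exists2 d : R, 0 < d & forall v v',
  nrm (v - b) < d -> nrm (v' - b) < d ->
  nrm (pmap v - pmap v' - (v - v') *m jac b) <= e * nrm (v - v').
Proof.
move=> e0; have ex j : exists d : R, 0 < d /\ forall v v', nrm (v - b) < d ->
    nrm (v' - b) < d ->
    nrm (peval (P j) v - peval (P j) v' - grad (P j) b (v - v')) <= e * nrm (v - v').
  by have [d d0 hd] := poly_strict (P j) b e0; exists d.
have [d hd] := choice ex.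
have [m m0 hm] := fin_pos_lower (fun j => (hd j).1).
exists m => // v v' vm v'm; apply: nrm_le_coord.
  by rewrite mulr_ge0 ?nrm_ge0// ltW.
move=> j; have [_ /(_ v v')] := hd j.
rewrite grad_jac !mxE => h; apply: h.
  exact: lt_le_trans vm (hm j).
exact: lt_le_trans v'm (hm j).
Qed.

Lemma jac_unit_near : jac a \in unitmx -> \forall v \near a, jac v \in unitmx.
Proof.
pose D := \det (\matrix_(k, j) mderiv k (P j)).
have E v : (jac v \in unitmx) = (peval D v != 0).
  rewrite unitmxE unitfE peval_det; congr (\det _ != 0).
  by apply/matrixP => k j; rewrite !mxE.
rewrite E => /poly_near_neq0; apply: filterS => v; by rewrite E.
Qed.

Hypothesis Ja : jac a \in unitmx.

(** Newton's iteration with the Jacobian frozen at [a]. Strict differentiability makes it contract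
    by 1/2, its fixed points are preimages, and the same estimate gives injectivity. The inverse is
    differentiable by the strict estimate at [psi w], where the Jacobian is still invertible. *)
Lemma local_inverse : exists psi : 'rV[C]_N -> 'rV[C]_N,
  [/\ psi (pmap a) = a,
      \forall w \near pmap a, differentiable psi w /\ pmap (psi w) = w
    & \forall v \near a, psi (pmap v) = v].
Proof.
have [b b_gt0 hb] : exists2 b : R, 0 < b &
    forall u : 'rV[C]_N, nrm (u *m invmx (jac a)) <= b * nrm u.
  have [b0 b00 hb0] := mulmx_bound (invmx (jac a)).
  exists (b0 + 1) => [|u]; first by lra.
  by apply: le_trans (hb0 u) _; rewrite ler_wpM2r ?nrm_ge0//; lra.
(* An error [1 / (2 * b)], multiplied by the bound [b] of the inverse Jacobian, leaves the factor
   1/2. *)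
have e0 : 0 < 1 / (2 * b) by rewrite divr_gt0// mulr_gt0.
have [d1 d10 hs1] := pmap_strict a e0.
have /nearN[d2 d20 hd2] := jac_unit_near Ja.
have [d [d0 dd1 dd2]] : exists d, [/\ 0 < d, d <= d1 & d <= d2].
  by exists (Num.min d1 d2); rewrite lt_min d10 d20 !ge_min !lexx orbT.
have hs v v' : nrm (v - a) < d -> nrm (v' - a) < d ->
   nrm (pmap v - pmap v' - (v - v') *m jac a) <= 1 / (2 * b) * nrm (v - v').
  by move=> v1 v2; apply: hs1; [exact: lt_le_trans v1 dd1|exact: lt_le_trans v2 dd1].
have JK (u : 'rV[C]_N) : u *m jac a *m invmx (jac a) = u by rewrite mulmxK.
have inj v v' : nrm (v - a) < d -> nrm (v' - a) < d ->
    nrm (v - v') <= 2 * b * nrm (pmap v - pmap v').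
  move=> v1 v2; have h := hs _ _ v1 v2.
  set E := pmap v - pmap v' - _ in h.
  have Eq : v - v' = (pmap v - pmap v') *m invmx (jac a) - E *m invmx (jac a).
    by rewrite -mulmxBl /E subKr JK.
  have h1 : nrm (v - v') <= b * nrm (pmap v - pmap v') + b * nrm E.
    by rewrite {1}Eq; apply: le_trans (nrmBD _ _) _; rewrite lerD// hb.
  have h2 : b * nrm E <= 1 / 2 * nrm (v - v').
    apply: le_trans (ler_wpM2l (ltW b_gt0) h) _.
    by rewrite le_eqVlt; apply/orP; left; apply/eqP; field; rewrite gt_eqF.
  by rewrite -mulrA; apply: absorb_half h1 h2.
(* The steps of the iteration add up to at most [2 * b * eta], which is half of [d]. *)
have [eta eta0 etaE] : exists2 eta : R, 0 < eta & eta * (4 * b) = d.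
  by exists (d / (4 * b)); rewrite ?divr_gt0 ?divfK ?gt_eqF ?mulr_gt0.
have surj w : nrm (w - pmap a) < eta -> exists v, nrm (v - a) < d /\ pmap v = w.
  move=> wa; pose T v := v - (pmap v - w) *m invmx (jac a).
  pose u n := iter n T a; pose mu := b * nrm (w - pmap a).
  have mu0 : 0 <= mu by rewrite mulr_ge0 ?nrm_ge0// ltW.
  have mud : 4 * mu < d.
    by rewrite /mu mulrA -etaE mulrC ltr_pM2r ?mulr_gt0.
  have mud2 : 2 * mu < d by apply: le_lt_trans mud; rewrite ler_wpM2r// ler_nat.
  have Tc v v' : nrm (v - a) < d -> nrm (v' - a) < d -> nrm (T v - T v') <= nrm (v - v') / 2.
    move=> v1 v2; have h := hs _ _ v1 v2; set E := pmap v - pmap v' - _ in h.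
    have -> : T v - T v' = - (E *m invmx (jac a)).
      rewrite /T /E !mulmxBl !JK.
      by apply/rowP => j; rewrite !mxE; ring.
    rewrite nrmN; apply: le_trans (hb _) _; apply: le_trans (ler_wpM2l (ltW b_gt0) h) _.
    by rewrite le_eqVlt; apply/orP; left; apply/eqP; field; rewrite gt_eqF.
  have p2 n : 0 < (2 : R) ^+ n by rewrite exprn_gt0.
  have st n : nrm (u n.+1 - u n) <= mu / 2 ^+ n /\ nrm (u n - a) <= 2 * mu * (1 - 1 / 2 ^+ n).
    elim: n => [|n [IH1 IH2]].
      rewrite expr0 !divr1 (subrr (1 : R)) mulr0; split; last by rewrite subrr nrm0.
      rewrite /u /= /T addrAC subrr add0r nrmN /mu nrmB; exact: hb.
    have q : 0 <= 1 / 2 ^+ n :> R by rewrite divr_ge0// ltW.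
    have un : nrm (u n - a) < d by apply: le_lt_trans IH2 (geometric_lt mu0 mud2 q).
    have h2 : nrm (u n.+1 - a) <= 2 * mu * (1 - 1 / 2 ^+ n.+1).
      rewrite (_ : u n.+1 - a = (u n.+1 - u n) + (u n - a)); last by rewrite addrA subrK.
      apply: le_trans (nrmD _ _) _; apply: le_trans (lerD IH1 IH2) _.
      by rewrite le_eqVlt; apply/orP; left; apply/eqP; rewrite exprS; field; rewrite gt_eqF.
    split => //; have q' : 0 <= 1 / 2 ^+ n.+1 :> R by rewrite divr_ge0// ltW.
    have un1 : nrm (u n.+1 - a) < d by apply: le_lt_trans h2 (geometric_lt mu0 mud2 q').
    have -> : u n.+2 - u n.+1 = T (u n.+1) - T (u n) by [].
    apply: le_trans (Tc _ _ un1 un) _; rewrite exprS invfM mulrCA mulrC.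
    by rewrite ler_wpM2l// invr_ge0.
  have und n : nrm (u n - a) <= 2 * mu.
    have [_ h] := st n; apply: le_trans h _.
    have q : 0 <= 1 / 2 ^+ n :> R by rewrite divr_ge0// ltW.
    exact: geometric_le.
  have [l hl] : exists l : 'rV[C]_N, forall e : R, 0 < e -> \forall n \near \oo, nrm (u n - l) <= e.
    have ex k : exists l : C, forall e : R, 0 < e -> \forall n \near \oo, nrm (u n 0 k - l) <= e.
      apply: (@seq_complete _ _ mu) => n; apply: le_trans (st n).1.
      by have := nrm_coord (u n.+1 - u n) k; rewrite !mxE.
    have [l hl] := choice ex; exists (\row_k l k) => e e1.
    have : \forall n \near \oo, forall k, nrm (u n 0 k - l k) <= e.
      by apply: filter_forall => k; exact: hl.
    apply: filterS => n hn; apply: nrm_le_coord; first exact: ltW.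
    by move=> k; rewrite !mxE.
  have la : nrm (l - a) <= 2 * mu.
    apply/ler_addgt0Pr => e e1; have [n _ /(_ n (leqnn _)) /= hn] := hl _ e1.
    rewrite (_ : l - a = (l - u n) + (u n - a)); last by rewrite addrA subrK.
    by apply: le_trans (nrmD _ _) _; rewrite nrmB addrC lerD.
  have lad : nrm (l - a) < d := le_lt_trans la mud2.
  exists l; split => //.
  have Tl : T l = l.
    apply: subr0_eq; apply: nrm_eq0; apply/eqP; rewrite eq_le nrm_ge0 andbT.
    apply/ler_addgt0Pr => e e1; rewrite add0r; have e2 : 0 < e / 2 by lra.
    have [n _ hn] := hl _ e2.
    have h1 := hn n (leqnn _); have h2 := hn n.+1 (leqnSn _); rewrite /= in h1 h2.
    have und' : nrm (u n - a) < d := le_lt_trans (und n) mud2.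
    rewrite (_ : T l - l = (T l - T (u n)) + (u n.+1 - l)); last by rewrite addrA subrK.
    apply: le_trans (nrmD _ _) _; rewrite [leRHS]splitr; apply: lerD h2.
    apply: le_trans (Tc _ _ lad und') _; rewrite [nrm (l - u n)]nrmB.
    by apply: le_trans h1; rewrite ler_pdivrMr// ler_peMr ?nrm_ge0// ler1n.
  have : (pmap l - w) *m invmx (jac a) = 0.
    have -> : (pmap l - w) *m invmx (jac a) = l - T l by rewrite /T subKr.
    by rewrite Tl subrr.
  move=> /(congr1 (fun M => M *m jac a)); rewrite mulmxKV// mul0mx.
  exact: subr0_eq.
(* The default [a] only occurs where no preimage lies in the ball, hence never within [eta] of
   [pmap a]. *)
pose psi w := xget a [set v | nrm (v - a) < d /\ pmap v = w].
have psiP w : nrm (w - pmap a) < eta -> nrm (psi w - a) < d /\ pmap (psi w) = w.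
  move=> /surj[v hv]; rewrite /psi; case: xgetP => [_ -> //|/(_ v)].
  by move/(_ hv).
have psiU v : nrm (v - a) < d -> nrm (pmap v - pmap a) < eta -> psi (pmap v) = v.
  move=> v1 /psiP[v2 E]; apply: subr0_eq; apply: nrm_eq0; apply/eqP.
  by rewrite eq_le nrm_ge0 andbT; have := inj _ _ v2 v1; rewrite E subrr nrm0 mulr0.
exists psi; split.
- by apply: psiU; rewrite subrr nrm0.
- apply/nearN; exists eta => // w weta; have [v1 E] := psiP _ weta; split => //.
  have Jv : jac (psi w) \in unitmx by apply: hd2; exact: lt_le_trans v1 dd2.
  set v := psi w in v1 E Jv *.
  have [b' b'0 hb'] := mulmx_bound (invmx (jac v)).
  have cl : continuous (mulmxr (invmx (jac v)) : {linear 'rV[C]_N -> 'rV[C]_N}).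
    exact: (@bounded_linear_cont _ _ _ (mulmxr (invmx (jac v)) : {linear 'rV[C]_N -> 'rV[C]_N}) b').
  have [|dpsi _] := @nrm_diff _ _ _ psi w _ cl; last exact: dpsi.
  move=> e e1; pose e' := e / (2 * b * (b' + 1)).
  have e'0 : 0 < e' by rewrite divr_gt0// !mulr_gt0// ltr_wpDl.
  have [dv dv0 hv] := pmap_strict v e'0.
  exists (Num.min (eta - nrm (w - pmap a)) (dv / (2 * b))).
    by rewrite lt_min subr_gt0 weta divr_gt0// mulr_gt0.
  move=> k; rewrite lt_min => /andP[k1 k2].
  have wk : nrm (w + k - pmap a) < eta.
    rewrite addrAC; apply: le_lt_trans (nrmD _ _) _.
    by rewrite -ltrBrDl.
  have [v'1 E'] := psiP _ wk; set v' := psi (w + k) in v'1 E' *.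
  have kE : pmap v' - pmap v = k by rewrite E' E addrAC subrr add0r.
  have vv : nrm (v' - v) <= 2 * b * nrm k by rewrite -kE; exact: inj.
  have := hv v' v; rewrite subrr nrm0 => /(_ _ dv0); rewrite kE.
  have vdv : nrm (v' - v) < dv.
    by move: k2; rewrite ltr_pdivlMr ?mulr_gt0// mulrC => k2; apply: le_lt_trans vv k2.
  move=> /(_ vdv) h; rewrite /= (_ : v' - v - k *m _ = - ((k - (v' - v) *m jac v) *m invmx (jac v))); last first.
    by rewrite mulmxBl mulmxK// opprB.
  rewrite nrmN; apply: le_trans (hb' _) _; apply: le_trans (ler_wpM2l b'0 h) _.
  apply: le_trans (ler_wpM2l b'0 (ler_wpM2l (ltW e'0) vv)) _.
  exact: scaled_error_le b_gt0 b'0 (nrm_ge0 _) (ltW e1).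
- have [d3 d30 h3] := pmap_strict a ltr01.
  have [b' b'0 hb'] := mulmx_bound (jac a).
  apply/nearN; exists (Num.min d (Num.min d3 (eta / (b' + 1 + 1)))).
    by rewrite lt_min d0 lt_min d30 divr_gt0//; lra.
  move=> v; rewrite !lt_min => /and3P[v1 v2 v3]; apply: psiU => //.
  have b2 : 0 < b' + 1 + 1 by lra.
  have := h3 v a; rewrite subrr nrm0 => /(_ v2 d30) h.
  rewrite ltr_pdivlMr// in v3; apply: le_lt_trans v3.
  have := nrmD (pmap v - pmap a - (v - a) *m jac a) ((v - a) *m jac a); rewrite subrK.
  move=> /le_trans; apply; apply: le_trans (lerD h (hb' _)) _.
  by rewrite -mulrDl mulrC ler_wpM2l ?nrm_ge0// addrC lerDl.
Qed.

End Inverse.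
End InverseFunction.

(** * Regular and holomorphic functions on a variety *)

Section RowDifferentials.
Variable R : realType.
Local Notation C := (cplx R).

Lemma near_all (E : normedModType C) n (P : 'I_n -> E -> Prop) (x : E) :
  (forall k, \forall v \near x, P k v) -> \forall v \near x, forall k, P k v.
Proof. by move=> hP; apply: filter_forall. Qed.

Lemma near_cont (E F : normedModType C) (f : E -> F) y (e : R) :
  {for y, continuous f} -> 0 < e -> \forall z \near y, nrm (f z - f y) < e.
Proof.
move=> c e0; have /(_ (fun u => nrm (u - f y) < e)) := c; apply.
by apply/nearN; exists e.
Qed.

Lemma differentiable_row (E : normedModType C) n (f : E -> 'rV[C]_n) x :
  (forall k, differentiable (fun y => f y 0 k : C) x) -> differentiable f x /\
  forall w k, dd f x w 0 k = dd (fun y => f y 0 k : C) x w.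
Proof.
move=> df; pose L w : 'rV[C]_n := \row_k dd (fun y => f y 0 k : C) x w.
have lin : linear L by move=> a u v; apply/rowP => k; rewrite !mxE ddP.
pose lM := GRing.isLinear.Build _ _ _ _ _ lin.
pose l : {linear E -> 'rV[C]_n} := HB.pack L lM.
have cl : continuous l.
  move=> y; apply/cvgrPdist_lt => e e0.
  have eE : e = creal (complex.Re e) :> C.
    by move: e0; rewrite /cplx ltcE => /andP[/eqP /= E1 _]; case: (e) E1 => a b /= ->.
  have e0' : 0 < complex.Re e by move: e0; rewrite /cplx ltcE => /andP[].
  have : \forall z \near y, forall k, nrm (l z 0 k - l y 0 k) < complex.Re e.
    apply: filter_forall => k.
    have c : {for y, continuous ('d (fun y => f y 0 k : C) x : E -> C)} by exact: diff_continuous.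
    apply: filterS (near_cont c e0') => z hz; rewrite !mxE !ddE; exact: hz.
  apply: filterS => z hz; rewrite -normrN opprB nrmE eE /creal /cplx ltcR.
  by apply/nrm_ltP => // k; have := hz k; rewrite !mxE.
have [|d dE] := @nrm_diff _ _ _ f x l cl; last first.
  split; first exact: d.
  move=> w k; rewrite ddE; have := congr1 (fun F : E -> 'rV[C]_n => F w 0 k) dE.
  by move=> ->; rewrite mxE.
move=> e e0; have ex k : exists d : R, 0 < d /\ forall w, nrm w < d ->
    nrm (f (x + w) 0 k - f x 0 k - dd (fun y => f y 0 k : C) x w) <= e * nrm w.
  by have [d d0 hd] := diff_dd (df k) e0; exists d.
have [d hd] := choice ex; have [m m0 hm] := fin_pos_lower (fun k => (hd k).1).
exists m => // w wm; apply: nrm_le_coord; first by rewrite mulr_ge0 ?nrm_ge0// ltW.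
by move=> k; rewrite !mxE; apply: (hd k).2; exact: lt_le_trans wm (hm k).
Qed.

Lemma row_delta_sum n (v : 'rV[C]_n) : v = \sum_k v 0 k *: delta_mx 0 k.
Proof. by rewrite {1}[v]row_sum_delta. Qed.

Lemma derive_coord n (G : 'rV[C]_n -> C) x w : differentiable G x ->
  'D_w G x = \sum_k w 0 k * 'D_(delta_mx 0 k) G x.
Proof.
move=> dG; rewrite deriveE// {1}(row_delta_sum w) linear_sum.
by apply: eq_bigr => k _; rewrite linearZ deriveE.
Qed.

Lemma chain_curve n (G : 'rV[C]_n -> C) (gam : C -> 'rV[C]_n) :
  differentiable G (gam 0) ->
  (forall k, differentiable (fun t : C => gam t 0 k : C) 0) ->
  differentiable (G \o gam) 0 /\
  'D_1 (G \o gam) 0 =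
    \sum_k 'D_(delta_mx 0 k) G (gam 0) * 'D_1 (fun t : C => gam t 0 k : C) 0.
Proof.
move=> dG dg; have [dgam dgamE] := differentiable_row dg.
have dGg : differentiable (G \o gam) 0 by exact: differentiable_comp.
split; first exact: dGg.
rewrite (dd_derive _ dGg) ddE diff_comp//= -[X in 'd G _ X]ddE -ddE -(dd_derive _ dG).
rewrite (derive_coord _ dG); apply: eq_bigr => k _.
by rewrite mulrC dgamE; congr (_ * _); rewrite (dd_derive _ (dg k)).
Qed.

Lemma chain_line (E : normedModType C) (f : E -> C) x w :
  differentiable f x -> differentiable (fun t : C => f (x + t *: w)) 0 /\
  'D_1 (fun t : C => f (x + t *: w)) 0 = 'D_w f x.
Proof.
move=> df; have df0 : differentiable f (x + (0 : C) *: w) by rewrite scale0r addr0.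
have [d e] := diff_line df0; split; first exact: d.
by rewrite (dd_derive _ d) ddE e scale0r addr0 (dd_derive _ df) ddE.
Qed.

End RowDifferentials.

(** * Regular functions in one chart, and generic properties *)

Section RegularFunctions.
Variables (C : numClosedFieldType) (V : atlas C).
Implicit Types (g h : V -> C) (i : chart V) (x y : V).

(** The clause of [regular_at] for one chart. Its closure properties hold in any atlas, so they
    apply to frame bundles as well as to the variety itself. *)
Definition reg_chart i g x := exists P Q : mpoly (adim i) C,
  peval Q (crd i x) != 0 /\
  forall y, dom i y -> peval Q (crd i y) != 0 ->
    g y = peval P (crd i y) / peval Q (crd i y).

Lemma reg_cst i c x : reg_chart i (fun=> c) x.
Proof.
exists (mpolyC _ c), (mpolyC _ 1); rewrite pevalC oner_neq0; split => // y _ _.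
by rewrite !pevalC divr1.
Qed.

Lemma reg_coord i k x : reg_chart i (fun y => crd i y 0 k) x.
Proof.
exists (mpolyX C (mnm1 k)), (mpolyC _ 1); rewrite pevalC oner_neq0; split => // y _ _.
by rewrite pevalC divr1 pevalX.
Qed.

Lemma reg_add i g h x : reg_chart i g x -> reg_chart i h x ->
  reg_chart i (fun y => g y + h y) x.
Proof.
move=> [P [Q [Q0 E]]] [P' [Q' [Q'0 E']]]; exists (P * Q' + P' * Q), (Q * Q').
rewrite pevalM mulf_neq0//; split => // y dy; rewrite pevalM mulf_eq0 negb_or => /andP[q q'].
by rewrite E// E'// pevalD !pevalM addf_div.
Qed.

Lemma reg_mul i g h x : reg_chart i g x -> reg_chart i h x ->
  reg_chart i (fun y => g y * h y) x.
Proof.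
move=> [P [Q [Q0 E]]] [P' [Q' [Q'0 E']]]; exists (P * P'), (Q * Q').
rewrite pevalM mulf_neq0//; split => // y dy; rewrite pevalM mulf_eq0 negb_or => /andP[q q'].
by rewrite E// E'// !pevalM mulf_div.
Qed.

Lemma reg_inv i g x : dom i x -> reg_chart i g x -> g x != 0 ->
  reg_chart i (fun y => (g y)^-1) x.
Proof.
move=> dx [P [Q [Q0 E]]] gx; have P0 : peval P (crd i x) != 0.
  by move: gx; rewrite E// mulf_eq0 negb_or => /andP[].
exists (Q * Q), (P * Q); rewrite pevalM mulf_neq0//; split => // y dy.
rewrite pevalM mulf_eq0 negb_or => /andP[p q].
by rewrite E// !pevalM invf_div -mulf_div divff// mulr1.
Qed.

Lemma reg_sum i I (r : seq I) (F : I -> V -> C) x :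
  (forall k, reg_chart i (F k) x) -> reg_chart i (fun y => \sum_(k <- r) F k y) x.
Proof.
move=> hF; elim: r => [|k r IH].
  have -> : (fun y => \sum_(k <- [::]) F k y) = (fun=> 0) by apply/funext => y; rewrite big_nil.
  exact: reg_cst.
have -> : (fun y => \sum_(k <- k :: r) F k y) = (fun y => F k y + \sum_(k <- r) F k y).
  by apply/funext => y; rewrite big_cons.
exact: reg_add.
Qed.

Lemma reg_poly i k (p : mpoly k C) (h : 'I_k -> V -> C) x :
  (forall l, reg_chart i (h l) x) ->
  reg_chart i (fun y => peval p (\row_l h l y)) x.
Proof.
move=> hh; move: p; apply: mpoly_ring_ind => [c|l|p q hp hq|p q hp hq].
- have -> : (fun y => peval (mpolyC k c) (\row_l h l y)) = (fun=> c).
    by apply/funext => y; rewrite pevalC.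
  exact: reg_cst.
- have -> : (fun y => peval (mpolyX C (mnm1 l)) (\row_l h l y)) = h l => //.
  by apply/funext => y; rewrite pevalX mxE.
- have -> : (fun y => peval (p + q) (\row_l h l y)) = (fun y => peval p (\row_l h l y) + peval q (\row_l h l y)).
    by apply/funext => y; rewrite pevalD.
  exact: reg_add.
- have -> : (fun y => peval (p * q) (\row_l h l y)) = (fun y => peval p (\row_l h l y) * peval q (\row_l h l y)).
    by apply/funext => y; rewrite pevalM.
  exact: reg_mul.
Qed.

Lemma reg_local i g h x (Q0 : mpoly (adim i) C) : peval Q0 (crd i x) != 0 ->
  (forall y, dom i y -> peval Q0 (crd i y) != 0 -> g y = h y) ->
  reg_chart i g x -> reg_chart i h x.
Proof.
move=> q0 gh [P [Q [Q1 E]]]; exists (P * Q0), (Q * Q0); rewrite pevalM mulf_neq0//.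
split => // y dy; rewrite pevalM mulf_eq0 negb_or => /andP[q q'].
by rewrite -gh// E// !pevalM -mulf_div divff// mulr1.
Qed.

Lemma reg_neq0 i g x : dom i x -> reg_chart i g x -> g x != 0 ->
  exists Q : mpoly (adim i) C, peval Q (crd i x) != 0 /\
    forall y, dom i y -> peval Q (crd i y) != 0 -> g y != 0.
Proof.
move=> dx [P [Q [Q0 E]]] gx; exists (P * Q); rewrite pevalM.
have P0 : peval P (crd i x) != 0 by move: gx; rewrite E// mulf_eq0 negb_or => /andP[].
rewrite mulf_neq0//; split => // y dy; rewrite pevalM mulf_eq0 negb_or => /andP[p q].
by rewrite E// mulf_neq0// invr_eq0.
Qed.

Lemma zopenI (O U : set V) : zopen O -> zopen U -> zopen (O `&` U).
Proof.
move=> hO hU x [Ox Ux]; have [ex _] := hO x Ox; split => // i dx.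
have [_ /(_ i dx)[Q [Q0 hQ]]] := hO x Ox; have [_ /(_ i dx)[Q' [Q'0 hQ']]] := hU x Ux.
exists (Q * Q'); rewrite pevalM mulf_neq0//; split => // y dy.
by rewrite pevalM mulf_eq0 negb_or => /andP[q q']; split; [exact: hQ|exact: hQ'].
Qed.

(** Turns open sets into functions, since morphisms and holomorphic maps are given by their action
    on functions. *)
Definition ind (O : set V) : V -> C := fun y => if `[< O y >] then 1 else 0.

Lemma ind_neq0 O y : ind O y != 0 -> O y.
Proof. by rewrite /ind; case: asboolP => //; rewrite eqxx. Qed.

Lemma ind_in (O : set V) y : O y -> ind O y = 1.
Proof. by move=> Oy; rewrite /ind; case: asboolP. Qed.

Lemma regular_ind O x : zopen O -> O x -> regular_at (ind O) x.
Proof.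
move=> hO Ox i dx; have [_ /(_ i dx)[Q [Q0 hQ]]] := hO x Ox.
by exists Q, Q; split => // y dy q; rewrite divff// ind_in//; exact: hQ.
Qed.

Lemma genericI (P P' : V -> Prop) : irreducible V -> generic P -> generic P' ->
  generic (fun x => P x /\ P' x).
Proof.
move=> [_ irr] [U [zU nU hU]] [U' [zU' nU' hU']]; exists (U `&` U'); split.
- exact: zopenI.
- exact: irr.
- by move=> x [/hU ? /hU' ?].
Qed.

(** For an empty [I] the conclusion still asserts that a nonempty Zariski open set exists, which is
    the second hypothesis. *)
Lemma generic_forall (I : finType) (P : I -> V -> Prop) : irreducible V ->
  generic (fun _ : V => True) -> (forall k, generic (P k)) -> generic (fun x => forall k, P k x).
Proof.
move=> irr hT hP.
have : generic (fun x => forall k, k \in enum I -> P k x).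
  elim: (enum I) => [|i s IH].
    by have [U [zU nU _]] := hT; exists U; split.
  have [U [zU nU hU]] := genericI irr (hP i) IH; exists U; split => // x /hU[Pi Ps] k.
  by rewrite inE => /predU1P[->//|]; exact: Ps.
by move=> [U [zU nU hU]]; exists U; split => // x /hU h k; apply: h; rewrite mem_enum.
Qed.

End RegularFunctions.

(** * Holomorphic functions and transcendental neighborhoods *)

Section HolomorphicFunctions.
Variables (R : realType) (V : atlas (cplx R)) (m : nat).
Local Notation C := (cplx R).
Hypothesis hV : smooth_irreducible_variety V m.
Implicit Types (g h : V -> C) (i j : chart V) (x y : V) (O U : set V).

Lemma ratio_differentiable n (P Q : mpoly n C) (a : 'rV[C]_n) :
  peval Q a != 0 -> \forall v \near a, peval Q v != 0 /\
    differentiable (fun v => peval P v / peval Q v : C) v.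
Proof.
move=> /poly_near_neq0; apply: filterS => v q; split => //.
apply: (@differentiableM _ _ (peval P) (fun v => (peval Q v)^-1)).
  exact: (poly_diff P v).1.
exact: (@differentiableV _ _ (peval Q) v (poly_diff Q v).1 q).
Qed.

(** [var_compat] makes the coordinates of chart [i] rational in those of chart [j]. Through these
    maps, [anbhs] and [hol_at] need only be tested in one chart. *)
Lemma transition i j x : dom i x -> dom j x -> exists rho : 'rV[C]_(adim j) -> 'rV[C]_(adim i),
  rho (crd j x) = crd i x /\
  \forall v \near crd j x, differentiable rho v /\
    forall y, dom j y -> crd j y = v -> dom i y /\ crd i y = rho v.
Proof.
move=> dix djx.
have ex k : exists PQ : mpoly (adim j) C * mpoly (adim j) C,
    peval PQ.2 (crd j x) != 0 /\ forall y, dom j y -> peval PQ.2 (crd j y) != 0 ->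
      crd i y 0 k = peval PQ.1 (crd j y) / peval PQ.2 (crd j y).
  by have [P [Q h]] := var_compat hV k dix djx; exists (P, Q).
have [pq hpq] := choice ex.
have [_ /(_ j djx)[Q0 [Q0x hQ0]]] := var_dom_open hV dix.
exists (fun v => \row_k (peval (pq k).1 v / peval (pq k).2 v)); split.
  by apply/rowP => k; rewrite mxE -(hpq k).2// (hpq k).1.
have h1 : \forall v \near crd j x, forall k, peval (pq k).2 v != 0 /\
    differentiable (fun v => peval (pq k).1 v / peval (pq k).2 v : C) v.
  by apply: near_all => k; apply: ratio_differentiable; exact: (hpq k).1.
apply: filterS2 h1 (poly_near_neq0 Q0x) => v hv q0; split.
  apply: (differentiable_row _).1 => k.
  by apply: (near_differentiable _ (hv k).2).1; apply: filterE => w; rewrite mxE.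
move=> y djy yv; split; first by apply: hQ0; rewrite ?yv.
by apply/rowP => k; rewrite mxE -yv -(hpq k).2// yv (hv k).1.
Qed.

Lemma transition_near i j x (P : 'rV[C]_(adim i) -> Prop) : dom i x -> dom j x ->
  (\forall v \near crd i x, P v) ->
  exists rho : 'rV[C]_(adim j) -> 'rV[C]_(adim i),
  \forall v \near crd j x, [/\ differentiable rho v, P (rho v) &
    forall y, dom j y -> crd j y = v -> dom i y /\ crd i y = rho v].
Proof.
move=> dix djx nP; have [rho [rx hrho]] := transition dix djx; exists rho.
have c : {for crd j x, continuous rho}.
  by apply: differentiable_continuous; have [] := nbhs_singleton hrho.
have nP' : \forall v \near crd j x, P (rho v) by apply: (c P); rewrite rx.
by apply: filterS2 hrho nP' => v [d h] p; split.
Qed.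

Lemma anbhs_chart i x O : dom i x ->
  (\forall v \near crd i x, forall y, dom i y -> crd i y = v -> O y) -> anbhs x O.
Proof.
move=> dix nO j djx; have [rho hrho] := transition_near dix djx nO.
apply: filterS hrho => v [_ h1 h2] y djy yv.
by have [diy ry] := h2 y djy yv; exact: h1.
Qed.

Lemma hol_chart i x g : dom i x ->
  (exists G : 'rV[C]_(adim i) -> C, \forall v \near crd i x, differentiable G v /\
     forall y, dom i y -> crd i y = v -> g y = G v) -> hol_at g x.
Proof.
move=> dix [G nG] j djx; have [rho hrho] := transition_near dix djx nG.
exists (G \o rho); apply: filterS hrho => v [d [dG gG] h2]; split.
  exact: differentiable_comp.
by move=> y djy yv; have [diy ry] := h2 y djy yv; exact: gG.
Qed.

Lemma anbhsI x O U : anbhs x O -> anbhs x U -> anbhs x (O `&` U).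
Proof.
move=> hO hU i dix; apply: filterS2 (hO i dix) (hU i dix) => v o u y dy yv.
by split; [exact: o|exact: u].
Qed.

Lemma anbhs_sub x O U : O `<=` U -> anbhs x O -> anbhs x U.
Proof.
by move=> OU hO i dix; apply: filterS (hO i dix) => v o y dy yv; exact/OU/o.
Qed.

Lemma anbhs_in x O : anbhs x O -> O x.
Proof.
by move=> hO; have [i dx] := var_cover hV x; have := nbhs_singleton (hO i dx); apply.
Qed.

Lemma zopen_anbhs O x : zopen O -> O x -> anbhs x O.
Proof.
move=> zO Ox i dx; have [_ /(_ i dx)[Q [Q0 hQ]]] := zO x Ox.
by apply: filterS (poly_near_neq0 Q0) => v q y dy yv; apply: hQ; rewrite ?yv.
Qed.

Lemma regular_hol g x : regular_at g x -> hol_at g x.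
Proof.
move=> rg i dx; have [P [Q [Q0 h]]] := rg i dx.
exists (fun v => peval P v / peval Q v).
apply: filterS (ratio_differentiable P Q0) => v [q d]; split => // y dy yv.
by rewrite -yv; apply: h; rewrite ?yv.
Qed.

Lemma hol_germ g h x : hol_at g x -> anbhs x [set y | g y = h y] -> hol_at h x.
Proof.
move=> hg gh i dx; have [G nG] := hg i dx; exists G.
apply: filterS2 nG (gh i dx) => v [d e] e'; split => // y dy yv.
by rewrite -(e' y dy yv); exact: e.
Qed.

Lemma hol_cst c x : hol_at (fun=> c : C) x.
Proof.
by move=> i dx; exists (fun=> c); apply: filterE => v; split => //; exact: differentiable_cst.
Qed.

Lemma hol_add g h x : hol_at g x -> hol_at h x -> hol_at (fun y => g y + h y) x.
Proof.
move=> hg hh i dx; have [G nG] := hg i dx; have [H nH] := hh i dx.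
exists (fun v => G v + H v); apply: filterS2 nG nH => v [d e] [d' e']; split.
  exact: (@differentiableD _ _ _ G H).
by move=> y dy yv; rewrite (e y)// (e' y).
Qed.

Lemma hol_mul g h x : hol_at g x -> hol_at h x -> hol_at (fun y => g y * h y) x.
Proof.
move=> hg hh i dx; have [G nG] := hg i dx; have [H nH] := hh i dx.
exists (fun v => G v * H v); apply: filterS2 nG nH => v [d e] [d' e']; split.
  exact: (@differentiableM _ _ G H).
by move=> y dy yv; rewrite (e y)// (e' y).
Qed.

Lemma hol_near g x : hol_at g x -> anbhs x [set y | hol_at g y].
Proof.
move=> hg; have [i dx] := var_cover hV x; apply: (anbhs_chart dx).
have [G nG] := hg i dx; have := nbhs_interior nG; apply: filterS => v hv y dy yv.
by apply: (hol_chart dy); exists G; rewrite yv.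
Qed.

Lemma hol_ind O x : anbhs x O -> hol_at (ind O) x.
Proof.
move=> hO i dx; exists (fun=> 1); apply: filterS (hO i dx) => v o; split.
  exact: differentiable_cst.
by move=> y dy yv; rewrite ind_in//; exact: o.
Qed.

(** The indicator of [O] composed with [s] is differentiable at [z], hence continuous, with value 1
    there. *)
Lemma holmap_near (E : normedModType C) (s : E -> V) z O :
  holmap_at s z -> anbhs (s z) O -> \forall z' \near z, O (s z').
Proof.
move=> hs hO; have d := nbhs_singleton (hs _ (hol_ind hO)).
have c : {for z, continuous (ind O \o s : E -> C)} by exact: differentiable_continuous.
apply: filterS (near_cont c (ltr01 : 0 < 1 :> R)) => z' h; apply: (@ind_neq0 C).
apply/eqP => i0; move: h; rewrite /= i0 ind_in; last exact: anbhs_in.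
by rewrite sub0r nrmN nrmC ComplexField.Normc.normc1 ltxx.
Qed.

End HolomorphicFunctions.

(** * Local coordinates and tangent vectors *)

Section LocalSection.
Variable R : realType.
Local Notation C := (cplx R).

Lemma complete_basis (F : fieldType) c N (J : 'M[F]_(c, N)) m :
  (c + m)%N = N -> \rank J = c ->
  exists B : 'M[F]_(m, N), row_full (col_mx J B).
Proof.
move=> cm rJ; have rC : \rank (J^C)%MS = m by rewrite mxrank_compl rJ -cm addKn.
exists (castmx (rC, erefl N) (row_base (J^C)%MS)).
have : row_full (J + J^C)%MS by exact: addsmx_compl_full.
suff E : (col_mx J (castmx (rC, erefl N) (row_base (J^C)%MS)) :=: J + J^C)%MS by rewrite /row_full E.
apply: eqmx_trans (eqmx_sym (addsmxE _ _)) _; apply: adds_eqmx => //.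
by apply: eqmx_trans (eqmx_cast _ _) (eq_row_base _).
Qed.

(** Completing the [c] equations by [m] linear forms, the columns of [B], gives a map with
    invertible Jacobian at [a]; [psi] is its local inverse on the slice where the equations take the
    value 0. [D] is the Jacobian determinant: where it does not vanish, the differentials of the
    equations can be given arbitrary values, as the density argument requires. *)
Lemma local_section N c m (p : 'I_c -> mpoly N C) (a : 'rV[C]_N) :
  (c + m)%N = N -> (forall k, peval (p k) a = 0) ->
  \rank (\matrix_(k < c, l < N) peval (mderiv l (p k)) a) = c ->
  exists (B : 'M[C]_(N, m)) (psi : 'rV[C]_m -> 'rV[C]_N) (D : mpoly N C),
  [/\ psi (a *m B) = a,
      \forall z \near a *m B, [/\ differentiable psi z,
         psi z *m B = z & forall k, peval (p k) (psi z) = 0],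
      \forall v \near a, (forall k, peval (p k) v = 0) -> psi (v *m B) = v,
      peval D a != 0
    & forall v, peval D v != 0 -> forall eta : 'I_c -> C, exists xi : 'rV[C]_N,
        forall k, grad (p k) v xi = eta k].
Proof.
move=> cm pa rJ; have [B0 fB] := complete_basis cm rJ.
move: N cm p a pa rJ B0 fB => _ <- p a pa rJ B0 fB.
pose lin l : mpoly (c + m) C := \sum_q mpolyC _ (B0 l q) * mpolyX C (mnm1 q).
pose P (j : 'I_(c + m)) := match fintype.split j with inl k => p k | inr l => lin l end.
have linE l v : peval (lin l) v = (v *m B0^T) 0 l.
  rewrite peval_sum mxE; apply: eq_bigr => q _.
  by rewrite pevalM pevalC pevalX !mxE mulrC.
have PE v : pmap P v = row_mx (\row_k peval (p k) v) (v *m B0^T).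
  apply/rowP => j; rewrite !mxE /P; case: splitP => k _; first by rewrite mxE.
  by rewrite linE.
have dlin l q v : peval (mderiv q (lin l)) v = B0 l q.
  have -> : mderiv q (lin l) = \sum_r mpolyC _ (B0 l r) * mderiv q (mpolyX C (mnm1 r)).
    by rewrite raddf_sum; apply: eq_bigr => r _; exact: mderiv_mulC.
  rewrite peval_sum (bigD1 q)//= big1 ?addr0 => [|r rq].
    rewrite pevalM pevalC mderivX mnm1E eqxx scale1r.
    have -> : mnm_sub (mnm1 q) (mnm1 q) = @mnm0 (c + m).
      by apply/mnmP => j; rewrite mnmBE subnn mnm0E.
    by rewrite mpolyX0 -mpolyC1 pevalC mulr1.
  by rewrite pevalM mderivX mnm1E (negPf rq) scale0r -mpolyC0 !pevalC mulr0.
have JE v : (jac P v)^T = col_mx (\matrix_(k < c, l < c + m) peval (mderiv l (p k)) v) B0.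
  apply/matrixP => j q; rewrite !mxE /P; case: splitP => k _; first by rewrite mxE.
  exact: dlin.
have Ja : jac P a \in unitmx.
  by rewrite -unitmx_tr JE -row_full_unit.
have [psi [psia npsi npsi']] := local_inverse Ja.
have p0 v : (forall k, peval (p k) v = 0) -> pmap P v = row_mx 0 (v *m B0^T).
  by move=> pv; rewrite PE; congr row_mx; apply/rowP => k; rewrite !mxE pv.
pose inj (z : 'rV[C]_m) : 'rV[C]_(c + m) := row_mx 0 z.
have dinj z : differentiable inj z.
  apply: (differentiable_row _).1 => k; rewrite -(splitK k); case: (fintype.split k) => l /=.
    apply: (near_differentiable _ (differentiable_cst (0 : C) z)).1.
    by apply: filterE => w; rewrite row_mxEl mxE.
  apply: (near_differentiable _ (differentiable_coord (m := 1) z 0 l)).1.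
  by apply: filterE => w; rewrite row_mxEr.
exists B0^T, (psi \o inj), (\det (\matrix_(k, j) mderiv k (P j))); split.
- by rewrite /inj /= -p0.
- have c0 : {for a *m B0^T, continuous inj} by exact: differentiable_continuous.
  have : \forall z \near a *m B0^T, differentiable psi (inj z) /\ pmap P (psi (inj z)) = inj z.
    by apply: (c0 [set w | differentiable psi w /\ pmap P (psi w) = w]); rewrite /inj -p0.
  apply: filterS => z [d E]; have := E; rewrite PE => /eq_row_mx[E1 E2]; split; last 1 first.
  - by move=> k; have := congr1 (fun M : 'rV[C]_c => M 0 k) E1; rewrite !mxE.
  - exact: (differentiable_comp (dinj z) d).
  - exact: E2.
- by apply: filterS npsi' => v E pv /=; rewrite /inj -p0.
- rewrite peval_det; move: Ja; rewrite unitmxE unitfE; congr (\det _ != 0).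
  by apply/matrixP => k j; rewrite !mxE.
move=> v Dv eta; have Jv : jac P v \in unitmx.
  rewrite unitmxE unitfE; move: Dv; rewrite peval_det; congr (\det _ != 0).
  by apply/matrixP => k j; rewrite !mxE.
pose y : 'rV[C]_(c + m) := row_mx (\row_k eta k) 0.
exists (y *m invmx (jac P v)) => k.
have := grad_jac P (lshift m k) v (y *m invmx (jac P v)).
rewrite mulmxKV// /y row_mxEl mxE /P.
case: splitP => [k' /= kk|l /= kl]; last by have := ltn_ord k; rewrite kl ltnNge leq_addr.
by have -> : k' = k by apply: val_inj.
Qed.
End LocalSection.

Lemma near_derive (R : realType) (E : normedModType (cplx R)) (f g : E -> cplx R) (x w : E) :
  (\forall y \near x, f y = g y) -> differentiable f x -> 'D_w g x = 'D_w f x.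
Proof.
move=> fg df; have [dg e] := near_dd fg df.
by rewrite (dd_derive _ df) (dd_derive _ dg) e.
Qed.

(** * Coordinates, tangent vectors as derivations, and brackets *)

Section LocalCoordinates.
Variables (R : realType) (V : atlas (cplx R)) (m : nat).
Local Notation C := (cplx R).
Hypothesis hV : smooth_irreducible_variety V m.
Implicit Types (g h : V -> C) (i j : chart V) (x y : V) (O U : set V).

Lemma hol_sum I (s : seq I) (F : I -> V -> C) x : (forall k, hol_at (F k) x) ->
  hol_at (fun y => \sum_(k <- s) F k y) x.
Proof.
move=> hF; elim: s => [|k s IH].
  have -> : (fun y => \sum_(k <- [::]) F k y) = (fun=> 0) by apply/funext => y; rewrite big_nil.
  exact: hol_cst.
have -> : (fun y => \sum_(k <- k :: s) F k y) = (fun y => F k y + \sum_(k <- s) F k y).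
  by apply/funext => y; rewrite big_cons.
exact: hol_add.
Qed.

(** The coordinates are the linear forms [B] of [local_section]. The inverse chart exists because
    common zeros of the equations near [x] are points of [V], by the last clause of [smooth_at]. *)
Lemma coords_exist x O : anbhs x O -> exists (U : set V) (r : V -> 'rV[C]_m) s,
  [/\ local_coordinates U r s, U x & U `<=` O].
Proof.
move=> xO; have [i dx] := var_cover hV x.
have [c [p [Q [cm pV rJ Qx hQ]]]] := var_smooth hV dx.
have [B [psi [D [psia npsi npsi' _ _]]]] := local_section cm (fun k => pV k x dx) rJ.
pose A0 : set 'rV[C]_(adim i) := [set v | [/\ (forall k, peval (p k) v = 0) -> psi (v *m B) = v,
   peval Q v != 0 & forall y, dom i y -> crd i y = v -> O y]].
have nA0 : nbhs (crd i x) A0.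
  have n1 := poly_near_neq0 Qx; have n2 := xO i dx.
  by apply: filterS3 npsi' n1 n2 => v h1 h2 h3; split.
have [A [oA Ax AA0]] : exists A, [/\ open A, A (crd i x) & A `<=` A0].
  exists A0^°; split; [exact: open_interior|exact: nA0|exact: interior_subset].
have cpsi : {for crd i x *m B, continuous psi}.
  by apply: differentiable_continuous; have [] := nbhs_singleton npsi.
have npsiA : \forall z \near crd i x *m B, A (psi z).
  have nA : nbhs (psi (crd i x *m B)) A by rewrite psia; exact: open_nbhs_nbhs.
  exact: cpsi nA.
pose Z0 : set 'rV[C]_m := [set z | [/\ differentiable psi z, psi z *m B = z,
   forall k, peval (p k) (psi z) = 0 & A (psi z)]].
have nZ0 : nbhs (crd i x *m B) Z0.
  by apply: filterS2 npsi npsiA => z [h1 h2 h3] h4; split.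
have [Z [oZ Zx ZZ0]] : exists Z, [/\ open Z, Z (crd i x *m B) & Z `<=` Z0].
  exists Z0^°; split; [exact: open_interior|exact: nZ0|exact: interior_subset].
pose r y : 'rV[C]_m := crd i y *m B.
have [s sP] : exists s : 'rV[C]_m -> V, forall z, Z z -> dom i (s z) /\ crd i (s z) = psi z.
  suff ex : forall z : 'rV[C]_m, exists y, Z z -> dom i y /\ crd i y = psi z.
    by have [s hs] := choice ex; exists s.
  (* Outside [Z] the value [x] is arbitrary; only the values on [Z] matter. *)
  move=> z; have [zZ|nZ] := pselect (Z z); last by exists x.
  have [h1 h2 h3 h4] := ZZ0 _ zZ; have [_ q _] := AA0 _ h4.
  by have [y dy yE] := hQ _ q h3; exists y.
pose U := [set y | [/\ dom i y, A (crd i y) & Z (r y)]].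
have dr v : differentiable (fun v : 'rV[C]_(adim i) => v *m B) v.
  have [b _ hb] := mulmx_bound B.
  pose f : {linear 'rV[C]_(adim i) -> 'rV[C]_m} := mulmxr B.
  apply: (@linear_differentiable _ _ _ f v).
  exact: (@bounded_linear_cont _ _ _ f b).
have rhol y k : dom i y -> hol_at (fun y => r y 0 k) y.
  move=> dy; have -> : (fun y => r y 0 k) = (fun y => \sum_l crd i y 0 l * B l k).
    by apply/funext => y'; rewrite mxE.
  apply: hol_sum => l; apply: hol_mul; last exact: hol_cst.
  by apply: (regular_hol); exact: (var_compat hV).
have srE y : U y -> s (r y) = y.
  move=> [dy Ay Zy]; have [d1 e1] := sP _ Zy; apply: (var_inj hV d1 dy).
  have [h1 _ _] := AA0 _ Ay.
  by rewrite e1; apply: h1 => k; exact: pV.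
have Us z : Z z -> U (s z) /\ r (s z) = z.
  move=> zZ; have [d1 e1] := sP _ zZ; have [h1 h2 h3 h4] := ZZ0 _ zZ.
  have E : r (s z) = z by rewrite /r e1.
  by split => //; split => //; rewrite ?e1// E.
exists U, r, s; split.
- split.
  + move=> y [dy Ay Zy]; apply: (anbhs_chart hV dy).
    have c1 : {for crd i y, continuous (fun v : 'rV[C]_(adim i) => v *m B)}.
      exact: differentiable_continuous.
    have n1 : nbhs (crd i y) A by apply: open_nbhs_nbhs.
    have n2 : \forall v \near crd i y, Z (v *m B) by apply: (c1 Z); apply: open_nbhs_nbhs.
    by apply: filterS2 n1 n2 => v Av Zv y' dy' yv; split; rewrite /r ?yv.
  + by move=> y Uy; split; [move=> k; apply: rhol; case: Uy|exact: srE].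
  + have -> : r @` U = Z => //.
    apply/seteqP; split => [z [y [_ _ Zy] <-] //|z zZ].
    by have [Usz rs] := Us _ zZ; exists (s z).
  + move=> y Uy g hg; have [dy Ay Zy] := Uy.
    have [dsy esy] := sP _ Zy; have [G nG] := hg i dsy.
    rewrite esy in nG; have [dpsi _ _ _] := ZZ0 _ Zy.
    have c1 : {for r y, continuous psi} by exact: differentiable_continuous.
    have n1 : \forall z \near r y, differentiable G (psi z) /\
        forall y, dom i y -> crd i y = psi z -> g y = G (psi z).
      exact: (c1 [set v | differentiable G v /\ forall y, dom i y -> crd i y = v -> g y = G v]).
    have n2 : nbhs (r y) Z by apply: open_nbhs_nbhs.
    have n12 : \forall z \near r y, (differentiable G (psi z) /\
        forall y, dom i y -> crd i y = psi z -> g y = G (psi z)) /\ Z z.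
      by apply: filterS2 n1 n2.
    apply: filterS (nbhs_interior n12) => z nz; have [[dG gG] Zz] := nbhs_singleton nz.
    have [dpsiz _ _ _] := ZZ0 _ Zz.
    apply: (near_differentiable (f := G \o psi) _ _).1; last exact: (differentiable_comp dpsiz dG).
    apply: filterS nz => z' [[_ gG'] Zz'] /=; have [d' e'] := sP _ Zz'.
    by rewrite (gG' _ d' e').
- by split.
- move=> y [dy Ay _]; have [_ _ h] := AA0 _ Ay.
  exact: h.
Qed.

Lemma anbhsT x : anbhs x setT.
Proof. by move=> i dx; apply: filterE. Qed.

Lemma hol_compose N (r : V -> 'rV[C]_N) (G : 'rV[C]_N -> C) x :
  (forall k, hol_at (fun y => r y 0 k) x) ->
  (\forall z \near r x, differentiable G z) -> hol_at (G \o r) x.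
Proof.
move=> hr nG; have [i dx] := var_cover hV x; apply: (hol_chart hV dx).
have ex k : exists H : 'rV[C]_(adim i) -> C, \forall v \near crd i x, differentiable H v /\
    forall y, dom i y -> crd i y = v -> r y 0 k = H v by exact: hr k i dx.
have [H hH] := choice ex; have nH := near_all hH.
pose rho v : 'rV[C]_N := \row_k H k v; exists (G \o rho).
have drho v : (forall k, differentiable (H k) v) -> differentiable rho v.
  move=> d; apply: (differentiable_row _).1 => k.
  by apply: (near_differentiable _ (d k)).1; apply: filterE => w; rewrite mxE.
have rhoE v y : dom i y -> crd i y = v -> (forall k, r y 0 k = H k v) -> r y = rho v.
  by move=> dy yv h; apply/rowP => k; rewrite mxE -h.
have hx k : r x 0 k = H k (crd i x) by have [_] := nbhs_singleton nH k; exact.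
have c : {for crd i x, continuous rho}.
  apply: differentiable_continuous; apply: drho => k.
  by have [] := nbhs_singleton nH k.
have rx : r x = rho (crd i x) by exact: rhoE.
have nG' : \forall v \near crd i x, differentiable G (rho v).
  by apply: (c (fun z => differentiable G z)); rewrite -rx.
apply: filterS2 nH nG' => v hv dG; split.
  exact: (differentiable_comp (drho v (fun k => (hv k).1)) dG).
move=> y dy yv /=; congr G; apply: rhoE => // k.
by have [_] := hv k; exact.
Qed.

Section Coordinates.
Variables (U : set V) (r : V -> 'rV[C]_m) (s : 'rV[C]_m -> V).
Hypothesis lc : local_coordinates U r s.

Lemma lc_open x : U x -> anbhs x U.
Proof. by case: lc => oU _ _ _; exact: oU. Qed.

Lemma lc_hol x k : U x -> hol_at (fun y => r y 0 k) x.
Proof. by case: lc => _ h _ _ /h[]. Qed.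

Lemma lc_sr x : U x -> s (r x) = x.
Proof. by case: lc => _ h _ _ /h[]. Qed.

Lemma lc_rs z : (r @` U) z -> U (s z) /\ r (s z) = z.
Proof. by move=> [y Uy <-]; rewrite lc_sr. Qed.

Lemma lc_near x : U x -> \forall z \near r x, (r @` U) z.
Proof. by case: lc => _ _ oU _ Ux; apply: open_nbhs_nbhs; split => //; exists x. Qed.

Lemma hol_comp g x : U x -> hol_at g x -> \forall z \near r x, differentiable (g \o s : 'rV[C]_m -> C) z.
Proof. by case: lc => _ _ _ h Ux hg; apply: h; rewrite ?lc_sr. Qed.

Lemma hol_of_coord (G : 'rV[C]_m -> C) x : U x ->
  (\forall z \near r x, differentiable G z) -> hol_at (G \o r) x.
Proof. by move=> Ux; apply: hol_compose => k; exact: lc_hol. Qed.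

Lemma on_germsT x (u : tvec V) g : hol_at g x -> on_germs x u g = u g.
Proof. by move=> hg; rewrite /on_germs; case: asboolP. Qed.

Lemma on_germs_ext x (u v : tvec V) : (forall g, hol_at g x -> u g = v g) ->
  on_germs x u = on_germs x v.
Proof. by move=> uv; apply/funext => g; rewrite /on_germs; case: asboolP => // /uv. Qed.

Lemma on_germsF x (u : tvec V) g : ~ hol_at g x -> on_germs x u g = 0.
Proof. by move=> hg; rewrite /on_germs; case: asboolP. Qed.

Lemma tangent_nonhol x u g : tangent x u -> ~ hol_at g x -> u g = 0.
Proof. by move=> [gam [_ _ ->]]; exact: on_germsF. Qed.

(** Near 0, [g] along the curve is [g \o s] along the curve read in coordinates, so the chain rule
    applies. A tangent vector thus depends on [m] numbers only. *)
Lemma tangent_coord x u g : U x -> tangent x u -> hol_at g x ->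
  u g = \sum_k u (fun y => r y 0 k) * 'D_(delta_mx 0 k) (g \o s : 'rV[C]_m -> C) (r x).
Proof.
move=> Ux [gam [g0 hgam uE]] hg; rewrite {1}uE on_germsT//.
have nU : \forall t \near (0 : C), U (gam t).
  by apply: (holmap_near hV hgam); rewrite g0; exact: lc_open.
have dk k : differentiable (fun t : C => (r \o gam) t 0 k : C) 0.
  by have := nbhs_singleton (hgam (fun y => r y 0 k) _); apply; rewrite g0; exact: lc_hol.
have dG : differentiable (g \o s : 'rV[C]_m -> C) ((r \o gam) 0).
  by rewrite /= g0; exact: nbhs_singleton (hol_comp Ux hg).
have [dc ec] := chain_curve dG dk.
rewrite (near_derive (f := (g \o s) \o (r \o gam)) _ _ dc); last first.
  by apply: filterS nU => t Ut /=; rewrite lc_sr.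
rewrite ec; apply: eq_bigr => k _; rewrite mulrC /= g0; congr (_ * _).
by rewrite uE on_germsT//; exact: lc_hol.
Qed.

Definition coord_vec (x : V) (a : 'rV[C]_m) : tvec V :=
  on_germs x (fun g => 'D_a (g \o s : 'rV[C]_m -> C) (r x)).

Lemma tangent_coord_vec x a : U x -> tangent x (coord_vec x a).
Proof.
move=> Ux; pose gam (t : C) := s (r x + t *: a).
have g0 : gam 0 = x by rewrite /gam scale0r addr0 lc_sr.
exists gam; split; first exact: g0.
  move=> g; rewrite g0 => hg; have := hol_comp Ux hg => /nearN[d d0 hd].
  apply: (proj2 (@nearN R C _ 0)); exists (d / (nrm a + 1)).
    by rewrite divr_gt0// ltr_wpDl ?nrm_ge0.
  move=> t; rewrite subr0 ltr_pdivlMr ?ltr_wpDl ?nrm_ge0// => td.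
  have dg : differentiable (g \o s : 'rV[C]_m -> C) (r x + t *: a).
    apply: hd; rewrite addrAC subrr add0r nrmZ; apply: le_lt_trans td.
    by rewrite ler_wpM2l ?nrm_ge0// lerDl.
  exact: (diff_line dg).1.
apply: on_germs_ext => g hg; have dg := nbhs_singleton (hol_comp Ux hg).
exact: esym (chain_line a dg).2.
Qed.

Lemma tangentE x u : U x -> tangent x u -> u = coord_vec x (\row_k u (fun y => r y 0 k)).
Proof.
move=> Ux tu; apply/funext => g; rewrite /coord_vec.
have [hg|hg] := pselect (hol_at g x); last by rewrite on_germsF// (tangent_nonhol tu).
rewrite on_germsT// (tangent_coord Ux tu hg) derive_coord; last exact: nbhs_singleton (hol_comp Ux hg).
by apply: eq_bigr => k _; rewrite mxE.
Qed.

Lemma tangent_ext x u v : U x -> tangent x u -> tangent x v ->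
  (forall k, u (fun y => r y 0 k) = v (fun y => r y 0 k)) -> u = v.
Proof.
move=> Ux tu tv uv; rewrite (tangentE Ux tu) (tangentE Ux tv); congr coord_vec.
by apply/rowP => k; rewrite !mxE uv.
Qed.

End Coordinates.

(** Not immediate for velocities of curves: in coordinates every vector is the velocity of a
    straight line. *)
Lemma tangent_lin x u v (a : C) : tangent x u -> tangent x v ->
  tangent x (fun g => a * u g + v g).
Proof.
move=> tu tv; have [U [r [s [lc Ux _]]]] := coords_exist (@anbhsT x).
have E : (fun g => a * u g + v g) =
    coord_vec r s x (\row_k (a * u (fun y => r y 0 k) + v (fun y => r y 0 k))).
  apply/funext => g; rewrite /coord_vec.
  have [hg|hg] := pselect (hol_at g x); last first.
    by rewrite on_germsF// (tangent_nonhol tu)// (tangent_nonhol tv)// mulr0 addr0.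
  rewrite on_germsT// (tangent_coord lc Ux tu hg) (tangent_coord lc Ux tv hg).
  rewrite derive_coord; last exact: nbhs_singleton (hol_comp lc Ux hg).
  rewrite mulr_sumr -big_split; apply: eq_bigr => k _; rewrite mxE /=; ring.
rewrite E; exact: (tangent_coord_vec lc _ Ux).
Qed.

(** If one of the functions is not holomorphic at [x], neither is the other, and both values are
    0. *)
Lemma tangent_germ x u g h : tangent x u -> anbhs x [set y | g y = h y] -> u g = u h.
Proof.
move=> tu gh; have hg : anbhs x [set y | h y = g y] by apply: anbhs_sub gh => y /= ->.
have [hh|hh] := pselect (hol_at g x); last first.
  rewrite !(tangent_nonhol tu)// => H; apply: hh; exact: hol_germ H hg.
have hh' : hol_at h x := hol_germ hh gh.
have [gam [g0 hgam ->]] := tu; rewrite (on_germsT _ hh) (on_germsT _ hh').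
rewrite -g0 in hh; have dg : differentiable (g \o gam : C -> C) 0 := nbhs_singleton (hgam g hh).
have e : \forall t \near (0 : C), (g \o gam) t = (h \o gam) t.
  by have gh' := gh; rewrite -g0 in gh'; exact: (holmap_near hV hgam gh').
exact: esym (near_derive (1 : C) e dg).
Qed.

Lemma tangent_add x u g h : tangent x u -> hol_at g x -> hol_at h x ->
  u (fun y => g y + h y) = u g + u h.
Proof.
move=> [gam [g0 hgam ->]] hg hh.
rewrite (on_germsT _ hg) (on_germsT _ hh) (on_germsT _ (hol_add hg hh)).
rewrite -g0 in hg hh; have dg := nbhs_singleton (hgam g hg); have dh := nbhs_singleton (hgam h hh).
exact: (@deriveD _ _ _ (g \o gam : C -> C) (h \o gam : C -> C) 0 1 (diff_derivable dg) (diff_derivable dh)).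
Qed.

Lemma tangent_mul x u g h : tangent x u -> hol_at g x -> hol_at h x ->
  u (fun y => g y * h y) = u g * h x + g x * u h.
Proof.
move=> [gam [g0 hgam ->]] hg hh.
rewrite (on_germsT _ hg) (on_germsT _ hh) (on_germsT _ (hol_mul hg hh)).
rewrite -g0 in hg hh *; have dg := nbhs_singleton (hgam g hg); have dh := nbhs_singleton (hgam h hh).
have := @deriveM _ _ (g \o gam : C -> C) (h \o gam : C -> C) 0 1 (diff_derivable dg) (diff_derivable dh).
by move=> ->; rewrite addrC mulrC.
Qed.

Lemma tangent_cst x u (c : C) : tangent x u -> u (fun=> c) = 0.
Proof.
move=> [gam [g0 hgam ->]]; rewrite (on_germsT _ (hol_cst c (x := x))).
have -> : (fun=> c) \o gam = cst c by []. exact: derive_cst.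
Qed.

Lemma tangent_sum x u I (l : seq I) (F : I -> V -> C) : tangent x u ->
  (forall k, hol_at (F k) x) -> u (fun y => \sum_(k <- l) F k y) = \sum_(k <- l) u (F k).
Proof.
move=> tu hF; elim: l => [|k l IH].
  have -> : (fun y => \sum_(k <- [::]) F k y) = (fun=> 0) by apply/funext => y; rewrite big_nil.
  by rewrite big_nil (tangent_cst _ tu).
have -> : (fun y => \sum_(k <- k :: l) F k y) = (fun y => F k y + \sum_(k <- l) F k y).
  by apply/funext => y; rewrite big_cons.
by rewrite big_cons -IH; apply: (tangent_add tu); [exact: hF|exact: hol_sum].
Qed.

Lemma hol_opp g x : hol_at g x -> hol_at (fun y => - g y) x.
Proof.
move=> hg; have -> : (fun y => - g y) = (fun y => -1 * g y) by apply/funext => y; rewrite mulN1r.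
by apply: hol_mul hg; exact: hol_cst.
Qed.

Section Brackets.
Variables (U : set V) (r : V -> 'rV[C]_m) (s : 'rV[C]_m -> V).
Hypothesis lc : local_coordinates U r s.

Definition pd (a : 'rV[C]_m) g : V -> C := fun y => 'D_a (g \o s : 'rV[C]_m -> C) (r y).

Lemma hol_pd a g x : U x -> hol_at g x -> hol_at (pd a g) x.
Proof.
move=> Ux hg; apply: (hol_of_coord lc Ux (G := fun z => 'D_a (g \o s : 'rV[C]_m -> C) z)).
exact: (derive_hol a (hol_comp lc Ux hg)).
Qed.

Lemma holvf_coord_vec a : holvf U (fun y => coord_vec r s y a).
Proof.
split=> [x Ux|x g Ux hg]; first exact: (tangent_coord_vec lc).
apply: (hol_germ (hol_pd a Ux hg)).
apply: anbhs_sub (hol_near hV hg) => y hgy /=.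
by rewrite /coord_vec on_germsT.
Qed.

Lemma holvf_near W X x g : holvf W X -> W x -> aopen W -> U x -> hol_at g x ->
  anbhs x [set y | X y g = \sum_k X y (fun y' => r y' 0 k) * pd (delta_mx 0 k) g y].
Proof.
move=> [tX _] Wx oW Ux hg.
apply: anbhs_sub (anbhsI (oW x Wx) (anbhsI (lc_open lc Ux) (hol_near hV hg))) => y [Wy [Uy hy]] /=.
exact: (tangent_coord lc Uy (tX y Wy) hy).
Qed.

Lemma pd_pd x (j k : 'I_m) g : U x -> hol_at g x ->
  pd (delta_mx 0 j) (pd (delta_mx 0 k) g) x = pd (delta_mx 0 k) (pd (delta_mx 0 j) g) x.
Proof.
move=> Ux hg; have hc := hol_comp lc Ux hg.
have E a b : pd a (pd b g) x = 'D_a (fun z => 'D_b (g \o s : 'rV[C]_m -> C) z) (r x).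
  have db : differentiable (fun z => 'D_b (g \o s : 'rV[C]_m -> C) z) (r x).
    exact: nbhs_singleton (derive_hol b hc).
  rewrite /pd; apply: (near_derive a _ db).
  by apply: filterS (lc_near lc Ux) => z /(lc_rs lc)[_ /= ->].
by rewrite !E; exact: derive_sym.
Qed.

(** The second derivatives of [g] cancel by symmetry, so the bracket is again a first order
    operator, determined by its values on the coordinates. This is what makes it a tangent
    vector. *)
Lemma bracket_coord W X Y x g : aopen W -> holvf W X -> holvf W Y -> W x -> U x ->
  hol_at g x ->
  bracket X Y x g = \sum_k bracket X Y x (fun y => r y 0 k) * pd (delta_mx 0 k) g x.
Proof.
move=> oW hX hY Wx Ux hg; pose rk k y := r y 0 k.
have hr k : hol_at (rk k) x by exact: (lc_hol lc).
have key X' Y' : holvf W X' -> holvf W Y' -> X' x (fun y => Y' y g) =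
   \sum_k (X' x (fun y => Y' y (rk k)) * pd (delta_mx 0 k) g x +
     \sum_j X' x (rk j) * Y' x (rk k) * pd (delta_mx 0 j) (pd (delta_mx 0 k) g) x).
  move=> hX' hY'; rewrite (tangent_germ (hX'.1 x Wx) (holvf_near hY' Wx oW Ux hg)).
  have h1 k : hol_at (fun y => Y' y (rk k)) x by exact: hY'.2.
  have h2 k : hol_at (pd (delta_mx 0 k) g) x by exact: hol_pd.
  rewrite (tangent_sum _ (hX'.1 x Wx)); last by move=> k; apply: hol_mul (h1 k) (h2 k).
  apply: eq_bigr => k _; rewrite (tangent_mul (hX'.1 x Wx) (h1 k) (h2 k)).
  congr (_ + _); rewrite (tangent_coord lc Ux (hX'.1 x Wx) (h2 k)) mulr_sumr.
  by apply: eq_bigr => j _; rewrite mulrA; congr (_ * _); rewrite mulrC.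
rewrite /bracket (on_germsT _ hg) (key X Y hX hY) (key Y X hY hX) !big_split /=.
have -> : \sum_k \sum_j X x (rk j) * Y x (rk k) * pd (delta_mx 0 j) (pd (delta_mx 0 k) g) x =
          \sum_k \sum_j Y x (rk j) * X x (rk k) * pd (delta_mx 0 j) (pd (delta_mx 0 k) g) x.
  rewrite exchange_big; apply: eq_bigr => k _; apply: eq_bigr => j _.
  by rewrite (pd_pd k j Ux hg) [X x _ * _]mulrC.
rewrite opprD addrACA subrr addr0 -sumrB; apply: eq_bigr => k _.
by rewrite on_germsT; [rewrite mulrBl|exact: hr].
Qed.

Lemma bracket_tangent_coord W X Y x : aopen W -> holvf W X -> holvf W Y -> W x -> U x ->
  tangent x (bracket X Y x).
Proof.
move=> oW hX hY Wx Ux.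
suff -> : bracket X Y x = coord_vec r s x (\row_k bracket X Y x (fun y => r y 0 k)).
  exact: (tangent_coord_vec lc).
apply/funext => g; rewrite /coord_vec; have [hg|hg] := pselect (hol_at g x); last first.
  by rewrite /bracket !on_germsF.
rewrite on_germsT// (bracket_coord oW hX hY Wx Ux hg) derive_coord; last first.
  exact: nbhs_singleton (hol_comp lc Ux hg).
by apply: eq_bigr => k _; rewrite mxE.
Qed.

End Brackets.

Lemma bracket_tangent W X Y x : aopen W -> holvf W X -> holvf W Y -> W x ->
  tangent x (bracket X Y x).
Proof.
move=> oW hX hY Wx; have [U [r [s [lc Ux _]]]] := coords_exist (@anbhsT x).
exact: (bracket_tangent_coord lc oW hX hY Wx Ux).
Qed.

End LocalCoordinates.

(** * Density of Zariski open sets *)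

Section PolynomialRelations.
Variable R : realType.
Local Notation C := (cplx R).

(** Induction on a degree bound: the partial derivatives also vanish near [a], so they are zero, and
    [p] is constant in characteristic 0. *)
Lemma mpoly_near0 N (p : mpoly N C) (a : 'rV[C]_N) :
  (\forall v \near a, peval p v = 0) -> p = 0.
Proof.
have [e pe] : exists e, forall mu : multinom N, (e <= mdeg mu)%N -> mcoeff mu p = 0.
  by exists (msize p) => mu /msize_mdeg_ge; rewrite -mcoeff_eq0 => /eqP.
elim: e p pe => [|e IH] p pe np.
  by apply/mpolyP => mu; rewrite mcoeff0 pe.
have dp k : mderiv k p = 0.
  apply: IH => [mu emu|].
    by rewrite mcoeff_mderiv pe ?mul0rn// mdegD mdeg1 addn1.
  apply: filterS (nbhs_interior np) => v nv.
  have d0 : differentiable (fun=> 0 : C) v by exact: differentiable_cst.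
  have [_ hE] := near_dd (f := fun=> 0) (g := peval p) (filterS (fun z h => esym h) nv) d0.
  have := hE (delta_mx 0 k); rewrite (poly_diff p v).2 /grad (bigD1 k)//= big1 => [|l lk].
    rewrite mxE !eqxx mulr1 addr0 => ->; rewrite ddE.
    by rewrite diff_cst.
  by rewrite mxE eqxx (negPf lk) mulr0.
have pc : p = mpolyC N (mcoeff (@mnm0 N) p).
  apply/mpolyP => mu; rewrite mcoeffC; have [->|mu0] := eqVneq mu (@mnm0 N); first by rewrite mulr1.
  rewrite mulr0; have [k mk] : exists k, mu k != 0%N.
    apply/existsP; rewrite -negb_forall; apply: contraNN mu0 => /forallP h.
    by apply/eqP/mnmP => k; rewrite mnm0E; apply/eqP; exact: h.
  have := congr1 (mcoeff (mnm_sub mu (mnm1 k))) (dp k).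
  rewrite mcoeff_mderiv mcoeff0 submK; last first.
    by apply/mnm_lepP => l; rewrite mnm1E; case: eqVneq => [<-|//]; rewrite lt0n.
  by move=> /eqP; rewrite mulrn_eq0 /= => /eqP.
by have := nbhs_singleton np; rewrite pc pevalC => ->; rewrite mpolyC0.
Qed.

Lemma box_near0 N d (c : {ffun 'I_N -> 'I_d} -> C) (a : 'rV[C]_N) :
  (\forall v \near a, \sum_al c al * \prod_k (v : 'rV[C]_N) 0 k ^+ al k = 0) -> forall al, c al = 0.
Proof.
move=> nc; pose mn (al : {ffun 'I_N -> 'I_d}) : multinom N := Multinom [tuple al k : nat | k < N].
have mn_inj : injective mn.
  by move=> al be /mnmP h; apply/ffunP => k; apply: val_inj; have := h k; rewrite !mnmE.
pose p : mpoly N C := \sum_al c al *: mpolyX C (mn al).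
have p0 : p = 0.
  apply: (mpoly_near0 (a := a)); apply: filterS nc => v <-; rewrite peval_sum; apply: eq_bigr => al _.
  rewrite /peval mevalZ mevalX; congr (_ * _); apply: eq_bigr => k _.
  by rewrite mnmE.
move=> al; have := congr1 (mcoeff (mn al)) p0; rewrite mcoeff0 => <-.
rewrite raddf_sum (bigD1 al)//= mcoeffZ mcoeffX eqxx mulr1 big1 ?addr0// => be be_al.
by rewrite mcoeffZ mcoeffX (inj_eq mn_inj) (negPf be_al) mulr0.
Qed.

(** Polynomials of size at most [B] are supported on the [B ^ N] monomials with exponents below [B];
    more of them than that are dependent. *)
Lemma linear_dependence (T : finType) N B (M : T -> mpoly N C) :
  (forall tau, msize (M tau) <= B)%N -> (B ^ N < #|T|)%N ->
  exists F : T -> C, (exists tau, F tau != 0) /\ \sum_tau F tau *: M tau = 0.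
Proof.
move=> hB cT; pose J := {ffun 'I_N -> 'I_B}.
pose mn (al : J) : multinom N := Multinom [tuple al k : nat | k < N].
pose A : 'M[C]_(#|T|, #|J|) := \matrix_(a, b) mcoeff (mn (enum_val b)) (M (enum_val a)).
have kA : kermx A != 0.
  rewrite kermx_eq0 -row_leq_rank -ltnNge; apply: leq_ltn_trans (rank_leq_col _) _.
  by rewrite card_ffun !card_ord.
have [i ri] : exists i, row i (kermx A) != 0.
  apply/existsP; rewrite -negb_forall; apply: contraNN kA => /forallP h.
  by apply/eqP/row_matrixP => i; rewrite row0; apply/eqP; exact: h.
pose u := row i (kermx A).
have uA : u *m A = 0 by rewrite -row_mul mulmx_ker row0.
exists (fun tau => u 0 (enum_rank tau)); split.
  have [k uk] : exists k, u 0 k != 0.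
    apply/existsP; rewrite -negb_forall; apply: contraNN ri => /forallP h.
    by apply/eqP/rowP => k; rewrite [RHS]mxE; apply/eqP; exact: h.
  by exists (enum_val k); rewrite enum_valK.
apply/mpolyP => mu; rewrite mcoeff0 raddf_sum /=.
have [Bmu|muB] := leqP B (mdeg mu).
  apply: big1 => tau _; rewrite mcoeffZ (_ : mcoeff mu (M tau) = 0) ?mulr0//.
  by apply/eqP; rewrite mcoeff_eq0; apply: msize_mdeg_ge; exact: leq_trans (hB tau) Bmu.
have mk k : (mu k < B)%N.
  apply: leq_ltn_trans muB; rewrite mdegE (bigD1 k)//=; exact: leq_addr.
pose al : J := [ffun k => Ordinal (mk k)].
have almu : mn al = mu by apply/mnmP => k; rewrite mnmE ffunE.
have := congr1 (fun v : 'rV[C]_#|J| => v 0 (enum_rank al)) uA; rewrite !mxE => h.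
rewrite -[RHS]h (reindex (@enum_val T T)) /=; last by apply: onW_bij; exact: enum_val_bij.
apply: eq_bigr => k _; rewrite mcoeffZ enum_valK; congr (_ * _).
by rewrite [RHS]mxE enum_rankK almu.
Qed.

Definition pdeg N (p : mpoly N C) := (msize p).+1.

Lemma pdegM N (p q : mpoly N C) : (pdeg (p * q)%R <= pdeg p + pdeg q)%N.
Proof. by have := msizeM_le p q; rewrite /pdeg; lia. Qed.

Lemma pdeg1 N : pdeg (1 : mpoly N C) = 2%N.
Proof. by rewrite /pdeg msize1. Qed.

Lemma pdegX N (p : mpoly N C) k : (pdeg (p ^+ k)%R <= 2 + k * pdeg p)%N.
Proof.
elim: k => [|k IH]; first by rewrite expr0 pdeg1.
by rewrite exprS; apply: leq_trans (pdegM _ _) _; lia.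
Qed.

Lemma pdeg_prod N c E (F : 'I_c -> mpoly N C) : (forall k, pdeg (F k) <= E)%N ->
  (pdeg (\prod_k F k)%R <= 2 + c * E)%N.
Proof.
elim: c F => [|c IH] F hF; first by rewrite big_ord0 pdeg1.
rewrite big_ord_recl; apply: leq_trans (pdegM _ _) _.
rewrite (leq_trans (leq_add (hF ord0) (IH _ (fun k => hF (lift ord0 k)))))//.
by rewrite mulSn addnCA.
Qed.

(** There are [d ^ (N + 1)] products with exponents below [d], of size at most [K * d]; for
    [d > K ^ N] this number exceeds [(K * d) ^ N]. *)
Lemma algebraic_relation N c m (p : 'I_c -> mpoly N C) (z : 'I_m -> mpoly N C)
    (P : mpoly N C) : (c + m)%N = N ->
  exists d (F : {ffun 'I_c -> 'I_d} * {ffun 'I_m -> 'I_d} * 'I_d -> C),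
    (exists tau, F tau != 0) /\
    \sum_tau F tau *: (\prod_k p k ^+ tau.1.1 k * \prod_l z l ^+ tau.1.2 l * P ^+ tau.2) = 0.
Proof.
move=> cm; pose E := (\sum_k pdeg (p k) + \sum_l pdeg (z l) + pdeg P + 2)%N.
(* [N + 1] powers of size at most [d * E] are multiplied; the rest of the factor is slack for
   additive constants. *)
pose K := ((N + 5) * E)%N; pose d := (K ^ N).+1; exists d.
apply: (linear_dependence (B := (K * d)%N)) => [[[al be] b] /=|]; last first.
  by rewrite !card_prod !card_ffun !card_ord -expnD cm expnMn mulnC ltn_pmul2l ?expn_gt0.
have hX (q : mpoly N C) (k : 'I_d) : (pdeg q <= E)%N -> (pdeg (q ^+ k)%R <= d * E)%N.
  move=> qE; apply: leq_trans (pdegX _ _) _.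
  have kd := ltn_ord k; have E2 : (2 <= E)%N by rewrite /E; lia.
  by move: (pdeg q) (nat_of_ord k) kd qE => a j; nia.
have hp k : (pdeg (p k) <= E)%N by rewrite /E (bigD1 k)//=; lia.
have hz l : (pdeg (z l) <= E)%N by rewrite /E (bigD1 l)//=; lia.
have hP : (pdeg P <= E)%N by rewrite /E; lia.
have h1 := pdeg_prod (fun k => hX (p k) (al k) (hp k)).
have h2 := pdeg_prod (fun l => hX (z l) (be l) (hz l)).
have h3 := hX P b hP.
have h4 := pdegM (\prod_k p k ^+ al k * \prod_l z l ^+ be l) (P ^+ b).
have h5 := pdegM (\prod_k p k ^+ al k) (\prod_l z l ^+ be l).
have E2 : (2 <= E)%N by rewrite /E; lia.
apply: leq_trans (leqnSn _) _; rewrite -[_.+1]/(pdeg _).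
apply: leq_trans h4 _; apply: leq_trans (leq_add (leq_trans h5 (leq_add h1 h2)) h3) _.
have d1 : (1 <= d)%N by [].
have -> : (K * d = (N + 5) * (d * E))%N by rewrite /K; lia.
have dE2 : (2 <= d * E)%N by apply: leq_trans E2 _; rewrite leq_pmull.
by rewrite -cm; move: (d * E)%N dE2 => x x2; rewrite !mulnDl; lia.
Qed.

Definition total_exponent c d (al : {ffun 'I_c -> 'I_d}) : nat := (\sum_k al k)%N.

Definition on_line N (v xi : 'rV[C]_N) : mpoly N C -> {poly C} :=
  mmap polyC (fun k => (v 0 k)%:P + xi 0 k *: 'X).

Lemma on_lineP N (v xi : 'rV[C]_N) p :
  (on_line v xi p).[0] = peval p v /\ ((on_line v xi p)^`()).[0] = grad p v xi.
Proof.
move: p; apply: mpoly_ring_ind => [c|k|p q [hp hp'] [hq hq']|p q [hp hp'] [hq hq']].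
- by rewrite /on_line mmapC derivC !hornerE pevalC gradC.
- rewrite /on_line mmapX mmap1U pevalX gradX derivD derivC derivZ derivX.
  by rewrite !hornerE.
- by rewrite /on_line !mmapD derivD !hornerD pevalD gradD -hp -hq -hp' -hq'.
- have -> : on_line v xi (p * q) = on_line v xi p * on_line v xi q by exact: rmorphM.
  by rewrite derivM pevalM gradM hornerD !hornerM hp hq hp' hq'.
Qed.

(* Lowest order part in [p] along a line through the common zero [v] of the
   [p k], in a direction where they have prescribed derivatives. *)
Lemma lowest_part N c m d (p : 'I_c -> mpoly N C) (z : 'I_m -> mpoly N C)
    (P : mpoly N C) (F : {ffun 'I_c -> 'I_d} * {ffun 'I_m -> 'I_d} * 'I_d -> C)
    d0 (v xi : 'rV[C]_N) :
  \sum_tau F tau *: (\prod_k p k ^+ tau.1.1 k * \prod_l z l ^+ tau.1.2 l * P ^+ tau.2) = 0 ->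
  (forall tau, F tau != 0 -> (d0 <= total_exponent tau.1.1)%N) ->
  (forall k, peval (p k) v = 0) ->
  \sum_(tau | (total_exponent tau.1.1 == d0)) F tau *
    (\prod_k grad (p k) v xi ^+ tau.1.1 k *
     (\prod_l peval (z l) v ^+ tau.1.2 l * peval P v ^+ tau.2)) = 0.
Proof.
move=> rel dF pv; pose L := on_line v xi.
have ex k : exists q, L (p k) = 'X * q /\ q.[0] = grad (p k) v xi.
  have [h0 h1] := on_lineP v xi (p k).
  have /factor_theorem[q E] : root (L (p k)) 0 by rewrite /root /L h0 pv.
  have E' : L (p k) = 'X * q by rewrite E polyC0 subr0 mulrC.
  exists q; split; first exact: E'.
  by rewrite -h1 -/L E' derivM derivX hornerD !hornerM !hornerE.
have [q hq] := choice ex.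
have LM p1 p2 : L (p1 * p2) = L p1 * L p2 by exact: rmorphM.
have LX p1 k : L (p1 ^+ k) = L p1 ^+ k by exact: rmorphXn.
have Lprod I (r : seq I) (G : I -> mpoly N C) : L (\prod_(k <- r) G k) = \prod_(k <- r) L (G k).
  exact: rmorph_prod.
(* The relation on the line, divided by ['X^d0]: each [p k] contributes a factor ['X], with cofactor
   [q k] whose value at 0 is the derivative. *)
pose S := \sum_(tau | F tau != 0) F tau *: ('X^(total_exponent tau.1.1 - d0) *
  (\prod_k q k ^+ tau.1.1 k * (\prod_l L (z l) ^+ tau.1.2 l * L P ^+ tau.2))).
have S0 : 'X^d0 * S = 0.
  have := congr1 L rel; rewrite /L /on_line mmap0 raddf_sum => <- /=.
  rewrite mulr_sumr [RHS](bigID (fun tau => F tau != 0)) /= [X in _ = _ + X]big1 ?addr0; last first.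
    by move=> tau /negPn/eqP ->; rewrite scale0r mmap0.
  apply: eq_bigr => tau Ft; rewrite mmapZ -[F tau *: _]mul_polyC mulrCA; congr (_ * _).
  have -> : \prod_k p k ^+ tau.1.1 k * \prod_l z l ^+ tau.1.2 l * P ^+ tau.2 =
    \prod_k p k ^+ tau.1.1 k * (\prod_l z l ^+ tau.1.2 l * P ^+ tau.2) by rewrite mulrA.
  rewrite -[RHS]/(L _) !LM !Lprod LX [LHS]mulrA -exprD subnKC ?dF//.
  rewrite [LHS]mulrA; congr (_ * (_ * _)); last by apply: eq_bigr => l _; rewrite LX.
  rewrite -prodrXr -big_split; apply: eq_bigr => k _ /=.
  by rewrite LX -exprMn -(hq k).1.
have S0' : S = 0 by apply/eqP; move/eqP: S0; rewrite mulf_eq0 expf_eq0 polyX_eq0 andbF.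
have := congr1 (fun Q : {poly C} => Q.[0]) S0'; rewrite /S horner0 horner_sum => S00.
rewrite -[RHS]S00 (bigID (fun tau => F tau != 0)) /= [X in _ + X]big1 ?addr0; last first.
  by move=> tau /andP[_ /negPn/eqP ->]; rewrite mul0r.
rewrite [RHS](bigID (fun tau => (total_exponent tau.1.1 == d0))) /= [X in _ = _ + X]big1 ?addr0; last first.
  move=> tau /andP[Ft dt]; rewrite hornerZ hornerM hornerXn expr0n subn_eq0 leqNgt ltn_neqAle eq_sym dt dF//.
  by rewrite mul0r mulr0.
apply: eq_big => [tau|tau /andP[/eqP dt Ft]]; first by rewrite andbC.
rewrite hornerZ dt subnn expr0 mul1r !hornerM horner_exp; congr (_ * (_ * (_ * _ ^+ _))).
- by rewrite horner_prod; apply: eq_bigr => k _; rewrite horner_exp (hq k).2.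
- by rewrite horner_prod; apply: eq_bigr => k _; rewrite horner_exp (on_lineP _ _ _).1.
- by rewrite (on_lineP _ _ _).1.
Qed.

End PolynomialRelations.

Lemma sum_triple (S : nmodType) (I1 I2 I3 : finType) (G : I1 * I2 * I3 -> S) :
  \sum_t G t = \sum_a \sum_b \sum_c G (a, b, c).
Proof. by rewrite !pair_big /=; apply: eq_bigr => [[[]]]. Qed.

(** * Nonempty Zariski open sets are dense in the transcendental topology *)

Section Density.
Variables (R : realType) (V : atlas (cplx R)) (m : nat).
Local Notation C := (cplx R).
Hypothesis hV : smooth_irreducible_variety V m.
Implicit Types (i : chart V) (x y : V) (O U : set V).

Lemma zopen_peval i (p : mpoly (adim i) C) :
  zopen (dom i `&` [set y | peval p (crd i y) != 0]).
Proof.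
move=> y [dy py]; split; first by exists i.
move=> j dj; pose g y' := peval p (\row_k crd i y' 0 k).
have rg : reg_chart j g y.
  by apply: reg_poly => k; exact: (var_compat hV).
have gE y' : g y' = peval p (crd i y').
  by rewrite /g; congr peval; apply/rowP => k; rewrite mxE.
have gy : g y != 0 by rewrite gE.
have [Q [Q0 hQ]] := reg_neq0 dj rg gy.
have [_ /(_ j dj)[Q' [Q'0 hQ']]] := var_dom_open hV dy.
exists (Q * Q'); rewrite pevalM; split; first exact: mulf_neq0.
move=> y' dy'; rewrite pevalM.
rewrite mulf_eq0 negb_or => /andP[q q'].
by have gy' := hQ y' dy' q; split; [exact: hQ'|rewrite /= -gE].
Qed.

(** Polynomial functions on a chart have no zero divisors: the nonvanishing loci of [p] and [q], if
    nonempty, would meet. *)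
Lemma irreducible_peval i (p q : mpoly (adim i) C) :
  (forall y, dom i y -> peval (p * q) (crd i y) = 0) ->
  (forall y, dom i y -> peval p (crd i y) = 0) \/
  (forall y, dom i y -> peval q (crd i y) = 0).
Proof.
move=> pq; have [[y [dy py]]|np] := pselect (exists y, dom i y /\ peval p (crd i y) != 0); last first.
  by left=> y dy; apply/eqP/negPn/negP => py; apply: np; exists y.
right=> z dz; apply/eqP/negPn/negP => qz; have [_ irr] := var_irreducible hV.
have [t [[dt pt] [_ qt]]] := irr _ _ (@zopen_peval i p) (@zopen_peval i q)
  (ex_intro _ y (conj dy py)) (ex_intro _ z (conj dz qz)).
by move/eqP: (pq t dt); rewrite pevalM mulf_eq0 (negPf pt) (negPf qt).
Qed.

(* Were [P] zero near [x] but not everywhere, an algebraic relation between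
   the equations [p], the local coordinates [z] and [P] would yield a relation
   between [z] and [P] alone on [V]; its term of least degree in [P] would
   vanish near [x] although the coordinates [z] are independent there. *)
Lemma zopen_dense x O U : anbhs x O -> zopen U -> U !=set0 -> exists y, O y /\ U y.
Proof.
move=> nO zU U0; apply: contrapT => nOU; have [i dx] := var_cover hV x.
have [_ irr] := var_irreducible hV.
have [y0 [Uy0 dy0]] : (U `&` dom i) !=set0.
  by apply: irr => //; [exact: (var_dom_open hV)|exists x].
have [_ /(_ i dy0)[P [Py0 hP]]] := zU y0 Uy0.
have P0 y : dom i y -> O y -> peval P (crd i y) = 0.
  by move=> dy Oy; apply/eqP/negPn/negP => Py; apply: nOU; exists y; split => //; exact: hP.
have [c [p [Q [cm pV rJ Qx hQ]]]] := var_smooth hV dx.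
have [B [psi [D [psia npsi npsi' Dx hD]]]] := local_section cm (fun k => pV k x dx) rJ.
pose z (l : 'I_m) : mpoly (adim i) C := \sum_q mpolyC _ (B q l) * mpolyX C (mnm1 q).
have zE l v : peval (z l) v = (v *m B) 0 l.
  rewrite peval_sum mxE; apply: eq_bigr => q _.
  by rewrite pevalM pevalC pevalX mulrC.
have [d [F [[tau1 Ftau1] rel]]] := algebraic_relation p z P cm.
(* A term of least total degree in the equations: such terms dominate on lines through points of
   [V]. *)
have [tau0 Ftau0 dF] : exists2 tau0, F tau0 != 0 &
    forall tau, F tau != 0 -> (total_exponent tau0.1.1 <= total_exponent tau.1.1)%N.
  by case: (arg_minnP (fun tau => total_exponent tau.1.1) (P := fun tau => F tau != 0) Ftau1) => tau; exists tau.
pose al0 := tau0.1.1.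
have relV y : dom i y -> peval D (crd i y) != 0 ->
    \sum_b (\sum_be F (al0, be, b) * \prod_l (crd i y *m B) 0 l ^+ be l) * peval P (crd i y) ^+ b = 0.
  move=> dy Dy; pose v := crd i y.
  pose cc (al : {ffun 'I_c -> 'I_d}) : C := if total_exponent al == total_exponent al0 then
    \sum_b (\sum_be F (al, be, b) * \prod_l (v *m B) 0 l ^+ be l) * peval P v ^+ b else 0.
  suff /(_ al0) : forall al, cc al = 0 by rewrite /cc eqxx.
  (* Where [D] does not vanish the derivatives [eta] of the equations are arbitrary, so the lowest
     part vanishes as a polynomial in [eta], coefficient by coefficient. *)
  apply: (box_near0 (a := 0)); apply: filterE => eta.
  have [xi hxi] := hD v Dy (fun k => eta 0 k).
  have := lowest_part xi rel dF (fun k => pV k y dy) => E0.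
  rewrite -[RHS]E0 [RHS]big_mkcond [RHS]sum_triple /=.
  apply: eq_bigr => al _; rewrite /cc; case: ifP => ta; last first.
    by rewrite mul0r big1// => be _; rewrite big1.
  rewrite mulr_suml exchange_big /=; apply: eq_bigr => b _.
  rewrite !mulr_suml; apply: eq_bigr => be _.
  have -> : \prod_k grad (p k) v xi ^+ al k = \prod_k eta 0 k ^+ al k.
    by apply: eq_bigr => k _; rewrite hxi.
  have -> : \prod_l peval (z l) v ^+ be l = \prod_l (v *m B) 0 l ^+ be l.
    by apply: eq_bigr => k _; rewrite zE.
  by rewrite -!mulrA; congr (_ * _); rewrite mulrA mulrC.
have [b0 [be0 Fb0] hb0] : exists2 b0, exists be0, F (al0, be0, b0) != 0 &
    forall b be, F (al0, be, b) != 0 -> (b0 <= b)%N.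
  have ex0 : [exists be0, F (al0, be0, tau0.2) != 0].
    by apply/existsP; exists tau0.1.2; rewrite /al0 -!surjective_pairing.
  case: (arg_minnP (fun b : 'I_d => b : nat) (P := fun b => [exists be0, F (al0, be0, b) != 0]) ex0) => b /existsP h1 h2.
  by exists b => // b' be h; apply: h2; apply/existsP; exists be.
(* The relation divided by [P ^+ b0]. Irreducibility allows this, [D] being nonzero at [x] and [P]
   at [y0]. *)
pose S : mpoly (adim i) C := \sum_b (\sum_be F (al0, be, b) *: \prod_l z l ^+ be l) * P ^+ (b - b0).
have SE y : peval S (crd i y) =
    \sum_b (\sum_be F (al0, be, b) * \prod_l (crd i y *m B) 0 l ^+ be l) * peval P (crd i y) ^+ (b - b0).
  rewrite peval_sum; apply: eq_bigr => b _; rewrite pevalM; congr (_ * _); last exact: rmorphXn.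
  rewrite peval_sum; apply: eq_bigr => be _; rewrite -mul_mpolyC pevalM pevalC peval_prod.
  by congr (_ * _); apply: eq_bigr => l _; rewrite -zE; exact: rmorphXn.
have S0 y : dom i y -> peval S (crd i y) = 0.
  move: y; have DPS y : dom i y -> peval (D * (P ^+ b0 * S)) (crd i y) = 0.
    move=> dy; rewrite pevalM; have [->|Dy] := eqVneq (peval D (crd i y)) 0; first by rewrite mul0r.
    rewrite pevalM SE [X in _ * X](_ : _ = 0) ?mulr0// -[RHS](relV y dy Dy) mulr_sumr.
    apply: eq_bigr => b _; rewrite (_ : peval (P ^+ b0) _ = peval P (crd i y) ^+ b0); last exact: rmorphXn.
    have [lb|lb] := leqP b0 b; first by rewrite mulrCA -exprD subnKC.
    rewrite big1 ?mul0r ?mulr0// => be _; have [->|/hb0] := eqVneq (F (al0, be, b)) 0; first by rewrite mul0r.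
    by rewrite leqNgt lb.
  have [/(_ x dx) Dx0|PS] := irreducible_peval DPS.
    by rewrite Dx0 eqxx in Dx.
  have [Pb|//] := irreducible_peval PS.
  have := Pb y0 dy0; rewrite (_ : peval (P ^+ b0) _ = peval P (crd i y0) ^+ b0); last exact: rmorphXn.
  by move=> /eqP; rewrite expf_eq0 (negPf Py0) andbF.
suff : F (al0, be0, b0) = 0 by move/eqP; rewrite (negPf Fb0).
pose G (be : {ffun 'I_m -> 'I_d}) := F (al0, be, b0).
suff : forall be, G be = 0 by exact.
apply: (box_near0 (a := crd i x *m B)).
have cpsi : {for crd i x *m B, continuous psi}.
  by apply: differentiable_continuous; have [] := nbhs_singleton npsi.
have n1 : \forall w \near crd i x *m B, (forall y, dom i y -> crd i y = psi w -> O y) /\ peval Q (psi w) != 0.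
  apply: (cpsi [set v | (forall y, dom i y -> crd i y = v -> O y) /\ peval Q v != 0]).
  by rewrite psia; apply: filterS2 (nO i dx) (poly_near_neq0 Qx).
apply: filterS2 npsi n1 => w [_ psiw pw] [Ow Qw].
have [y dy yw] := hQ _ Qw pw.
(* At points of [V] near [x] the polynomial [P] vanishes and only the term [b0] survives, a
   polynomial in the independent coordinates. *)
have := S0 y dy; rewrite SE (P0 y dy (Ow y dy yw)) yw psiw => S0y; rewrite -[RHS]S0y.
rewrite [RHS](bigD1 b0)//= subnn expr0 mulr1 [X in _ + X]big1 ?addr0// => b bb0.
have [lb|lb] := ltnP b0 b; first by rewrite expr0n subn_eq0 leqNgt lb mulr0.
rewrite big1 ?mul0r// => be _; have [->|/hb0 lb'] := eqVneq (F (al0, be, b)) 0; first by rewrite mul0r.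
by case/negP: bb0; apply/eqP/val_inj/eqP; rewrite eqn_leq lb lb'.
Qed.

End Density.

(** * Morphisms and symplectic gradients *)

Section Morphisms.
Variables (R : realType) (V : atlas (cplx R)) (m : nat).
Local Notation C := (cplx R).
Hypothesis hV : smooth_irreducible_variety V m.
Implicit Types (g h : V -> C) (i j : chart V) (x y : V) (O U W : set V).

Lemma hol_neq0 g x : hol_at g x -> g x != 0 -> anbhs x [set y | g y != 0].
Proof.
move=> hg gx i dx; have [G nG] := hg i dx; have [dG gG] := nbhs_singleton nG.
have Gx : G (crd i x) != 0 by rewrite -(gG x dx erefl).
have c : {for crd i x, continuous G} by exact: differentiable_continuous.
have e0 : 0 < nrm (G (crd i x)) by rewrite lt0r nrm_ge0 andbT; apply: contraNneq Gx => /nrm_eq0 ->.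
apply: filterS2 nG (near_cont c e0) => v [_ gv] lv y dy yv /=.
rewrite (gv y dy yv); apply/eqP => G0; move: lv; rewrite G0 sub0r nrmN.
by rewrite ltxx.
Qed.

Lemma hol_preimage N (phi : V -> 'rV[C]_N) (A : set 'rV[C]_N) x :
  (forall k, hol_at (fun y => phi y 0 k) x) -> nbhs (phi x) A ->
  anbhs x [set y | A (phi y)].
Proof.
move=> hphi nA; pose G z : C := if `[< A z >] then 1 else 0.
have hG : hol_at (G \o phi) x.
  apply: (hol_compose hV hphi); apply: filterS (nbhs_interior nA) => z nz.
  have d1 : differentiable (fun=> 1 : C) z by exact: differentiable_cst.
  apply: (near_differentiable _ d1).1; apply: filterS nz => w Aw.
  by rewrite /G; case: asboolP.
have Gx : (G \o phi) x != 0.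
  by rewrite /= /G; case: asboolP; [rewrite oner_neq0|move/(_ (nbhs_singleton nA))].
apply: anbhs_sub (hol_neq0 hG Gx) => y; rewrite /= /G; case: asboolP => //.
by rewrite eqxx.
Qed.

(** Morphisms are tested on regular functions. Among these are the chart coordinates at [f x], and a
    holomorphic function is a holomorphic function of the coordinates. *)
Lemma morphism_hol U f x g : morphism_on U f -> U x -> hol_at g (f x) ->
  hol_at (g \o f) x.
Proof.
move=> mf Ux hg; have [j dj] := var_cover hV (f x); have [G nG] := hg j dj.
pose phi y := crd j (f y).
have hphi k : hol_at (fun y => phi y 0 k) x.
  apply: (regular_hol); exact: (mf x Ux _ (var_compat hV k dj)).
have hd : anbhs x [set y | dom j (f y)].
  have ri : regular_at (ind (dom j) \o f) x.
    by apply: (mf x Ux); apply: regular_ind => //; exact: (var_dom_open hV).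
  have ix : (ind (dom j) \o f) x != 0 by rewrite /= ind_in// oner_neq0.
  by apply: anbhs_sub (hol_neq0 (regular_hol ri) ix) => y /ind_neq0.
have hG : hol_at (G \o phi) x.
  by apply: (hol_compose hV hphi); apply: filterS nG => z [].
apply: (hol_germ hG); apply: anbhs_sub (anbhsI hd (hol_preimage hphi nG)) => y [dy [_ gy]] /=.
by rewrite (gy _ dy erefl).
Qed.

Lemma morphism_anbhs U f x O : morphism_on U f -> U x -> anbhs (f x) O ->
  anbhs x [set y | O (f y)].
Proof.
move=> mf Ux nO; have h := morphism_hol mf Ux (hol_ind nO).
have ix : (ind O \o f) x != 0 by rewrite /= ind_in ?oner_neq0//; exact: (anbhs_in hV).
by apply: anbhs_sub (hol_neq0 h ix) => y /ind_neq0.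
Qed.

Lemma zopen_preimage U f O : zopen U -> morphism_on U f -> zopen O ->
  zopen (U `&` [set x | O (f x)]).
Proof.
move=> zU mf zO x [Ux Ofx]; have [ex _] := zU x Ux; split => // i dx.
have [_ /(_ i dx)[Q [Q0 hQ]]] := zU x Ux.
have rg : reg_chart i (ind O \o f) x by apply: (mf x Ux) dx; exact: regular_ind.
have g0 : (ind O \o f) x != 0 by rewrite /= ind_in ?oner_neq0.
have [Q' [Q'0 hQ']] := reg_neq0 dx rg g0.
exists (Q * Q'); rewrite pevalM; split; first exact: mulf_neq0.
move=> y dy; rewrite pevalM mulf_eq0 negb_or => /andP[q q']; split; first exact: hQ.
exact: ind_neq0 (hQ' y dy q').
Qed.

Lemma holmap_morphism (E : normedModType C) (s : E -> V) z U f : morphism_on U f ->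
  U (s z) -> holmap_at s z -> holmap_at (f \o s) z.
Proof. by move=> mf Us hs g hg; apply: hs (morphism_hol mf Us hg). Qed.

Lemma pushforward_tangent U f x u : morphism_on U f -> U x -> tangent x u ->
  tangent (f x) (Defs.pushforward f x u).
Proof.
move=> mf Ux [gam [g0 hgam ->]]; exists (f \o gam); split.
- by rewrite /= g0.
- by have Ug : U (gam 0) by [rewrite g0]; exact: (holmap_morphism mf Ug hgam).
apply: on_germs_ext => g hg; rewrite on_germsT//.
exact: morphism_hol mf Ux hg.
Qed.

Lemma pushforwardE f x u g : hol_at g (f x) -> Defs.pushforward f x u g = u (g \o f).
Proof. exact: on_germsT. Qed.

Lemma generic_near (P : V -> Prop) x O : generic P -> anbhs x O -> exists y, O y /\ P y.
Proof.
move=> [U [zU U0 hU]] nO; have [y [Oy Uy]] := zopen_dense hV nO zU U0.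
by exists y; split; last exact: hU.
Qed.

Lemma generic_true : generic (fun _ : V => True).
Proof.
have [[x _] _] := var_irreducible hV; have [i dx] := var_cover hV x.
by exists (dom i); split => //; [exact: (var_dom_open hV)|exists x].
Qed.

Lemma generic_and (P P' : V -> Prop) : generic P -> generic P' -> generic (fun x => P x /\ P' x).
Proof. exact: genericI (var_irreducible hV). Qed.

Lemma generic_all (I : finType) (P : I -> V -> Prop) :
  (forall k, generic (P k)) -> generic (fun x => forall k, P k x).
Proof. exact: generic_forall (var_irreducible hV) generic_true. Qed.

Lemma generic_sub (P P' : V -> Prop) : (forall x, P x -> P' x) -> generic P -> generic P'.
Proof. by move=> PP' [U [zU U0 hU]]; exists U; split => // x /hU /PP'. Qed.

Lemma generic_anbhs (P : V -> Prop) : generic P -> generic (fun x => anbhs x P).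
Proof.
move=> [U [zU U0 hU]]; exists U; split => // x Ux.
exact: anbhs_sub (zopen_anbhs zU Ux).
Qed.

End Morphisms.

(** * Symplectic gradients of first integrals are invariant *)

Section Forms.
Variables (R : realType) (V : atlas (cplx R)) (m : nat).
Local Notation C := (cplx R).
Hypothesis hV : smooth_irreducible_variety V m.
Variable w : form2 V.
Hypothesis hw : holomorphic_form w.
Implicit Types (x y : V) (u v : tvec V).

Lemma tangent0 x : tangent x ((fun=> 0) : tvec V).
Proof.
have [U [r [s [lc Ux _]]]] := coords_exist hV (@anbhsT _ _ x).
have t0 := tangent_coord_vec lc 0 Ux.
have -> : ((fun=> 0) : tvec V) = (fun g => -1 * coord_vec r s x 0 g + coord_vec r s x 0 g).
  by apply/funext => g; rewrite mulN1r addNr.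
exact: (tangent_lin hV).
Qed.

Lemma form0 x t : tangent x t -> w x (fun=> 0) t = 0.
Proof.
move=> tt; have t0 := tangent0 x.
have := form_linear hw (-1) t0 t0 tt.
have -> : (fun g : V -> C => -1 * 0 + 0) = (fun=> 0 : C) by apply/funext => g; rewrite mulr0 addr0.
by rewrite mulN1r addNr.
Qed.

Lemma tangent_sumZ x I (l : seq I) (c : I -> C) (u : I -> tvec V) :
  (forall k, tangent x (u k)) -> tangent x (fun g => \sum_(k <- l) c k * u k g).
Proof.
move=> tu; elim: l => [|k l IH].
  have -> : (fun g : V -> C => \sum_(k <- [::]) c k * u k g) = (fun=> 0).
    by apply/funext => g; rewrite big_nil.
  exact: tangent0.
have -> : (fun g : V -> C => \sum_(k <- k :: l) c k * u k g) =
    (fun g => c k * u k g + \sum_(k <- l) c k * u k g).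
  by apply/funext => g; rewrite big_cons.
exact: (tangent_lin hV).
Qed.

Lemma form_sum x I (l : seq I) (c : I -> C) (u : I -> tvec V) t :
  (forall k, tangent x (u k)) -> tangent x t ->
  w x (fun g => \sum_(k <- l) c k * u k g) t = \sum_(k <- l) c k * w x (u k) t.
Proof.
move=> tu tt; elim: l => [|k l IH].
  have -> : (fun g : V -> C => \sum_(k <- [::]) c k * u k g) = (fun=> 0).
    by apply/funext => g; rewrite big_nil.
  by rewrite big_nil form0.
have -> : (fun g : V -> C => \sum_(k <- k :: l) c k * u k g) =
    (fun g => c k * u k g + \sum_(k <- l) c k * u k g).
  by apply/funext => g; rewrite big_cons.
by rewrite (form_linear hw)// ?IH ?big_cons//; exact: tangent_sumZ.
Qed.

Hypothesis hnd : nondegenerate_form w.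

Lemma nondegenerate_inj x u v : tangent x u -> tangent x v ->
  (forall t, tangent x t -> w x u t = w x v t) -> u = v.
Proof.
move=> tu tv uv; have tD := tangent_lin hV (-1) tv tu.
have E := hnd tD; apply/funext => g.
have := congr1 (fun F : tvec V => F g) (E _); rewrite mulN1r addrC => /(_ _)/subr0_eq; apply.
by move=> t tt; rewrite (form_linear hw)// uv// mulN1r addNr.
Qed.

(** For [v] tangent at [x], w (f_* X, f_* v) = w (X, v) = v H = v (H o f) = (f_* v) H, which is w
    (X, f_* v) at [f x]. As [f] is birational, every vector at [f x] is some f_* v, and
    nondegeneracy concludes. *)
Lemma invariant_gradient f H X : birational f -> preserves f w ->
  first_integral f H -> symplectic_gradient w H X ->
  generic (fun x => forall h, hol_at h (f x) -> X x (h \o f) = X (f x) h).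
Proof.
move=> [U [W [g [[zU zW [x0 Ux0]] [mf mg fU gW]]]]] pf [[U1 [zU1 U10 rH]] gH] [rX gX].
have [UX [zUX UX0 [tX _] _]] := rX.
pose P x := [/\ regular_at H x, tangent x (X x) & forall v, tangent x v -> v H = w x (X x) v].
have gP : generic P.
  have g1 : generic (fun x => regular_at H x) by exists U1.
  have g2 : generic (fun x => tangent x (X x)) by exists UX.
  by apply: generic_sub (generic_and hV g1 (generic_and hV g2 gX)) => x [? [? ?]].
have gU : generic U by exists U; split => //; exists x0.
(* The preimage of a nonempty Zariski open set is nonempty, because [f] maps [U] onto the open set
   [W], which meets it. *)
have gPf : generic (fun x => P (f x)).
  have [S [zO S0 hO]] := gP; exists (U `&` [set x | S (f x)]); split.
  - exact: (zopen_preimage zU mf zO).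
  - have W0 : W !=set0 by exists (f x0); exact: (fU x0 Ux0).1.
    have [_ irr] := var_irreducible hV.
    have [y [Wy Oy]] := irr W S zW zO W0 S0.
    by exists (g y); have [Ug fg] := gW y Wy; split; rewrite /= ?fg.
  - by move=> x [_ /hO].
(* The equality of [H \o f] and [H] is differentiated, so it has to hold on a neighborhood of the
   point. *)
have gA := generic_and hV (generic_and hV gP gPf)
  (generic_and hV gU (generic_and hV pf (generic_anbhs gH))).
refine (generic_sub _ gA) => x [[[rHx tXx gXx] [rHf tXf gXf]] [Ux [pfx nH]]] h hh.
have [Wfx gfx] := fU x Ux.
suff E : Defs.pushforward f x (X x) = X (f x) by rewrite -E pushforwardE.
apply: (nondegenerate_inj (pushforward_tangent hV mf Ux tXx) tXf) => t tt.
have Wg : U (g (f x)) by rewrite gfx.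
pose v := Defs.pushforward g (f x) t.
have tv : tangent x v by rewrite -[x in tangent x]gfx; exact: (pushforward_tangent hV mg Wfx tt).
have vE : Defs.pushforward f x v = t.
  apply/funext => k; have [hk|hk] := pselect (hol_at k (f x)); last first.
    by rewrite /Defs.pushforward on_germsF// (tangent_nonhol tt).
  have hkf : hol_at (k \o f) x by exact: (morphism_hol hV mf Ux).
  rewrite pushforwardE// /v pushforwardE ?gfx//.
  apply: (tangent_germ hV tt).
  by apply: anbhs_sub (zopen_anbhs zW Wfx) => y /gW[_ /= ->].
rewrite -vE pfx// -gXf ?vE// -gXx// -vE pushforwardE; last exact: regular_hol.
by apply: esym; apply: (tangent_germ hV tv).
Qed.

End Forms.

(** * Frames and their jets of order 1 *)

Section MultiIndexPowers.
Variables (m : nat) (T : Type) (op : 'I_m -> T -> T).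

Lemma multipower0 F : multipower op (@mnm0 m) F = F.
Proof.
rewrite /multipower; elim: (enum _) => //= j l IH.
by rewrite mnm0E.
Qed.

Lemma multipower1 a F : multipower op (mnm1 a) F = op a F.
Proof.
rewrite /multipower; have : uniq (enum 'I_m) by exact: enum_uniq.
have : a \in enum 'I_m by rewrite mem_enum.
have out l : a \notin l -> foldr (fun j => iter (mnm1 a j) (op j)) F l = F.
  elim: l => //= j l IH; rewrite inE negb_or => /andP[aj al].
  by rewrite mnm1E (negPf aj) /= IH.
elim: (enum _) => //= j l IH; rewrite inE mnm1E.
have [<-|aj] := eqVneq a j; first by move=> _ /andP[al _]; rewrite /= out.
by move=> al /andP[_ ul]; rewrite /= IH.
Qed.

Lemma mdeg0_lt2 : (mdeg (@mnm0 m) < 2)%N.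
Proof. by rewrite mdeg0. Qed.

(** The bound of [bmultinom] is strict: 2 means order at most 1, and [bzero] and the [bunit a] are
    all such multi-indices. *)
Definition bzero : bmultinom m 2 := @BMultinom m 2 (@mnm0 m) mdeg0_lt2.
Definition bunit a : bmultinom m 2 := @BMultinom m 2 (mnm1 a) (eq_leq (congr1 S (@mdeg1 m a))).

Lemma bm_ind (P : bmultinom m 2 -> Prop) : P bzero -> (forall a, P (bunit a)) -> forall al, P al.
Proof.
move=> P0 P1 al; have := valP al; rewrite /= ltnS leq_eqVlt ltnS leqn0 => /orP[/eqP h|/eqP h].
  have /existsP[a /eqP E] : [exists a, bmnm al == mnm1 a] by rewrite -mdeg_eq1 h.
  by have -> : al = bunit a by apply: val_inj.
have /eqP E : bmnm al == @mnm0 m by rewrite -mdeg_eq0 h.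
by have -> : al = bzero by apply: val_inj.
Qed.

Lemma sum_bm (S : nmodType) (G : bmultinom m 2 -> S) :
  \sum_al G al = G bzero + \sum_a G (bunit a).
Proof.
rewrite (bigD1 bzero)//=; congr (_ + _).
have inj : injective bunit by move=> a b /(congr1 val)/= /mnmP/(_ a); rewrite !mnm1E eqxx; case: eqVneq.
rewrite -[RHS](big_imset (A := 'I_m) G (in2W inj)) /=; apply: eq_bigl => al.
apply/idP/imsetP => [|[a _ ->]]; last by rewrite -val_eqE /= mnm1_eq0.
by move: al; apply: bm_ind => [|a _]; [rewrite eqxx|exists a].
Qed.

End MultiIndexPowers.

Section DerivativeOfComposite.
Variable R : realType.
Local Notation C := (cplx R).

Lemma derive_comp N (E : normedModType C) (phi : E -> 'rV[C]_N) (G : 'rV[C]_N -> C) (z w : E) :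
  (forall k, differentiable (fun y => phi y 0 k : C) z) -> differentiable G (phi z) ->
  'D_w (G \o phi) z = \sum_k 'D_(delta_mx 0 k) G (phi z) * 'D_w (fun y => phi y 0 k : C) z.
Proof.
move=> dphi dG; have dP : differentiable phi z by exact: (differentiable_row dphi).1.
have dGP : differentiable (G \o phi) z by exact: (differentiable_comp dP dG).
have [_ <-] := chain_line w dGP; pose gam (t : C) := phi (z + t *: w).
have g0 : gam 0 = phi z by rewrite /gam scale0r addr0.
have dgam k : differentiable (fun t : C => gam t 0 k : C) 0 by exact: (chain_line w (dphi k)).1.
have dG0 : differentiable G (gam 0) by rewrite g0.
have [_ E1] := chain_curve dG0 dgam.
rewrite -[LHS]/('D_1 (G \o gam) 0) E1 g0; apply: eq_bigr => k _.
by have [_ <-] := chain_line w (dphi k).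
Qed.

End DerivativeOfComposite.

(** * Tangent vectors in the frame given by an invertible germ *)

Section Germs.
Variables (R : realType) (V : atlas (cplx R)) (m : nat).
Local Notation C := (cplx R).
Hypothesis hV : smooth_irreducible_variety V m.
Implicit Types (g h : V -> C) (i : chart V) (x y : V) (r s : 'rV[C]_m -> V).

Definition inverse_germ r (t : V -> 'rV[C]_m) :=
  [/\ forall k, hol_at (fun x => t x 0 k) (r 0),
      \forall z \near (0 : 'rV[C]_m), t (r z) = z
    & anbhs (r 0) [set x | r (t x) = x]].

Lemma germ_diff r g : holmap_at r 0 -> hol_at g (r 0) -> differentiable (g \o r : 'rV[C]_m -> C) 0.
Proof. by move=> hr hg; exact: nbhs_singleton (hr g hg). Qed.

Lemma tangent_germ_coord r t u g : holmap_at r 0 -> inverse_germ r t -> tangent (r 0) u ->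
  hol_at g (r 0) ->
  u g = \sum_k u (fun y => t y 0 k) * 'D_(delta_mx 0 k) (g \o r : 'rV[C]_m -> C) 0.
Proof.
move=> hr [ht tr rt] [gam [g0 hgam uE]] hg; rewrite {1}uE on_germsT//.
have t0 : t (r 0) = 0 by exact: nbhs_singleton tr.
have nU : \forall tau \near (0 : C), r (t (gam tau)) = gam tau.
  have rt' := rt; rewrite -g0 in rt'; exact: (holmap_near hV hgam rt').
have dk k : differentiable (fun tau : C => (t \o gam) tau 0 k : C) 0.
  by have hk := ht k; rewrite -g0 in hk; exact: nbhs_singleton (hgam _ hk).
have dG : differentiable (g \o r : 'rV[C]_m -> C) ((t \o gam) 0).
  by rewrite /= g0 t0; exact: germ_diff.
have [dc ec] := chain_curve dG dk.
have e : \forall tau \near (0 : C), ((g \o r) \o (t \o gam)) tau = (g \o gam) tau.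
  by apply: filterS nU => tau /= ->.
rewrite (near_derive (1 : C) e dc).
rewrite ec; apply: eq_bigr => k _; rewrite mulrC /= g0 t0; congr (_ * _).
by rewrite uE on_germsT.
Qed.

Definition jacobian i r : 'M[C]_(m, adim i) :=
  \matrix_(a, l) 'D_(delta_mx 0 a) (fun z : 'rV[C]_m => crd i (r z) 0 l : C) 0.

Lemma hol_crd i x k : dom i x -> hol_at (fun y => crd i y 0 k) x.
Proof. by move=> dx; apply: regular_hol; exact: (var_compat hV). Qed.

(** The chain rule for [t (r z) = z], with [t] read in the chart. A chart may have more than [m]
    coordinates, so the inverse is one-sided. *)
Lemma jacobian_inverse i r t : holmap_at r 0 -> inverse_germ r t -> dom i (r 0) ->
  exists M : 'M[C]_(adim i, m), jacobian i r *m M = 1%:M.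
Proof.
move=> hr [ht tr rt] dx.
have ex k : exists T : 'rV[C]_(adim i) -> C, \forall v \near crd i (r 0), differentiable T v /\
    forall y, dom i y -> crd i y = v -> t y 0 k = T v by exact: ht k i dx.
have [T hT] := choice ex; have nT := near_all hT.
exists (\matrix_(l, k) 'D_(delta_mx 0 l) (T k) (crd i (r 0))).
pose phi (z : 'rV[C]_m) := crd i (r z).
have dphi l : differentiable (fun z => phi z 0 l : C) 0 by exact: (germ_diff hr (hol_crd l dx)).
apply/matrixP => a k; rewrite !mxE.
have dT : differentiable (T k) (phi 0) by have [] := nbhs_singleton nT k.
under eq_bigr => l _ do rewrite !mxE mulrC.
rewrite -(derive_comp (delta_mx 0 a) dphi dT).
have n1 : \forall z \near (0 : 'rV[C]_m), dom i (r z).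
  by apply: (holmap_near hV hr); apply: zopen_anbhs => //; exact: (var_dom_open hV).
have c : {for (0 : 'rV[C]_m), continuous phi}.
  by apply: differentiable_continuous; exact: (differentiable_row dphi).1.
have n2 := c _ nT.
have dc : differentiable (fun z : 'rV[C]_m => z 0 k : C) 0 by exact: differentiable_coord.
have e : \forall z \near (0 : 'rV[C]_m), (z : 'rV[C]_m) 0 k = (T k \o phi) z.
  apply: filterS3 n1 n2 tr => z dz hz tz.
  by have [_ /(_ _ dz erefl)] := hz k; rewrite tz.
rewrite (near_derive _ e dc) (dd_derive _ dc).
have [dp hp] := poly_diff (mpolyX C (mnm1 k)) (0 : 'rV[C]_m).
have e' : \forall z \near (0 : 'rV[C]_m), peval (mpolyX C (mnm1 k)) z = (z : 'rV[C]_m) 0 k.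
  by apply: filterE => z; rewrite pevalX.
by rewrite (near_dd e' dp).2 hp gradX mxE eqxx eq_sym.
Qed.

End Germs.

Section RegularMatrices.
Variables (C : numClosedFieldType) (V : atlas C) (i : chart V) (x : V).

Lemma reg_prod I (l : seq I) (F : I -> V -> C) :
  (forall k, reg_chart i (F k) x) -> reg_chart i (fun y => \prod_(k <- l) F k y) x.
Proof.
move=> hF; elim: l => [|k l IH].
  have -> : (fun y => \prod_(k <- [::]) F k y) = (fun=> 1) by apply/funext => y; rewrite big_nil.
  exact: reg_cst.
have -> : (fun y => \prod_(k <- k :: l) F k y) = (fun y => F k y * \prod_(k <- l) F k y).
  by apply/funext => y; rewrite big_cons.
exact: reg_mul.
Qed.

Definition reg_mx n p (A : V -> 'M[C]_(n, p)) :=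
  forall a b, reg_chart i (fun y => A y a b) x.

Lemma reg_mulmx n p q (A : V -> 'M[C]_(n, p)) (B : V -> 'M[C]_(p, q)) :
  reg_mx A -> reg_mx B -> reg_mx (fun y => A y *m B y).
Proof.
move=> rA rB a b.
have -> : (fun y => (A y *m B y) a b) = (fun y => \sum_k A y a k * B y k b).
  by apply/funext => y; rewrite mxE.
by apply: reg_sum => k; apply: reg_mul; [exact: rA|exact: rB].
Qed.

Lemma reg_det n (A : V -> 'M[C]_n) : reg_mx A -> reg_chart i (fun y => \det (A y)) x.
Proof.
move=> rA; apply: reg_sum => k; apply: reg_mul; first exact: reg_cst.
by apply: reg_prod => a; exact: rA.
Qed.

Lemma reg_adj n (A : V -> 'M[C]_n) : reg_mx A -> reg_mx (fun y => \adj (A y)).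
Proof.
move=> rA a b.
have -> : (fun y => (\adj (A y)) a b) =
    (fun y => (-1) ^+ (b + a) * \det (row' b (col' a (A y)))).
  by apply/funext => y; rewrite mxE.
apply: reg_mul; first exact: reg_cst.
apply: (reg_det (A := fun y => row' b (col' a (A y)))) => c d.
have -> : (fun y => row' b (col' a (A y)) c d) = (fun y => A y (lift b c) (lift a d)).
  by apply/funext => y; rewrite !mxE.
exact: rA.
Qed.

End RegularMatrices.

(** * Functions on the bundle of first order jets *)

Section FirstOrderJets.
Variables (R : realType) (V : atlas (cplx R)) (m : nat).
Local Notation C := (cplx R).
Hypothesis hV : smooth_irreducible_variety V m.
Local Notation FB := (frame_bundle V m 1).
Implicit Types (g h : V -> C) (i : chart V) (x y : V) (r s : 'rV[C]_m -> V) (J : FB).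

Lemma jet_self r : invertible_germ r -> jet 1 r r.
Proof. by move=> ir; split. Qed.

Lemma same_jet_jacobian i r s : same_jet 1 r s -> dom i (r 0) ->
  jacobian i r = jacobian i s.
Proof.
move=> [_ h] dx; apply/matrixP => a l; rewrite [LHS]mxE [RHS]mxE.
have := h i dx l (mnm1 a); rewrite mdeg1 => /(_ (leqnn _)).
by rewrite /partial !multipower1.
Qed.

(** A jet is a class of germs, so a function on jets is given by a relation between representatives
    and values. The default [c0] is irrelevant once [jet_valueE] applies, which asks for
    independence of the representative. *)
Definition jet_value (T : choiceType) (c0 : T) (P : ('rV[C]_m -> V) -> set T) : FB -> T :=
  fun J => xget c0 [set c | exists2 r, (J : set ('rV[C]_m -> V)) r & P r c].

Lemma jet_valueE (T : choiceType) (c0 : T) P r c : invertible_germ r -> P r c ->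
  (forall s c', invertible_germ s -> same_jet 1 r s -> P s c' -> c' = c) ->
  jet_value c0 P (jet 1 r) = c.
Proof.
move=> ir Prc uc; apply: xget_unique; first by exists r => //; exact: jet_self.
by move=> c' [s [is_ rs]]; exact: uc.
Qed.

Lemma crd_jet i r : invertible_germ r -> dom i (r 0) ->
  crd (a := FB) i (jet 1 r) = \row_k jet_entry (i := i) r (enum_val k).
Proof.
move=> ir dx; apply: xget_unique; first by exists r => //; exact: jet_self.
move=> c' [s [is_ [_ rs]] ->]; apply/rowP => k; rewrite !mxE /jet_entry.
by rewrite (rs i dx)// -ltnS bmdeg.
Qed.

Definition fpoint i J : 'rV[C]_(adim i) :=
  \row_l crd (a := FB) i J 0 (enum_rank (l, bzero m)).

Definition fjac i J : 'M[C]_(m, adim i) :=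
  \matrix_(a, l) crd (a := FB) i J 0 (enum_rank (l, bunit a)).

Lemma fpointE i r : invertible_germ r -> dom i (r 0) -> fpoint i (jet 1 r) = crd i (r 0).
Proof.
move=> ir dx; apply/rowP => l; rewrite mxE crd_jet// mxE enum_rankK /jet_entry /partial /=.
by rewrite multipower0.
Qed.

Lemma fjacE i r : invertible_germ r -> dom i (r 0) -> fjac i (jet 1 r) = jacobian i r.
Proof.
move=> ir dx; apply/matrixP => a l; rewrite mxE crd_jet// !mxE enum_rankK /jet_entry /partial /=.
by rewrite multipower1.
Qed.

Lemma reg_fpoint i J l : reg_chart (V := FB) i (fun J => fpoint i J 0 l) J.
Proof.
have -> : (fun J => fpoint i J 0 l) = (fun J => crd (a := FB) i J 0 (enum_rank (l, bzero m))).
  by apply/funext => J'; rewrite mxE.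
exact: reg_coord.
Qed.

Lemma reg_fjac i J a l : reg_chart (V := FB) i (fun J => fjac i J a l) J.
Proof.
have -> : (fun J => fjac i J a l) = (fun J => crd (a := FB) i J 0 (enum_rank (l, bunit a))).
  by apply/funext => J'; rewrite mxE.
exact: reg_coord.
Qed.

Lemma reg_fpoint_poly i J (P : mpoly (adim i) C) :
  reg_chart (V := FB) i (fun J => peval P (fpoint i J)) J.
Proof.
have -> : (fun J => peval P (fpoint i J)) = (fun J => peval P (\row_l fpoint i J 0 l)).
  by apply/funext => J'; congr peval; apply/rowP => l; rewrite mxE.
exact: (reg_poly (V := FB) P (fun l => reg_fpoint (i := i) J l)).
Qed.

Lemma invertible_affine U (c : V -> 'rV[C]_m) s b (L : 'M[C]_m) : local_coordinates U c s ->
  (c @` U) b -> L \in unitmx -> invertible_germ (fun z => s (b + z *m L)).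
Proof.
move=> lc Ub uL; have [Us cs] := lc_rs lc Ub.
have s0 : s (b + 0 *m L) = s b by rewrite mul0mx addr0.
have dL (N : 'M[C]_m) (v : 'rV[C]_m) : differentiable (fun z : 'rV[C]_m => z *m N) v.
  have [e _ he] := mulmx_bound N.
  pose F : {linear 'rV[C]_m -> 'rV[C]_m} := mulmxr N.
  apply: (@linear_differentiable _ _ _ F v).
  exact: (@bounded_linear_cont _ _ _ F e).
have dA v : differentiable (fun z : 'rV[C]_m => b + z *m L) v.
  exact: (@differentiableD _ _ _ (fun=> b) (fun z : 'rV[C]_m => z *m L) v (differentiable_cst b v) (dL L v)).
have cA (P : set 'rV[C]_m) : nbhs b P -> \forall z \near (0 : 'rV[C]_m), P (b + z *m L).
  move=> nP; have c0 : {for (0 : 'rV[C]_m), continuous (fun z : 'rV[C]_m => b + z *m L)}.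
    exact: differentiable_continuous.
  by apply: (c0 P); rewrite mul0mx addr0.
have nb : nbhs b (c @` U) by have := lc_near lc Us; rewrite cs.
split.
  move=> g; rewrite s0 => hg; have := hol_comp lc Us hg; rewrite cs => /cA.
  by apply: filterS => z dz; exact: (differentiable_comp (dA z) dz).
exists (fun y => (c y - b) *m invmx L); split.
- move=> k; rewrite s0.
  have -> : (fun y => ((c y - b) *m invmx L) 0 k) =
      (fun y => \sum_l (c y 0 l + - b 0 l) * invmx L l k).
    by apply/funext => y; rewrite mxE; apply: eq_bigr => l _; rewrite !mxE.
  apply: hol_sum => l; apply: hol_mul; last exact: hol_cst.
  by apply: hol_add; [exact: (lc_hol lc)|exact: hol_cst].
- apply: filterS (cA _ nb) => z /(lc_rs lc)[_ ->].
  by rewrite addrC addKr mulmxK.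
rewrite s0; apply: anbhs_sub (lc_open lc Us) => y Uy /=.
by rewrite mulmxKV// addrC subrK (lc_sr lc).
Qed.

Definition base_value g : FB -> C := jet_value 0 (fun r c => c = g (r 0)).

Lemma base_valueE g r : invertible_germ r -> base_value g (jet 1 r) = g (r 0).
Proof.
by move=> ir; apply: jet_valueE => // s c' _ [-> _] ->.
Qed.

Lemma reg_base_value i g r : invertible_germ r -> dom i (r 0) -> regular_at g (r 0) ->
  reg_chart (V := FB) i (base_value g) (jet 1 r).
Proof.
move=> ir dx /(_ i dx)[P [Q [Qx gE]]].
have dJ : dom (a := FB) i (jet 1 r) by exists r.
pose q J := peval Q (fpoint i J).
have rq : reg_chart (V := FB) i q (jet 1 r) by exact: reg_fpoint_poly.
have q0 : q (jet 1 r) != 0 by rewrite /q fpointE.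
have [Q0 [Q0J hQ0]] := reg_neq0 dJ rq q0.
have rpq : reg_chart (V := FB) i (fun J => peval P (fpoint i J) * (q J)^-1) (jet 1 r).
  by apply: reg_mul; [exact: reg_fpoint_poly|exact: reg_inv].
apply: (reg_local (Q0 := Q0) Q0J _ rpq) => J [s [is_ ds ->]] Q0s.
have dJs : dom (a := FB) i (jet 1 s) by exists s.
have := hQ0 _ dJs Q0s; rewrite /q fpointE// => qs.
by rewrite base_valueE// (gE _ ds qs).
Qed.

Definition jets_above (O : set V) : set FB :=
  [set J | exists r, [/\ invertible_germ r, O (r 0) & J = jet 1 r]].

Lemma zopen_jets_above O : zopen O -> zopen (jets_above O).
Proof.
move=> zO J [r [ir Or ->]]; have [[i0 d0] _] := zO _ Or; split; first by exists i0, r.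
move=> i [s [is_ ds E]].
have srj : jet 1 s r by rewrite -E; exact: jet_self.
have dx : dom (a := V) i (r 0) by have [_ [<- _]] := srj.
have rb := reg_base_value ir dx (regular_ind zO Or).
have dJ : dom (a := FB) i (jet 1 r) by exists r.
have b0 : base_value (ind O) (jet 1 r) != 0 by rewrite base_valueE// ind_in ?oner_neq0.
have [Q [Q0 hQ]] := reg_neq0 dJ rb b0; exists Q; split => // J' dJ' QJ'.
have := hQ J' dJ' QJ'; have [r' [ir' dr' ->]] := dJ'.
by rewrite base_valueE// => /ind_neq0 Or'; exists r'.
Qed.

Lemma jets_above_neq0 O : O !=set0 -> jets_above O !=set0.
Proof.
move=> [x Ox]; have [U [c [s [lc Ux _]]]] := coords_exist hV (@anbhsT _ _ x).
have Ucx : (c @` U) (c x) by exists x.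
have ir := invertible_affine lc Ucx (unitmx1 _ m).
exists (jet 1 (fun z => s (c x + z *m 1%:M))), (fun z => s (c x + z *m 1%:M)); split => //.
by rewrite mul0mx addr0 (lc_sr lc).
Qed.

Lemma generic_jets (P : FB -> Prop) (P' : V -> Prop) : generic P' ->
  (forall r, invertible_germ r -> P' (r 0) -> P (jet 1 r)) -> generic P.
Proof.
move=> [S [zO S0 hO]] h; exists (jets_above S); split.
- exact: zopen_jets_above.
- exact: jets_above_neq0.
- by move=> J [r [ir Or ->]]; apply: h => //; exact: hO.
Qed.

(** [a] consists of the components of [X] at [r 0] in the frame formed by the derivatives of [r] at
    0. *)
Definition is_coeff (X : vfield V) r (a : 'rV[C]_m) := forall h, hol_at h (r 0) ->
  X (r 0) h = \sum_k a 0 k * 'D_(delta_mx 0 k) (h \o r : 'rV[C]_m -> C) 0.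

Lemma coeff_jacobian X i r a : dom i (r 0) -> is_coeff X r a ->
  a *m jacobian i r = \row_l X (r 0) (fun y => crd i y 0 l).
Proof.
move=> dx ha; apply/rowP => l; rewrite [LHS]mxE [RHS]mxE (ha _ (hol_crd hV l dx)).
by apply: eq_bigr => k _; rewrite mxE.
Qed.

Lemma coeff_exists X r : invertible_germ r -> tangent (r 0) (X (r 0)) ->
  exists a, is_coeff X r a.
Proof.
move=> [hr [t it]] tX; exists (\row_k X (r 0) (fun y => t y 0 k)) => h hh.
by rewrite (tangent_germ_coord hV hr it tX hh); apply: eq_bigr => k _; rewrite mxE.
Qed.

Definition frame_coef (X : vfield V) : FB -> 'rV[C]_m := jet_value 0 (is_coeff X).

(** Uniqueness: [a] times the Jacobian of [r] is the vector of chart components of [X], and the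
    Jacobian has a right inverse and depends on the 1-jet only. *)
Lemma frame_coefE X r a : invertible_germ r -> is_coeff X r a ->
  frame_coef X (jet 1 r) = a.
Proof.
move=> ir ha; apply: jet_valueE => // s b is_ rs hb.
have [i dx] := var_cover hV (r 0); have dxs : dom i (s 0) by case: rs => <-.
have [hr [t it]] := ir; have [M JM] := jacobian_inverse hV hr it dx.
have Ea := coeff_jacobian dx ha; have Eb := coeff_jacobian dxs hb.
rewrite -(same_jet_jacobian rs dx) -(proj1 rs) -Ea in Eb.
by have := congr1 (mulmx^~ M) Eb; rewrite /= -!mulmxA JM !mulmx1.
Qed.

(* Cramer's rule, in the coordinates selected by a left inverse [M] of the
   Jacobian at the given jet. *)
Lemma reg_frame_coef S X i r k : zopen S -> (forall x, S x -> tangent x (X x)) ->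
  (forall x g, S x -> regular_at g x -> regular_at (fun y => X y g) x) ->
  invertible_germ r -> S (r 0) -> dom i (r 0) ->
  reg_chart (V := FB) i (fun J => frame_coef X J 0 k) (jet 1 r).
Proof.
move=> zS tX rX ir Sr dx; have [hr [t it]] := ir.
have [M JM] := jacobian_inverse hV hr it dx.
have dJ : dom (a := FB) i (jet 1 r) by exists r.
pose A J := fjac i J *m M.
pose xi J : 'rV[C]_(adim i) := \row_l base_value (fun y => X y (fun y' => crd i y' 0 l)) J.
have rM : reg_mx (V := FB) i (jet 1 r) (fun _ => M) by move=> a b; exact: reg_cst.
have rA : reg_mx (V := FB) i (jet 1 r) A.
  by apply: reg_mulmx rM => a b; exact: reg_fjac.
have rxi : reg_mx (V := FB) i (jet 1 r) xi.
  move=> a l.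
  have -> : (fun J => xi J a l) = base_value (fun y => X y (fun y' => crd i y' 0 l)).
    by apply/funext => J; rewrite mxE.
  by apply: reg_base_value => //; apply: rX => //; exact: (var_compat hV).
have rD := reg_det rA.
have D0 : \det (A (jet 1 r)) != 0 by rewrite /A fjacE// JM det1 oner_neq0.
have [Q0 [Q0J hQ0]] := reg_neq0 dJ rD D0.
have b0 : base_value (ind S) (jet 1 r) != 0 by rewrite base_valueE// ind_in ?oner_neq0.
have [Q1 [Q1J hQ1]] := reg_neq0 dJ (reg_base_value ir dx (regular_ind zS Sr)) b0.
have rN := reg_mulmx (reg_mulmx rxi rM) (reg_adj rA).
have rNk := reg_mul (rN 0 k) (reg_inv dJ rD D0).
have Q01 : peval (Q0 * Q1) (crd (a := FB) i (jet 1 r)) != 0 by rewrite pevalM mulf_neq0.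
apply: (reg_local Q01 _ rNk) => J dJ'; rewrite pevalM mulf_eq0 negb_or => /andP[q0 q1].
have := hQ0 J dJ' q0; have := hQ1 J dJ' q1; have [s [is_ ds ->]] := dJ'.
rewrite base_valueE// => /ind_neq0 Ss Ds.
have [a ha] := coeff_exists is_ (tX _ Ss); rewrite (frame_coefE is_ ha).
have E : xi (jet 1 s) *m M = a *m A (jet 1 s).
  rewrite /A mulmxA fjacE// (coeff_jacobian ds ha); congr (_ *m _).
  by apply/rowP => l; rewrite !mxE base_valueE.
by rewrite E -mulmxA mul_mx_adj mul_mx_scalar mxE mulrAC divff ?mul1r.
Qed.

End FirstOrderJets.

(** * Differential invariants of order 1 *)

Lemma mnm1_eqE m (a b : 'I_m) : (mnm1 a == mnm1 b) = (a == b).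
Proof.
apply/eqP/eqP => [/mnmP/(_ a)|-> //]; rewrite !mnm1E eqxx.
by case: eqVneq.
Qed.

Section Lines.
Variable R : realType.
Local Notation C := (cplx R).

Lemma line_near (E : normedModType C) (z v : E) (P : E -> Prop) : (\forall y \near z, P y) ->
  \forall t \near (0 : C), P (z + t *: v).
Proof.
move=> /nearN[d d0 hd]; apply: (proj2 (@nearN R C _ 0)); exists (d / (nrm v + 1)).
  by rewrite divr_gt0// ltr_wpDl ?nrm_ge0.
move=> t; rewrite subr0 ltr_pdivlMr ?ltr_wpDl ?nrm_ge0// => td.
apply: hd; rewrite addrAC subrr add0r nrmZ; apply: le_lt_trans td.
by rewrite ler_wpM2l ?nrm_ge0// lerDl.
Qed.

(** [1 + t * d%:R] is the determinant of the elementary matrix [1%:M + t *: delta_mx a i], where [d]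
    tells whether [a] and [i] coincide. *)
Lemma near_1D (d : bool) : \forall t \near (0 : C), 1 + t * d%:R != 0.
Proof.
apply: (proj2 (@nearN R C _ 0)); exists 1 => // t; rewrite subr0 => t1.
case: d; last by rewrite mulr0 addr0 oner_neq0.
rewrite mulr1 addrC addr_eq0; apply/eqP => E; move: t1.
by rewrite E nrmN nrmC ComplexField.Normc.normc1 ltxx.
Qed.

Lemma derive_elementary (d : bool) (u e : C) :
  differentiable (fun t : C => u - t / (1 + t * d%:R) * e) 0 /\
  'D_1 (fun t : C => u - t / (1 + t * d%:R) * e) 0 = - e.
Proof.
have di : differentiable (fun t : C => t) 0 by have [] := @is_diff_id C C 0.
have d1 : differentiable (fun t : C => 1 + t * d%:R) 0.
  have dd : differentiable (fun t : C => t * d%:R) 0.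
    exact: (@differentiableM _ _ (fun t : C => t) (fun=> d%:R) _ di (differentiable_cst _ _)).
  exact: (@differentiableD _ C C (cst (1 : C)) (fun t : C => t * d%:R) 0 (differentiable_cst (1 : C) 0) dd).
have n0 : 1 + 0 * d%:R != 0 :> C by rewrite mul0r addr0 oner_neq0.
have dv : differentiable (fun t : C => (1 + t * d%:R)^-1) 0.
  exact: (@differentiableV _ _ (fun t : C => 1 + t * d%:R) 0 d1 n0).
pose g (t : C) : C := (1 + t * d%:R)^-1 * - e.
have dg : differentiable g 0.
  exact: (@differentiableM _ _ (fun t : C => (1 + t * d%:R)^-1) (fun=> - e) _ dv (differentiable_cst _ _)).
have -> : (fun t : C => u - t / (1 + t * d%:R) * e) = (fun t : C => t * g t + u).
  by apply/funext => t; rewrite /g mulrN mulrN mulrA addrC.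
have dm : differentiable (fun t : C => t * g t) 0.
  exact: (@differentiableM _ _ (fun t : C => t) g).
split; first exact: (@differentiableD _ _ _ (fun t : C => t * g t) (fun=> u) 0 dm (differentiable_cst _ _)).
have -> := @deriveD _ _ _ (fun t : C => t * g t) (fun=> u) 0 1 (diff_derivable dm) (diff_derivable (differentiable_cst u 0)).
rewrite derive_cst addr0.
have -> := @deriveM _ _ (fun t : C => t) g 0 1 (diff_derivable di) (diff_derivable dg).
by rewrite scale0r add0r derive_id /g mul0r addr0 invr1 mul1r [_ *: _]mulr1.
Qed.

(** The Sherman-Morrison formula for a rank one perturbation of the identity. *)
Lemma elementary_inverse m (a i : 'I_m) (t : C) : 1 + t * (i == a)%:R != 0 ->
  (1%:M + t *: delta_mx a i) *m (1%:M - (t / (1 + t * (i == a)%:R)) *: delta_mx a i) = 1%:M.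
Proof.
move=> n0; rewrite mulmxBr mulmx1 mulmxDl mul1mx -scalemxAl -scalemxAr mul_delta_mx_cond.
have -> : delta_mx a i *+ (i == a) = (i == a)%:R *: delta_mx a i :> 'M[C]_m by rewrite scaler_nat.
rewrite !scalerA -scalerDl -addrA -scalerBl.
have -> : t - (t / (1 + t * (i == a)%:R) + t * (t / (1 + t * (i == a)%:R)) * (i == a)%:R) = 0.
  by move: ((i == a)%:R : C) n0 => d n0; field.
by rewrite scale0r addr0.
Qed.

End Lines.

(** * Two families of invariants and their prolonged derivatives *)

Section Invariants.
Variables (R : realType) (V : atlas (cplx R)) (m : nat).
Local Notation C := (cplx R).
Hypothesis hV : smooth_irreducible_variety V m.
Local Notation FB := (frame_bundle V m 1).
Implicit Types (g h H : V -> C) (x y : V) (r s : 'rV[C]_m -> V) (J : FB).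

Lemma same_jet_trans q r s t : same_jet q r s -> same_jet q r t -> same_jet q s t.
Proof.
move=> [rs h] [rt h']; split; first by rewrite -rs.
by move=> i; rewrite -rs => dx k al hal; rewrite -h// h'.
Qed.

Lemma jet_eq q r s : same_jet q r s -> jet q r = jet q s.
Proof.
move=> rs; have sr : same_jet q s r by apply: same_jet_trans rs _; split.
by apply/seteqP; split => t [it rt]; split => //; [exact: same_jet_trans rs rt|exact: same_jet_trans sr rt].
Qed.

Lemma invertible_comp (U W : set V) (f g : V -> V) r : zopen U -> zopen W ->
  morphism_on U f -> morphism_on W g ->
  (forall x, U x -> W (f x) /\ g (f x) = x) -> (forall y, W y -> U (g y) /\ f (g y) = y) ->
  invertible_germ r -> U (r 0) -> invertible_germ (f \o r).
Proof.
move=> zU zW mf mg fU gW [hr [t [ht tr rt]]] Ur; have [Wfr gfr] := fU _ Ur.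
split; first exact: (holmap_morphism hV mf Ur hr).
exists (t \o g); split.
- move=> k; have hk := ht k; rewrite -gfr in hk; exact: (morphism_hol hV mg Wfr hk).
- apply: filterS2 tr (holmap_near hV hr (zopen_anbhs zU Ur)) => z tz Uz /=.
  by rewrite (fU _ Uz).2.
- rewrite -gfr in rt.
  apply: anbhs_sub (anbhsI (zopen_anbhs zW Wfr) (morphism_anbhs hV mg Wfr rt)) => y [Wy /= ->].
  exact: (gW y Wy).2.
Qed.

Lemma invariant_base_value f H : birational f -> first_integral f H ->
  diff_invariant f (base_value (m := m) H) /\
  generic (fun x => forall r, invertible_germ r -> r 0 = x ->
    regular_at (V := FB) (base_value H) (jet 1 r)).
Proof.
move=> [U [W [g [[zU zW U0] [mf mg fU gW]]]]] [rH fH].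
have gU : generic U by exists U.
have reg : generic (fun x => forall r, invertible_germ r -> r 0 = x ->
    regular_at (V := FB) (base_value H) (jet 1 r)).
  refine (generic_sub _ rH) => x rx r ir rE i [s [is_ ds E]].
  have srj : jet 1 s r by rewrite -E; exact: jet_self.
  have dx : dom (a := V) i (r 0) by have [_ [<- _]] := srj.
  by apply: reg_base_value => //; rewrite rE.
split; last exact: reg.
split; first by apply: (generic_jets hV reg) => r ir /(_ r ir erefl).
apply: (generic_jets hV (generic_and hV gU fH)) => r ir [Ur Hr] s [is_ [rs _]].
rewrite rs in Ur Hr.
by rewrite !base_valueE ?rs//; exact: (invertible_comp zU zW mf mg fU gW).
Qed.

Lemma invariant_frame_coef f X k : birational f -> ratvf X ->
  generic (fun x => forall h, hol_at h (f x) -> X x (h \o f) = X (f x) h) ->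
  diff_invariant f (fun J : FB => frame_coef X J 0 k) /\
  generic (fun x => forall r, invertible_germ r -> r 0 = x ->
    regular_at (V := FB) (fun J => frame_coef X J 0 k) (jet 1 r)).
Proof.
move=> [U [W [g [[zU zW U0] [mf mg fU gW]]]]] [S [zS S0 [tX hX] rX]] fX.
have gU : generic U by exists U.
have gS : generic S by exists S.
have reg : generic (fun x => forall r, invertible_germ r -> r 0 = x ->
    regular_at (V := FB) (fun J => frame_coef X J 0 k) (jet 1 r)).
  refine (generic_sub _ gS) => x rx r ir rE i [s [is_ ds E]].
  have srj : jet 1 s r by rewrite -E; exact: jet_self.
  have dx : dom (a := V) i (r 0) by have [_ [<- _]] := srj.
  by apply: (reg_frame_coef hV k zS tX rX) => //; rewrite rE.
split; last exact: reg.
split; first by apply: (generic_jets hV reg) => r ir /(_ r ir erefl).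
apply: (generic_jets hV (generic_and hV gU (generic_and hV gS fX))).
move=> r ir [Ur [Sr Xr]] s [is_ rs]; have ifs : invertible_germ (f \o s).
  by apply: (invertible_comp zU zW mf mg fU gW) => //; rewrite -rs.1.
rewrite rs.1 in Ur Sr Xr.
have [a ha] := coeff_exists hV is_ (tX _ Sr).
have hfa : is_coeff X (f \o s) a.
  move=> h hh /=; rewrite -Xr// ha; last exact: (morphism_hol hV mf Ur hh).
  by apply: eq_bigr.
by rewrite (jet_eq rs) (frame_coefE hV ifs hfa) (frame_coefE hV is_ ha).
Qed.

Lemma taylor1 (rho : jcoord C m) z :
  taylor 1 rho z = base rho + z *m (linear_part rho)^T.
Proof.
apply/rowP => i; rewrite !mxE sum_bm; congr (_ + _).
  by rewrite big1 ?mulr1// => j _; rewrite mnm0E expr0 fact0 divr1.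
apply: eq_bigr => a _; rewrite !mxE mulrC; congr (_ * _).
have bE j : bunit a j = (a == j) :> nat by exact: mnm1E.
rewrite (bigD1 a)//= bE eqxx expr1 divr1 big1 ?mulr1// => j ja.
by rewrite bE eq_sym (negPf ja) expr0 fact0 divr1.
Qed.

(** Recentres the derivative at increment 0 and allows the function to be replaced near it: far from
    the given jet the germs need not be invertible, and [F] has no controlled value there. *)
Lemma djcoord_near (i : 'I_m) al (F : jcoord C m -> C) (rho : jcoord C m) (G : C -> C) : differentiable G 0 ->
  (\forall t \near (0 : C), G t = F (jcoord_upd rho i al (rho i al + t))) ->
  djcoord i al F rho = 'D_1 G 0.
Proof.
move=> dG e; rewrite -(near_derive (1 : C) e dG) /djcoord /derive.
apply: (congr1 (fun F : C -> C => lim (F h @[h --> 0^']))); apply/funext => h /=.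
by rewrite !addr0 [rho i al + _]addrC.
Qed.

Section AtPoint.
Variables (U : set V) (c : V -> 'rV[C]_m) (s : 'rV[C]_m -> V).
Hypothesis lc : local_coordinates U c s.
Variable x : V.
Hypothesis Ux : U x.

(** The jet of the coordinate frame z -> s (c x + z): base point [c x], identity linear part, higher
    entries 0. All prolongations are evaluated at this jet. *)
Definition rho0 : jcoord C m := fun (i : 'I_m) al =>
  if al == @mnm0 m then c x 0 i else (al == mnm1 i)%:R.

Lemma base_rho0 : base rho0 = c x.
Proof. by apply/rowP => i; rewrite mxE /rho0 eqxx. Qed.

Lemma linear_rho0 : linear_part rho0 = 1%:M.
Proof.
apply/matrixP => i j; rewrite !mxE /rho0 mnm1_eq0 eq_sym.
by rewrite mnm1_eqE.
Qed.

Lemma base_upd0 (rho : jcoord C m) (i : 'I_m) t : base (jcoord_upd rho i (@mnm0 m) (rho i (@mnm0 m) + t)) =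
  base rho + t *: delta_mx 0 i.
Proof.
apply/rowP => j; rewrite !mxE /jcoord_upd !eqxx andbT.
by case: eqVneq => [->|_]; rewrite ?mulr1 ?mulr0 ?addr0.
Qed.

Lemma base_upd (rho : jcoord C m) (i : 'I_m) al t : al != @mnm0 m -> base (jcoord_upd rho i al t) = base rho.
Proof.
by move=> al0; apply/rowP => j; rewrite !mxE /jcoord_upd eq_sym [_ == al]eq_sym (negPf al0) andbF.
Qed.

Lemma linear_upd0 (rho : jcoord C m) (i : 'I_m) t : linear_part (jcoord_upd rho i (@mnm0 m) t) = linear_part rho.
Proof. by apply/matrixP => j k; rewrite !mxE /jcoord_upd mnm1_eq0 andbF. Qed.

Lemma linear_upd1 (rho : jcoord C m) (i a : 'I_m) t :
  linear_part (jcoord_upd rho i (mnm1 a) (rho i (mnm1 a) + t)) =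
  linear_part rho + t *: delta_mx i a.
Proof.
apply/matrixP => j k; rewrite !mxE /jcoord_upd mnm1_eqE.
by case: eqVneq => [->|_]; case: eqVneq => [->|_] /=; rewrite ?mulr1 ?mulr0 ?addr0.
Qed.

Definition vcomp (Y : vfield V) (i : 'I_m) : V -> C := fun y => Y y (fun y' => c y' 0 i).

Lemma componentE Y i rho : component c s Y i rho = (vcomp Y i \o s) (base rho).
Proof. by []. Qed.

Lemma djcoord_cst (i : 'I_m) al (F : jcoord C m -> C) (rho : jcoord C m) k :
  (\forall t \near (0 : C), F (jcoord_upd rho i al (rho i al + t)) = k) ->
  djcoord i al F rho = 0.
Proof.
move=> e; rewrite (@djcoord_near i al F rho (fun=> k)); first exact: derive_cst.
- exact: differentiable_cst.
- by apply: filterS e => t ->.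
Qed.

Lemma djcoord_component Y i a : hol_at (vcomp Y i) x ->
  djcoord a (@mnm0 m) (component c s Y i) rho0 =
  'D_(delta_mx 0 a) (vcomp Y i \o s : 'rV[C]_m -> C) (c x).
Proof.
move=> hY; have dY := nbhs_singleton (hol_comp lc Ux hY).
have [dl <-] := chain_line (delta_mx 0 a) dY.
apply: djcoord_near dl _; apply: filterE => t.
by rewrite componentE base_upd0 base_rho0.
Qed.

Lemma total_derivative_component Y i a : hol_at (vcomp Y i) x ->
  total_derivative a (component c s Y i) rho0 =
  'D_(delta_mx 0 a) (vcomp Y i \o s : 'rV[C]_m -> C) (c x).
Proof.
(* [component] depends on the base point only, and the first order entries of [rho0] are those of
   the identity, so only the index [a] with multi-index 0 contributes. *)
move=> hY; rewrite /total_derivative -(fsbig_widen [set (a, @mnm0 m)])//; last first.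
  move=> [j al] /= [_ ne]; have [al0|al0] := eqVneq al (@mnm0 m); last first.
    rewrite (djcoord_cst (k := component c s Y i rho0)) ?mulr0//.
    by apply: filterE => t; rewrite !componentE base_upd.
  rewrite al0 /rho0 add0m mnm1_eq0 mnm1_eqE; have [aj|_] := eqVneq a j; last by rewrite mul0r.
  by case: ne; rewrite al0 aj.
rewrite fsbig_set1 /= djcoord_component// /rho0 add0m mnm1_eq0 eqxx mul1r.
by [].
Qed.

Lemma prolong_rho0 Y (F : FB -> C) : (forall i, hol_at (vcomp Y i) x) ->
  prolong c s Y F rho0 = \sum_i (vcomp Y i x * djcoord i (@mnm0 m) (in_jcoord s F) rho0 +
    \sum_a 'D_(delta_mx 0 a) (vcomp Y i \o s : 'rV[C]_m -> C) (c x) *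
      djcoord i (mnm1 a) (in_jcoord s F) rho0).
Proof.
move=> hY; rewrite /prolong; apply: eq_bigr => i _; rewrite sum_bm.
rewrite [bmnm (bzero m)]/= multipower0 componentE base_rho0 /= (lc_sr lc)//; congr (_ + _).
apply: eq_bigr => a _; rewrite multipower1.
by rewrite total_derivative_component.
Qed.

Lemma in_jcoordE (F : FB -> C) rho :
  in_jcoord s F rho = F (jet 1 (fun z => s (base rho + z *m (linear_part rho)^T))).
Proof.
rewrite /in_jcoord; congr (F (jet 1 _)); apply/funext => z /=.
by rewrite taylor1.
Qed.

Lemma unitmx_near (a i : 'I_m) :
  \forall t \near (0 : C), (1%:M + t *: delta_mx a i : 'M[C]_m) \in unitmx.
Proof.
apply: filterS (near_1D R (i == a)) => t n0.
exact: (mulmx1_unit (elementary_inverse n0)).1.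
Qed.

Lemma in_jcoord_upd0 (F : FB -> C) i t : in_jcoord s F (jcoord_upd rho0 i (@mnm0 m) (rho0 i (@mnm0 m) + t)) =
  F (jet 1 (fun z => s (c x + t *: delta_mx 0 i + z *m 1%:M))).
Proof. by rewrite in_jcoordE base_upd0 linear_upd0 base_rho0 linear_rho0 trmx1. Qed.

Lemma in_jcoord_upd1 (F : FB -> C) i a t : in_jcoord s F (jcoord_upd rho0 i (mnm1 a) (rho0 i (mnm1 a) + t)) =
  F (jet 1 (fun z => s (c x + z *m (1%:M + t *: delta_mx a i)))).
Proof.
have n0 : mnm1 a != @mnm0 m by rewrite mnm1_eq0.
rewrite in_jcoordE (base_upd _ _ _ n0) linear_upd1 base_rho0 linear_rho0.
by rewrite linearD linearZ /= trmx1 trmx_delta.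
Qed.

Lemma prolong_base_value Y H : tangent x (Y x) -> (forall i, hol_at (vcomp Y i) x) ->
  hol_at H x -> prolong c s Y (base_value H) rho0 = Y x H.
Proof.
move=> tY hY hH; rewrite prolong_rho0// (tangent_coord hV lc Ux tY hH); apply: eq_bigr => i _.
have dH := nbhs_singleton (hol_comp lc Ux hH).
have [dl dlE] := chain_line (delta_mx 0 i) dH.
have Ucx : (c @` U) (c x) by exists x.
rewrite (djcoord_near dl); last first.
  apply: filterS (line_near (delta_mx 0 i) (lc_near lc Ux)) => t Ut.
  rewrite in_jcoord_upd0 base_valueE; last exact: (invertible_affine lc Ut (unitmx1 _ m)).
  by rewrite mul0mx addr0.
rewrite dlE big1 ?addr0// => a _; rewrite (djcoord_cst (k := H x)) ?mulr0//.
apply: filterS (unitmx_near a i) => t ut.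
rewrite in_jcoord_upd1 base_valueE; last exact: (invertible_affine lc Ucx ut).
by rewrite mul0mx addr0 (lc_sr lc).
Qed.

Lemma coeff_affine X b (N : 'M[C]_m) a : (c @` U) b -> N \in unitmx ->
  tangent (s b) (X (s b)) -> a *m N = \row_i vcomp X i (s b) ->
  is_coeff X (fun z => s (b + z *m N)) a.
Proof.
move=> Ub uN tX aN h; have sb : s (b + 0 *m N) = s b by rewrite mul0mx addr0.
rewrite sb => hh; have [Us csb] := lc_rs lc Ub.
have [hr _] := invertible_affine lc Ub uN.
have dh := nbhs_singleton (hol_comp lc Us hh); rewrite csb in dh.
have hr' : differentiable (h \o (fun z => s (b + z *m N)) : 'rV[C]_m -> C) 0.
  by apply: germ_diff hr _; rewrite sb.
have E k : 'D_(delta_mx 0 k) (h \o (fun z => s (b + z *m N)) : 'rV[C]_m -> C) 0 =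
    \sum_i N k i * 'D_(delta_mx 0 i) (h \o s : 'rV[C]_m -> C) b.
  have [_ <-] := chain_line (delta_mx 0 k) hr'.
  have [_ E1] := chain_line (row k N) dh.
  transitivity ('D_(row k N) (h \o s : 'rV[C]_m -> C) b); last first.
    by rewrite derive_coord//; apply: eq_bigr => i _; rewrite mxE.
  rewrite -E1; apply: (congr1 (fun F : C -> C => 'D_1 F 0)); apply/funext => t /=.
  by rewrite add0r -scalemxAl rowE.
rewrite (tangent_coord hV lc Us tX hh) csb.
under [RHS]eq_bigr => k _ do rewrite E mulr_sumr.
rewrite exchange_big; apply: eq_bigr => i _.
under eq_bigr => k _ do rewrite mulrA.
rewrite -mulr_suml; congr (_ * _).
by have := congr1 (fun M : 'rV[C]_m => M 0 i) aN; rewrite !mxE => ->.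
Qed.

(** Changing the linear part by [t *: delta_mx i a] multiplies the row of components on the right by
    the inverse of [1%:M + t *: delta_mx a i], the transpose coming from row vectors; this is
    differentiated at [t = 0]. *)
Lemma djcoord_frame_coef X k (i a : 'I_m) : tangent x (X x) ->
  djcoord i (mnm1 a) (in_jcoord s (fun J : FB => frame_coef X J 0 k)) rho0 =
  - (vcomp X a x * (k == i)%:R).
Proof.
move=> tX; have Ucx : (c @` U) (c x) by exists x.
have [dG <-] := derive_elementary (i == a) (vcomp X k x) (vcomp X a x * (k == i)%:R).
apply: djcoord_near dG _.
apply: filterS2 (near_1D R (i == a)) (unitmx_near a i) => t n0 ut.
have sx : s (c x) = x by exact: (lc_sr lc).
pose e := t / (1 + t * (i == a)%:R).
pose v : 'rV[C]_m := \row_j vcomp X j x.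
have inv := mulmx1C (elementary_inverse n0).
have hv : is_coeff X (fun z => s (c x + z *m (1%:M + t *: delta_mx a i)))
    (v *m (1%:M - e *: delta_mx a i)).
  by apply: (coeff_affine Ucx ut); rewrite sx// -mulmxA inv mulmx1.
rewrite in_jcoord_upd1 (frame_coefE hV (invertible_affine lc Ucx ut) hv).
rewrite mulmxBr mulmx1 -scalemxAr !mxE; congr (_ - _ * _).
rewrite (bigD1 a)//= big1 ?addr0 => [|j ja]; last by rewrite !mxE (negPf ja) mulr0.
by rewrite !mxE eqxx.
Qed.

(** Moving the base point along [Y] differentiates the component of [X]; the induced motion of the
    frame contributes minus the derivative of the component of [Y] along [X]. Together they form a
    component of the bracket. *)
Lemma prolong_frame_coef X Y k : U `<=` [set y | tangent y (X y)] ->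
  (forall i, hol_at (vcomp X i) x) -> tangent x (Y x) -> (forall i, hol_at (vcomp Y i) x) ->
  prolong c s Y (fun J => frame_coef X J 0 k) rho0 = Y x (vcomp X k) - X x (vcomp Y k).
Proof.
move=> tX hX tY hY; rewrite prolong_rho0// big_split /=; congr (_ + _).
  have e i : djcoord i (@mnm0 m) (in_jcoord s (fun J : FB => frame_coef X J 0 k)) rho0 =
      'D_(delta_mx 0 i) (vcomp X k \o s : 'rV[C]_m -> C) (c x).
    have dX := nbhs_singleton (hol_comp lc Ux (hX k)).
    have [dl <-] := chain_line (delta_mx 0 i) dX.
    apply: djcoord_near dl _.
    apply: filterS (line_near (delta_mx 0 i) (lc_near lc Ux)) => t Ut.
    have [Us _] := lc_rs lc Ut; rewrite in_jcoord_upd0.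
    have hv : is_coeff X (fun z => s (c x + t *: delta_mx 0 i + z *m 1%:M))
        (\row_j vcomp X j (s (c x + t *: delta_mx 0 i))).
      by apply: (coeff_affine Ut (unitmx1 _ m) (tX _ Us)); rewrite mulmx1.
    by rewrite (frame_coefE hV (invertible_affine lc Ut (unitmx1 _ m)) hv) mxE.
  by rewrite (tangent_coord hV lc Ux tY (hX k)); apply: eq_bigr => i _; rewrite e.
rewrite (tangent_coord hV lc Ux (tX _ Ux) (hY k)) -sumrN exchange_big /=.
apply: eq_bigr => a _; rewrite (bigD1 k)//= big1 => [|i ik].
  by rewrite (djcoord_frame_coef _ _ _ (tX _ Ux)) eqxx mulr1 addr0 mulrN mulrC.
by rewrite (djcoord_frame_coef _ _ _ (tX _ Ux)) eq_sym (negPf ik) mulr0 oppr0 mulr0.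
Qed.

End AtPoint.
End Invariants.

(** * Commutation *)

Section Commutation.
Variables (R : realType) (V : atlas (cplx R)) (m : nat).
Local Notation C := (cplx R).
Hypothesis hV : smooth_irreducible_variety V m.
Implicit Types (g h H : V -> C) (x y : V) (U W S : set V) (X Y Z : vfield V).

Lemma tangent_zero x v : tangent x v -> v (fun=> 0) = 0.
Proof. exact: tangent_cst. Qed.

Lemma holvf_sub W S X : S `<=` W -> holvf W X -> holvf S X.
Proof. by move=> SW [tX hX]; split => [x /SW|x g /SW]; [exact: tX|exact: hX]. Qed.

Lemma bracketE X Y x g : hol_at g x ->
  bracket X Y x g = X x (fun y => Y y g) - Y x (fun y => X y g).
Proof. exact: on_germsT. Qed.

(** The equation of the section for the invariant [base_value H], read at the jet [rho0]. *)
Lemma section_derivative f W Y H : birational f -> first_integral f H ->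
  malgrange_section m f W Y -> generic (fun x => W x -> Y x H = 0).
Proof.
move=> bf fH [oW hY mY]; have [inv reg] := invariant_base_value hV bf fH.
refine (generic_sub _ (generic_and hV reg fH.1)) => x [rx rH] Wx.
have [U [c [s [lc Ux UW]]]] := coords_exist hV (oW x Wx).
have Ucx : (c @` U) (c x) by exists x.
have hYi i : hol_at (vcomp c Y i) x by apply: hY.2 => //; exact: (lc_hol lc).
rewrite -(prolong_base_value hV lc Ux (hY.1 x Wx) hYi (regular_hol rH)).
apply: (mY 1%N _ inv U c s UW lc).
- by rewrite base_rho0.
- by rewrite linear_rho0 unitmx1.
have -> : s \o taylor 1 (rho0 c x) = (fun z => s (c x + z *m 1%:M)).
  by apply/funext => z /=; rewrite taylor1 base_rho0 linear_rho0 trmx1.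
apply: rx; first exact: (invertible_affine lc Ucx (unitmx1 _ m)).
by rewrite mul0mx addr0 (lc_sr lc).
Qed.

(** The equations of the section for the components of [X] in a frame, read at [rho0], kill every
    coordinate of the bracket. Coordinates are taken inside [W] and the open set where [X] is
    holomorphic. *)
Lemma section_bracket f W X Y : birational f -> ratvf X ->
  generic (fun x => forall h, hol_at h (f x) -> X x (h \o f) = X (f x) h) ->
  malgrange_section m f W Y -> generic (fun x => W x -> bracket Y X x = (fun=> 0)).
Proof.
move=> bf rX iX [oW hY mY].
have reg := generic_all hV (fun k => (invariant_frame_coef hV k bf rX iX).2).
have [S [zS S0 hX _]] := rX; have gS : generic S by exists S.
refine (generic_sub _ (generic_and hV reg gS)) => x [rx Sx] Wx.
have oWS : aopen (W `&` S).
  by move=> y [Wy Sy]; apply: anbhsI; [exact: oW|exact: zopen_anbhs].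
have WSx : (W `&` S) x by [].
have [U [c [s [lc Ux UWS]]]] := coords_exist hV (oWS x WSx).
have Ucx : (c @` U) (c x) by exists x.
have UW : U `<=` W by move=> y /UWS[].
have tX : U `<=` [set y | tangent y (X y)] by move=> y /UWS[_ Sy]; exact: hX.1.
have hYi i : hol_at (vcomp c Y i) x by apply: hY.2 => //; exact: (lc_hol lc).
have hXi i : hol_at (vcomp c X i) x by apply: hX.2 => //; exact: (lc_hol lc).
have tb : tangent x (bracket Y X x).
  apply: (bracket_tangent hV oWS _ _ WSx).
  - by apply: holvf_sub hY => y [].
  - by apply: holvf_sub hX => y [].
apply: (tangent_ext hV lc Ux tb (tangent0 hV x)) => k.
rewrite bracketE; last exact: (lc_hol lc).
rewrite -[LHS]/(Y x (vcomp c X k) - X x (vcomp c Y k)).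
rewrite -(prolong_frame_coef hV lc Ux _ tX hXi (hY.1 x Wx) hYi).
apply: (mY 1%N _ (invariant_frame_coef hV k bf rX iX).1 U c s UW lc).
- by rewrite base_rho0.
- by rewrite linear_rho0 unitmx1.
have -> : s \o taylor 1 (rho0 c x) = (fun z => s (c x + z *m 1%:M)).
  by apply/funext => z /=; rewrite taylor1 base_rho0 linear_rho0 trmx1.
apply: (rx k); first exact: (invertible_affine lc Ucx (unitmx1 _ m)).
by rewrite mul0mx addr0 (lc_sr lc).
Qed.

(* Cartan's formula on X, Y and a coordinate field Z reduces to w([X, Y], Z) = 0. *)
Lemma gradients_commute (w : form2 V) S X Y HX HY : holomorphic_form w ->
  nondegenerate_form w -> closed_form w -> aopen S -> holvf S X -> holvf S Y ->
  (forall x, S x -> hol_at HX x) -> (forall x, S x -> hol_at HY x) ->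
  (forall x v, S x -> tangent x v -> v HX = w x (X x) v) ->
  (forall x v, S x -> tangent x v -> v HY = w x (Y x) v) ->
  (forall x, S x -> X x HY = 0) -> (forall x, S x -> Y x HX = 0) ->
  forall x, S x -> bracket X Y x = (fun=> 0).
Proof.
move=> hw nd cl oS hX hY hHX hHY gX gY XHY YHX x Sx.
have [U [c [s [lc Ux US]]]] := coords_exist hV (oS x Sx).
have oU : aopen U by case: lc.
have hXU := holvf_sub US hX; have hYU := holvf_sub US hY.
have tb := bracket_tangent hV oU hXU hYU Ux.
apply: (nd x _ tb) => v tv; rewrite (tangentE hV lc Ux tv).
set a := (\row_k _).
have [Z <- hZ] : exists2 Z, Z x = coord_vec c s x a & holvf U Z.
  by exists (fun y => coord_vec c s y a); last exact: (holvf_coord_vec hV lc).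
have tX := hXU.1 x Ux; have tY := hYU.1 x Ux; have tZ := hZ.1 x Ux.
have near0 u (F G : V -> C) : tangent x u -> (forall y, U y -> F y = G y) -> u F = u G.
  by move=> tu FG; apply: (tangent_germ hV tu); exact: anbhs_sub (oU x Ux).
have E1 : X x (fun y => w y (Y y) (Z y)) = X x (fun y => Z y HY).
  by apply: (near0 _ _ _ tX) => y Uy; exact: esym (gY y _ (US y Uy) (hZ.1 y Uy)).
have E2 : Y x (fun y => w y (X y) (Z y)) = Y x (fun y => Z y HX).
  by apply: (near0 _ _ _ tY) => y Uy; exact: esym (gX y _ (US y Uy) (hZ.1 y Uy)).
have E3 : Z x (fun y => w y (X y) (Y y)) = 0.
  rewrite -(tangent_zero tZ); apply: (near0 _ _ _ tZ) => y Uy.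
  by rewrite -(gX y _ (US y Uy) (hYU.1 y Uy)) (YHX y (US y Uy)).
have E4 : Z x (fun y => X y HY) = 0.
  by rewrite -(tangent_zero tZ); apply: (near0 _ _ _ tZ) => y Uy; exact: XHY (US y Uy).
have E4' : Z x (fun y => Y y HX) = 0.
  by rewrite -(tangent_zero tZ); apply: (near0 _ _ _ tZ) => y Uy; exact: YHX (US y Uy).
have E5 : w x (bracket X Z x) (Y x) = - X x (fun y => Z y HY).
  have tXZ := bracket_tangent hV oU hXU hZ Ux.
  rewrite (form_alternating hw tXZ tY) -(gY x _ Sx tXZ) (bracketE X Z (hHY x Sx)).
  by rewrite E4 subr0.
have E6 : w x (bracket Y Z x) (X x) = - Y x (fun y => Z y HX).
  have tYZ := bracket_tangent hV oU hYU hZ Ux.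
  rewrite (form_alternating hw tYZ tX) -(gX x _ Sx tYZ) (bracketE Y Z (hHX x Sx)).
  by rewrite E4' subr0.
have := cl U X Y Z oU hXU hYU hZ x Ux; rewrite E1 E2 E3 E5 E6.
move: (w x _ _) (X x _) (Y x _) => T A B E.
by apply: oppr_inj; rewrite oppr0 -E; ring.
Qed.

(** The kernel of [A^T] has rank [m - k = l], already reached by the rows of [B]. *)
Lemma span_kernel k l (A : 'M[C]_(k, m)) (B : 'M[C]_(l, m)) (b : 'rV[C]_m) :
  (k + l)%N = m -> row_free A -> row_free B -> B *m A^T = 0 -> b *m A^T = 0 ->
  exists u : 'rV[C]_l, b = u *m B.
Proof.
move=> kl fA fB BA bA; apply/submxP.
have BK : (B <= kermx A^T)%MS by apply/sub_kermxP.
have bK : (b <= kermx A^T)%MS by apply/sub_kermxP.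
apply: submx_trans bK _; rewrite -(geq_leqif (mxrank_leqif_sup BK)).
rewrite mxrank_ker mxrank_tr; move/eqP: fA => ->; move/eqP: fB => ->.
by rewrite -kl addKn.
Qed.

Lemma bracket0_comm X Y x g : bracket X Y x = (fun=> 0) -> hol_at g x ->
  X x (fun y => Y y g) = Y x (fun y => X y g).
Proof.
move=> E hg; have := congr1 (fun F : tvec V => F g) E.
by rewrite (bracketE X Y hg) => /subr0_eq.
Qed.

(* X(Y g) = \sum_i c_i X_i(Y g) = \sum_i c_i Y(X_i g) = \sum_(i, j) c_i d_j X_j(X_i g) *)
Lemma span_commute l (E : 'I_l -> vfield V) (c d : 'I_l -> C) X Y x :
  X x = (fun g => \sum_j c j * E j x g) -> Y x = (fun g => \sum_j d j * E j x g) ->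
  (forall j, bracket X (E j) x = (fun=> 0)) -> (forall j, bracket Y (E j) x = (fun=> 0)) ->
  (forall i j, bracket (E i) (E j) x = (fun=> 0)) -> bracket X Y x = (fun=> 0).
Proof.
move=> XE YE bX bY bE; apply/funext => g.
have [hg|hg] := pselect (hol_at g x); last by rewrite /bracket on_germsF.
rewrite bracketE//; apply/eqP; rewrite subr_eq0; apply/eqP.
have e1 : X x (fun y => Y y g) = \sum_i \sum_j c i * (d j * E j x (fun y => E i y g)).
  rewrite XE; apply: eq_bigr => i _; rewrite -(bracket0_comm (bY i) hg) YE mulr_sumr.
  by [].
have e2 : Y x (fun y => X y g) = \sum_j \sum_i d j * (c i * E i x (fun y => E j y g)).
  rewrite YE; apply: eq_bigr => i _; rewrite -(bracket0_comm (bX i) hg) XE mulr_sumr.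
  by [].
rewrite e1 e2 exchange_big; apply: eq_bigr => j _; apply: eq_bigr => i _.
by rewrite mulrCA (bracket0_comm (bE j i) hg).
Qed.

End Commutation.

Lemma row_free_inj (F : fieldType) p q (A : 'M[F]_(p, q)) :
  (forall u : 'rV[F]_p, u *m A = 0 -> u = 0) -> row_free A.
Proof.
move=> h; rewrite -kermx_eq0; apply/eqP/row_matrixP => i; rewrite row0.
by apply: h; rewrite -row_mul mulmx_ker row0.
Qed.

(** * Sections of the Lie algebra for an integrable map *)

Section Integrable.
Variables (R : realType) (V : atlas (cplx R)) (n l : nat).
Local Notation C := (cplx R).
Local Notation m := (2 * n)%N.
Hypothesis hV : smooth_irreducible_variety V m.
Variable w : form2 V.
Hypotheses (hw : holomorphic_form w) (hnd : nondegenerate_form w) (hcl : closed_form w).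
Variables (H : 'I_(n + l) -> V -> C) (E : 'I_(n - l) -> vfield V).
Hypothesis ln : (l <= n)%N.
Implicit Types (x y : V) (X Y : vfield V).

Lemma low_index_inj : injective (@low_index n l).
Proof. by move=> i j /(congr1 val)/= /val_inj. Qed.

(* The [n - l] Hamiltonian vectors are independent and killed by the [n + l]
   independent differentials, so they span their common kernel. *)
Lemma kernel_span x u : (forall i, hol_at (H i) x) -> (forall j, tangent x (E j x)) ->
  (forall c : 'I_(n + l) -> C,
    (forall v, tangent x v -> \sum_(i < n + l) c i * v (H i) = 0) -> forall i, c i = 0) ->
  (forall j v, tangent x v -> v (H (low_index j)) = w x (E j x) v) ->
  (forall j i, E j x (H i) = 0) -> tangent x u -> (forall i, u (H i) = 0) ->
  exists c : 'I_(n - l) -> C, u = (fun g => \sum_j c j * E j x g).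
Proof.
move=> hH tE ind gE EH tu uH.
have [U [c [s [lc Ux _]]]] := coords_exist hV (@anbhsT _ _ x).
pose co (v : tvec V) : 'rV[C]_m := \row_k v (fun y => c y 0 k).
pose A : 'M[C]_(n + l, m) := \matrix_(i, k) pd c s (delta_mx 0 k) (H i) x.
pose B : 'M[C]_(n - l, m) := \matrix_(j, k) co (E j x) 0 k.
have vH v i : tangent x v -> v (H i) = \sum_k co v 0 k * A i k.
  move=> tv; rewrite (tangent_coord hV lc Ux tv (hH i)); apply: eq_bigr => k _.
  by rewrite !mxE.
have fA : row_free A.
  apply: row_free_inj => d dA; apply/rowP => i; rewrite [RHS]mxE; move: i.
  apply: ind => v tv; under eq_bigr => i _ do rewrite (vH _ i tv) mulr_sumr.
  rewrite exchange_big big1// => k _.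
  have := congr1 (fun M : 'rV[C]_m => M 0 k) dA; rewrite [RHS]mxE mxE => dAk.
  by under eq_bigr => i _ do rewrite mulrCA; rewrite -mulr_sumr dAk mulr0.
have fB : row_free B.
  apply: row_free_inj => d dB; pose T : tvec V := fun g => \sum_j d 0 j * E j x g.
  have T0 : T = (fun=> 0).
    apply: (tangent_ext hV lc Ux (tangent_sumZ hV _ _ tE) (tangent0 hV x)) => k.
    have := congr1 (fun M : 'rV[C]_m => M 0 k) dB; rewrite [RHS]mxE mxE => dBk.
    by rewrite -[RHS]dBk; apply: eq_bigr => j _; rewrite !mxE.
  (* [d] extended by 0 beyond the low indices: the differential with coefficients [e] is w (T, .),
     hence 0, and the independence of the differentials applies. *)
  pose e i := \sum_j d 0 j * (low_index j == i)%:R.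
  have e0 : forall i, e i = 0.
    apply: ind => v tv; under eq_bigr => i _ do rewrite mulr_suml.
    rewrite exchange_big /=; transitivity (w x T v); last by rewrite T0 (form0 hV hw tv).
    rewrite (form_sum hV hw _ _ tE tv); apply: eq_bigr => j _.
    rewrite (bigD1 (low_index j))//= eqxx mulr1 (gE j v tv) big1 ?addr0// => i ij.
    by rewrite eq_sym (negPf ij) mulr0 mul0r.
  apply/rowP => j; rewrite [RHS]mxE -[RHS](e0 (low_index j)) /e (bigD1 j)//= eqxx mulr1.
  rewrite big1 ?addr0// => i ij.
  by rewrite (inj_eq low_index_inj) (negPf ij) mulr0.
have BA : B *m A^T = 0.
  apply/matrixP => j i; rewrite [RHS]mxE -(EH j i) (vH _ i (tE j)) mxE.
  by apply: eq_bigr => k _; rewrite !mxE.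
have bA : co u *m A^T = 0.
  apply/rowP => i; rewrite [RHS]mxE -(uH i) (vH _ i tu) mxE.
  by apply: eq_bigr => k _; rewrite [X in _ * X]mxE.
have kl : (n + l + (n - l) = m)%N by rewrite mul2n -addnn -addnA subnKC.
have [d du] := span_kernel kl fA fB BA bA; exists (fun j => d 0 j).
apply: (tangent_ext hV lc Ux tu (tangent_sumZ hV _ _ tE)) => k.
have := congr1 (fun M : 'rV[C]_m => M 0 k) du; rewrite !mxE => ->.
by apply: eq_bigr => j _; rewrite !mxE.
Qed.

Variable f : V -> V.
Hypotheses (bf : birational f) (pf : preserves f w).
Hypothesis fH : forall i, first_integral f (H i).
Hypothesis indH : functionally_independent H.
Hypothesis gradE : forall j, symplectic_gradient w (H (low_index j)) (E j).
Hypothesis kerE : kernel_generated_by H E.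

(** [E j] is trivially in the span of the generators, so it lies in the kernel distribution.
    Isotropy enters here: the Hamiltonian fields annihilate all the first integrals, in particular
    each other's. *)
Lemma gradient_kills j i : generic (fun x => E j x (H i) = 0).
Proof.
have [rE _] := gradE j; move: i; apply: (proj2 (kerE rE)).
exists (fun k _ => (k == j)%:R); split.
  move=> k; refine (generic_sub _ (generic_true hV)) => x _ i dx.
  exact: reg_cst.
refine (generic_sub _ (generic_true hV)) => x _; apply/funext => g.
rewrite (bigD1 j)//= eqxx mul1r big1 ?addr0// => k kj.
by rewrite (negPf kj) mul0r.
Qed.

(** The generic conditions are gathered on one open set, because the commutation of gradients
    requires them on a neighborhood and not just at one point. *)
Lemma generic_gradients : exists S : set V, [/\ zopen S, S !=set0, forall j, holvf S (E j) &
  forall x, S x -> [/\ forall i, hol_at (H i) x,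
    forall j v, tangent x v -> v (H (low_index j)) = w x (E j x) v,
    forall j i, E j x (H i) = 0 &
    forall c : 'I_(n + l) -> C,
      (forall v, tangent x v -> \sum_(i < n + l) c i * v (H i) = 0) -> forall i, c i = 0]].
Proof.
have g1 : generic (fun x => forall i, hol_at (H i) x).
  apply: (generic_all hV) => i; refine (generic_sub _ (fH i).1) => x; exact: regular_hol.
have g2 : generic (fun x => forall j, tangent x (E j x) /\
    forall g, hol_at g x -> hol_at (fun y => E j y g) x).
  apply: (generic_all hV) => j; have [[S [zS S0 [tS hS] _]] _] := gradE j.
  by exists S; split => // x Sx; split; [exact: tS|move=> g; exact: hS].
have g3 := generic_all hV (fun j => (gradE j).2).
have g4 := generic_all hV (fun j => generic_all hV (gradient_kills j)).
have [S [zS S0 hS]] := generic_and hV (generic_and hV g1 g2) (generic_and hV g3 (generic_and hV g4 indH)).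
exists S; split => //.
- move=> j; split=> [x /hS[[_ h] _]|x g /hS[[_ h] _]]; first exact: (h j).1.
  exact: (h j).2.
- by move=> x /hS[[h1 _] [h3 [h4 h5]]]; split.
Qed.

Lemma sections_commute_generic W X Y : malgrange_section m f W X -> malgrange_section m f W Y ->
  generic (fun x => W x -> bracket X Y x = (fun=> 0)).
Proof.
move=> sX sY; have [oW hX _] := sX; have [_ hY _] := sY.
have [S [zS S0 hE hS]] := generic_gradients.
have iE j := invariant_gradient hV hw hnd bf pf (fH (low_index j)) (gradE j).
have gX := generic_all hV (fun i => section_derivative hV bf (fH i) sX).
have gY := generic_all hV (fun i => section_derivative hV bf (fH i) sY).
have gXE := generic_all hV (fun j => section_bracket hV bf (gradE j).1 (iE j) sX).
have gYE := generic_all hV (fun j => section_bracket hV bf (gradE j).1 (iE j) sY).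
have gS : generic S by exists S.
refine (generic_sub _ (generic_and hV gS (generic_and hV (generic_and hV gX gY) (generic_and hV gXE gYE)))).
move=> x [Sx [[Xx Yx] [XEx YEx]]] Wx; have [hHx gEx EHx indx] := hS x Sx.
have tE j : tangent x (E j x) by exact: (hE j).1.
have span u := @kernel_span x u hHx tE indx gEx EHx.
have [c Xc] := span (X x) (hX.1 x Wx) (fun i => Xx i Wx).
have [d Yd] := span (Y x) (hY.1 x Wx) (fun i => Yx i Wx).
apply: (span_commute (E := E) Xc Yd).
- by move=> j; exact: XEx.
- by move=> j; exact: YEx.
move=> i j; have oS : aopen S by move=> y; exact: zopen_anbhs.
apply: (gradients_commute hV hw hnd hcl oS (hE i) (hE j)
  (HX := H (low_index i)) (HY := H (low_index j)) _ _ _ _ _ _ Sx) => y.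
- by move=> /hS[h _ _ _]; exact: h.
- by move=> /hS[h _ _ _]; exact: h.
- by move=> v /hS[_ h _ _]; exact: h.
- by move=> v /hS[_ h _ _]; exact: h.
- by move=> /hS[_ _ h _]; exact: h.
- by move=> /hS[_ _ h _]; exact: h.
Qed.

Lemma sections_commute W X Y : malgrange_section m f W X -> malgrange_section m f W Y ->
  forall x, W x -> bracket X Y x = (fun=> 0).
Proof.
move=> sX sY x Wx; have gen := sections_commute_generic sX sY.
have [oW hX _] := sX; have [_ hY _] := sY.
have [U [c [s [lc Ux UW]]]] := coords_exist hV (oW x Wx).
have tb := bracket_tangent hV oW hX hY Wx.
apply: (tangent_ext hV lc Ux tb (tangent0 hV x)) => k.
pose ck y := c y 0 k.
(* A component of the bracket as a holomorphic function: where it is nonzero it stays nonzero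
   nearby, and a generic point there gives a contradiction. *)
pose b y := X y (fun y' => Y y' ck) - Y y (fun y' => X y' ck).
have hck : hol_at ck x by exact: (lc_hol lc).
have hb : hol_at b x.
  apply: hol_add; first by apply: hX.2 => //; exact: hY.2.
  by apply: hol_opp; apply: hY.2 => //; exact: hX.2.
rewrite (bracketE X Y hck) -[LHS]/(b x); apply/eqP/negPn/negP => bx.
have [y [[Uy by0] gy]] := generic_near hV gen (anbhsI (lc_open lc Ux) (hol_neq0 hb bx)).
move/eqP: by0; apply.
have hcy : hol_at ck y by exact: (lc_hol lc).
by rewrite -[LHS](bracketE X Y hcy) (gy (UW y Uy)).
Qed.

End Integrable.

Theorem theorem2 (R : realType) (n : nat) (hn : (1 <= n)%N)
  (V : atlas R[i]) (hV : smooth_irreducible_variety V (2 * n))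
  (w : form2 V) (hw : holomorphic_form w)
  (hw_nondeg : nondegenerate_form w) (hw_closed : closed_form w)
  (f : V -> V) (hf : birational f) (hfw : preserves f w)
  (hint : integrable_isotropic n w f) :
  forall (W : set V) (X Y : vfield V),
    malgrange_section (2 * n) f W X ->
    malgrange_section (2 * n) f W Y ->
    forall x, W x -> bracket X Y x = (fun=> 0).
Proof.
move=> W X Y sX sY; have [l [ln [H [E [fH indH gradE kerE]]]]] := hint.
exact: (@sections_commute R V n l hV w hw hw_nondeg hw_closed H E ln f hf hfw fH indH gradE kerE W X Y sX sY).
Qed.
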